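(* Let $\rho^1,\rho^2\in\mathbb{R}$ with $\rho^2>\rho^1$. Let $f_0\in H^s(\mathbb{R}^2)$ (real-valued) with $s\ge4$ and $\|\nabla f_0\|_{L^\infty}<1/3$. Then the unique solution $f$, in $C([0,T];H^s(\mathbb{R}^2))$ for any $T>0$ within its time of existence, of $$f_t(x,t)=\frac{\rho^2-\rho^1}{4\pi}\,\mathrm{PV}\!\int_{\mathbb{R}^2}\frac{(\nabla f(x,t)-\nabla f(x-y,t))\cdot y}{[|y|^2+(f(x,t)-f(x-y,t))^2]^{3/2}}\,dy,\qquad f(x,0)=f_0(x),\quad x\in\mathbb{R}^2,$$ satisfies $$\|\nabla f\|_{L^\infty}(t)<1/3\qquad\text{for all } t>0 \text{ in its interval of existence}.$$
   Context: Here $\|\nabla f\|_{L^\infty}(t)=\sup_{x\in\mathbb{R}^2}|\nabla f(x,t)|$ with $|\cdot|$ the Euclidean norm on $\mathbb{R}^2$. The principal value is $\mathrm{PV}\int_{\mathbb{R}^2}=\lim_{\epsilon\to0,\,R\to\infty}\int_{\epsilon<|y|<R}$. The equation is the contour equation of the 3D Muskat problem ($\rho^1$, $\rho^2$ the densities of the upper and lower fluid); for $\rho^2>\rho^1$ it is known to be locally well posed in $H^s(\mathbb{R}^2)$, so the solution exists and is unique on some time interval. *)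

(* Defs.v *)
From HB Require Import structures.
From mathcomp Require Import all_boot all_order all_algebra.
From mathcomp Require Import all_classical all_reals all_analysis.
From mathcomp Require Import measurable_realfun.

Set Implicit Arguments.
Unset Strict Implicit.
Unset Printing Implicit Defensive.

Import Order.TTheory GRing.Theory Num.Theory.
Import numFieldNormedType.Exports.

Local Open Scope classical_set_scope.
Local Open Scope ring_scope.

Notation lebesgue2 := (@lebesgue_measure _ \x @lebesgue_measure _)%E.

Section plane.
Context {R : realType}.

Definition dotp (x y : R * R) : R := x.1 * y.1 + x.2 * y.2.

(* The library norm on R * R is the maximum norm, hence a separate one. *)
Definition enorm (x : R * R) : R := Num.sqrt (dotp x x).

Definition grad (f : R * R -> R) (x : R * R) : R * R :=
  ('D_(1, 0) f x, 'D_(0, 1) f x).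

Definition sup_grad (f : R * R -> R) : \bar R :=
  ereal_sup (range (fun x => (enorm (grad f x))%:E)).

End plane.

Section sobolev.
Context {R : realType}.
Implicit Types (f : R * R -> R) (s : R).

(* Real and imaginary parts of the integral of f(x) e^{- i x . xi} over the
   disc |x| < r. *)
Definition trunc_fourier_re f (r : R) (xi : R * R) : R :=
  \int[lebesgue2]_(x in [set x | enorm x < r]) (f x * cos (dotp x xi)).

Definition trunc_fourier_im f (r : R) (xi : R * R) : R :=
  \int[lebesgue2]_(x in [set x | enorm x < r]) (- (f x * sin (dotp x xi))).

(* a + i b is the Fourier-Plancherel transform of f, i.e. the limit in L^2 of
   the truncated transforms; it is unique up to a null set. *)
Definition is_fourier f (a b : R * R -> R) : Prop :=
  [/\ a \in Lfun lebesgue2 2%:E, b \in Lfun lebesgue2 2%:E &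
   (fun r : R => (\int[lebesgue2]_xi
      ((trunc_fourier_re f r xi - a xi) ^+ 2
       + (trunc_fourier_im f r xi - b xi) ^+ 2)%:E)%E)
     @ pinfty_nbhs R --> 0%E].

Definition sobolev_energy s (a b : R * R -> R) : \bar R :=
  (\int[lebesgue2]_xi
     ((1 + dotp xi xi) `^ s * (a xi ^+ 2 + b xi ^+ 2))%:E)%E.

(* All Fourier transforms of f give the same energy; the infimum selects this
   common value, and is +oo when f has no transform in L^2. *)
Definition sobolev_norm s f : \bar R :=
  sqrte (ereal_inf [set sobolev_energy s ab.1 ab.2 |
                    ab in [set ab | is_fourier f ab.1 ab.2]]).

(* An element of H^s is a class of functions modulo null sets. For s > 1 each
   class contains exactly one continuous function, by which it is represented
   here, so that pointwise values and derivatives make sense. *)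
Definition sobolev s f : Prop :=
  [/\ continuous f, f \in Lfun lebesgue2 2%:E & (sobolev_norm s f < +oo)%E].

(* f belongs to C([0, T]; H^s), where f t x stands for f(x, t). *)
Definition continuous_sobolev s (T : R) (f : R -> R * R -> R) : Prop :=
  forall t0 : R, 0 <= t0 <= T ->
    sobolev s (f t0) /\
    (fun t : R => sobolev_norm s (f t \- f t0))
      @ within [set t : R | 0 <= t <= T] (nbhs t0) --> 0%E.

End sobolev.

Section muskat.
Context {R : realType}.

Definition is_PV (h : R * R -> R) (l : R) : Prop :=
  (fun er : R * R =>
     \int[lebesgue2]_(y in [set y | er.1 < enorm y < er.2]) h y)
    @ filter_prod (at_right (0 : R)) (pinfty_nbhs R) --> l.

Definition muskat_integrand (f : R * R -> R) (x y : R * R) : R :=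
  dotp (grad f x - grad f (x - y)) y
  / (enorm y ^+ 2 + (f x - f (x - y)) ^+ 2) `^ (3 / 2).

(* f is a solution on [0, T] in the class C([0, T]; H^s). *)
Definition muskat_solution (rho1 rho2 s T : R) (f0 : R * R -> R)
    (f : R -> R * R -> R) : Prop :=
  [/\ continuous_sobolev s T f,
      forall x, f 0 x = f0 x &
      forall (t : R) (x : R * R), 0 < t < T ->
        exists2 l, is_PV (muskat_integrand (f t) x) l &
          is_derive t (1 : R) (fun u : R => f u x)
            ((rho2 - rho1) / (4 * pi) * l)].

End muskat.

(* Main.v *)
(* Let D_h f(x) = f(x + h) - f(x). The proof shows that the Lipschitz constant
   of f(., t) does not increase, by a maximum principle for D_h f, so that no
   derivative of the equation is taken.

   Fourier inversion and s >= 4 give, through a bound of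
   (1 + |xi|^2) f^ in L^1, uniform bounds of f, of its Lipschitz constant and of
   its first order Taylor remainder by the H^s norm; in particular f(., t) is
   continuous in t for the Lipschitz seminorm and vanishes at infinity.

   Suppose that D_h f(., t) has a maximum at x. Then f has the same gradient p at
   x and at x + h, and f(x) - f(x - y) <= f(x + h) - f(x + h - y) for all y.
   With u = f(x) - f(x - y) the integrand of the equation is
     (p . y - u) / (|y|^2 + u^2)^(3/2) - |y|^(-2) (y . grad)(u / (|y|^2 + u^2)^(1/2)),
   where the first term decreases in u if 5 L^2 <= 1 for a Lipschitz constant L
   of f, and the second ones contribute nothing to the difference of the two
   principal values. Hence the time
   derivative of D_h f is nonpositive at its maximum, and sup D_h f cannot grow
   as long as 5 L^2 <= 1. Since 5 / 9 <= 1, a continuation argument keeps f(., t)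
   Lipschitz with the constant sup |grad f0| < 1/3. *)
From HB Require Import structures.
Require Import Defs.
From mathcomp Require Import all_boot all_order all_algebra.
From mathcomp Require Import all_classical all_reals all_analysis.
From mathcomp Require Import measurable_realfun.
From mathcomp Require Import ring lra.

Set Implicit Arguments.
Unset Strict Implicit.
Unset Printing Implicit Defensive.

Import Order.TTheory GRing.Theory Num.Theory.
Import numFieldNormedType.Exports.

Local Open Scope classical_set_scope.
Local Open Scope ring_scope.

(** The equation provides, at each x separately, a principal value with no rate in its two
    independent radii and a time derivative with no uniformity in x. The comparison of two principal
    values therefore rests on one good annulus at every pair of scales, which leaves the freedom to
    pick its radii by a mean value argument. Likewise the supremum over x is never differentiated in
    time: D_h f - e t is maximised over space and time together, and the equation is used at the
    point of maximum only.

    Equality of the two gradients acts twice: it puts the same linear term into both main parts, and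
    it cancels the direction-dependent limits of the two slopes at the origin, so that no
    cancellation over directions has to be exploited.

    The norm of H^s is built on L^2 limits of truncated transforms, so inversion is recovered from
    an approximate identity. Products of one-dimensional Poisson kernels serve for this, since their
    integrals all come from explicit antiderivatives. The gap between sup |grad f0| and 1/3 is what
    lets the continuation start. *)

Section measurability.
Context d (T : measurableType d) {R : realType}.
Implicit Types h : T -> R.

Lemma measurable_cosf h : measurable_fun setT h -> measurable_fun setT (fun x => cos (h x)).
Proof. by apply: measurableT_comp; apply: continuous_measurable_fun; exact: continuous_cos. Qed.

Lemma measurable_sinf h : measurable_fun setT h -> measurable_fun setT (fun x => sin (h x)).
Proof. by apply: measurableT_comp; apply: continuous_measurable_fun; exact: continuous_sin. Qed.

Lemma measurable_expRf h : measurable_fun setT h -> measurable_fun setT (fun x => expR (h x)).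
Proof. by apply: measurableT_comp; exact: measurable_expR. Qed.

Lemma measurable_normf h : measurable_fun setT h -> measurable_fun setT (fun x => `|h x|).
Proof. by apply: measurableT_comp; exact: normr_measurable. Qed.

Lemma measurable_sqrtf h : measurable_fun setT h -> measurable_fun setT (fun x => Num.sqrt (h x)).
Proof. by apply: measurableT_comp; apply: continuous_measurable_fun; exact: sqrt_continuous. Qed.

Lemma measurable_powRf p h : measurable_fun setT h -> measurable_fun setT (fun x => h x `^ p).
Proof. by move=> mh; exact: (measurableT_comp (measurable_powR p) mh). Qed.

(** Inversion is not continuous at 0. Written as y * (y^2)^(-1) it reduces to a measurable real
    power, and at 0 both sides vanish by convention. *)
Lemma measurable_invf h : measurable_fun setT h -> measurable_fun setT (fun x => (h x)^-1).
Proof.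
apply: (@measurableT_comp _ _ _ _ _ _ (fun y : R => y^-1)).
have -> : (fun y : R => y^-1) = (fun y => y * ((y ^+ 2) `^ (-1))).
  apply/funext => y; rewrite powRN powRr1 ?sqr_ge0//.
  by have [->|y0] := eqVneq y 0; [rewrite invr0 mul0r | field].
apply: measurable_funM; first exact: measurable_id.
by apply: (measurableT_comp (measurable_powR _)); exact: exprn_measurable.
Qed.

End measurability.

Section measurability_pair.
Context d d1 d2 (T : measurableType d) (T1 : measurableType d1) (T2 : measurableType d2).
Implicit Types h : T -> T1 * T2.

Lemma measurable_fstf h : measurable_fun setT h -> measurable_fun setT (fun x => (h x).1).
Proof. by apply: measurableT_comp; exact: measurable_fst. Qed.

Lemma measurable_sndf h : measurable_fun setT h -> measurable_fun setT (fun x => (h x).2).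
Proof. by apply: measurableT_comp; exact: measurable_snd. Qed.

End measurability_pair.

(** The lemmas above are stated for composites [fun x => op (h x)], so that applying them backwards
    takes an expression apart down to constants, projections and hypotheses. *)
Ltac meas := repeat first
 [ assumption
 | apply: measurable_cst | apply: measurable_id
 | apply: measurable_fst | apply: measurable_snd
 | apply: measurable_funX
 | apply: measurable_fun_pair
 | apply: measurable_cosf | apply: measurable_sinf | apply: measurable_expRf
 | apply: measurable_normf | apply: measurable_sqrtf | apply: measurable_powRf
 | apply: measurable_invf
 | apply: measurable_funD | apply: measurable_funM | apply: measurable_funN
 | apply: measurable_fstf | apply: measurable_sndf ].

(** * The Euclidean structure of the plane *)

Section euclidean_plane.
Context {R : realType}.
Implicit Types x y z : R * R.

Lemma dotpC x y : dotp x y = dotp y x.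
Proof. by rewrite /dotp mulrC (mulrC x.2). Qed.

Lemma dotpDl x y z : dotp (x + y) z = dotp x z + dotp y z.
Proof. rewrite /dotp/=; ring. Qed.

Lemma dotpBl x y z : dotp (x - y) z = dotp x z - dotp y z.
Proof. rewrite /dotp/=; ring. Qed.

Lemma dotpDr x y z : dotp z (x + y) = dotp z x + dotp z y.
Proof. rewrite /dotp/=; ring. Qed.

Lemma dotpZr (k : R) x z : dotp z (k *: x) = k * dotp z x.
Proof. rewrite /dotp/= /GRing.scale/=; ring. Qed.

Lemma dotpZl (k : R) x z : dotp (k *: x) z = k * dotp x z.
Proof. rewrite /dotp/= /GRing.scale/=; ring. Qed.

Lemma dotpp_ge0 x : 0 <= dotp x x.
Proof. by rewrite addr_ge0// -expr2 sqr_ge0. Qed.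

Lemma enorm_ge0 x : 0 <= enorm x.
Proof. exact: sqrtr_ge0. Qed.

Lemma sqr_enorm x : enorm x ^+ 2 = dotp x x.
Proof. by rewrite sqr_sqrtr// dotpp_ge0. Qed.

Lemma ler_enorm (a : R) x : 0 <= a -> dotp x x <= a ^+ 2 -> enorm x <= a.
Proof. by move=> a0 h; rewrite -(ger0_norm a0) -sqrtr_sqr ler_wsqrtr. Qed.

Lemma norm_dotp x y : `|dotp x y| <= enorm x * enorm y.
Proof.
rewrite -sqrtrM ?dotpp_ge0// -sqrtr_sqr ler_wsqrtr// /dotp.
have := sqr_ge0 (x.1 * y.2 - x.2 * y.1); lra.
Qed.

Lemma norm_fst_enorm x : `|x.1| <= enorm x.
Proof. by rewrite -sqrtr_sqr ler_wsqrtr// /dotp expr2 lerDl -expr2 sqr_ge0. Qed.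

Lemma norm_snd_enorm x : `|x.2| <= enorm x.
Proof. by rewrite -sqrtr_sqr ler_wsqrtr// /dotp expr2 lerDr -expr2 sqr_ge0. Qed.

Lemma enorm_le_norm1 x : enorm x <= `|x.1| + `|x.2|.
Proof.
apply: ler_enorm; first by rewrite addr_ge0.
rewrite /dotp -!expr2 -(real_normK (num_real x.1)) -(real_normK (num_real x.2)).
have := mulr_ge0 (normr_ge0 x.1) (normr_ge0 x.2); lra.
Qed.

Lemma enormD x y : enorm (x + y) <= enorm x + enorm y.
Proof.
apply: ler_enorm; first by rewrite addr_ge0// enorm_ge0.
rewrite sqrrD !sqr_enorm dotpDl !dotpDr (dotpC y x).
have := le_trans (ler_norm _) (norm_dotp x y); lra.
Qed.

Lemma enormZ (k : R) x : enorm (k *: x) = `|k| * enorm x.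
Proof.
by rewrite /enorm dotpZl dotpZr mulrA -expr2 sqrtrM ?sqr_ge0// sqrtr_sqr.
Qed.

Lemma enormN x : enorm (- x) = enorm x.
Proof. by rewrite -scaleN1r enormZ normrN1 mul1r. Qed.

Lemma enormB x y : enorm (x - y) <= enorm x + enorm y.
Proof. by rewrite (le_trans (enormD _ _))// enormN. Qed.

Lemma enorm_eq0 x : enorm x = 0 -> x = 0.
Proof.
move=> x0; have := norm_fst_enorm x; have := norm_snd_enorm x.
by case: x x0 => a b /= ->; rewrite !normr_le0 => /eqP -> /eqP ->.
Qed.

Lemma measurable_enorm : measurable_fun setT (@enorm R).
Proof. by rewrite /enorm /dotp; meas. Qed.

Lemma measurable_disc (r : R) : measurable ([set x | enorm x < r] : set (measurableTypeR R * measurableTypeR R)%type).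
Proof.
rewrite [X in measurable X](_ : _ = setT `&` (@enorm R @^-1` `]-oo, r[%classic)).
  exact: measurable_enorm.
by apply/seteqP; split => x /=; rewrite in_itv/=; [split|case].
Qed.

Lemma measurable_annulus (a b : R) : measurable ([set x | a < enorm x < b] : set (measurableTypeR R * measurableTypeR R)%type).
Proof.
rewrite [X in measurable X](_ : _ = setT `&` (@enorm R @^-1` `]a, b[%classic)).
  exact: measurable_enorm.
by apply/seteqP; split => x /=; rewrite in_itv/=; [split|case].
Qed.

End euclidean_plane.

(** * The Poisson kernel and its Fourier transform *)

Section real_line.
Context {R : realType}.
Local Notation mu := (@lebesgue_measure R).

Lemma sqrD_neq0 (d z : R) : 0 < d -> d ^+ 2 + z ^+ 2 != 0.
Proof. by move=> d0; rewrite gt_eqF// ltr_wpDr ?sqr_ge0// exprn_gt0. Qed.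

Lemma ge0_integralT_split (g : R -> R) :
  continuous g -> (forall x, 0 <= g x) ->
  (\int[mu]_x (g x)%:E = \int[mu]_(x in `[0%R, +oo[) (g x)%:E
     + \int[mu]_(x in `[0%R, +oo[) (g (- x))%:E)%E.
Proof.
move=> cg g0.
have mg : measurable_fun [set: R] g by exact: continuous_measurable_fun.
rewrite -(setUv `[0%R, +oo[%classic) ge0_integral_setU//=; last 4 first.
- exact: measurableC.
- by apply/measurable_EFinP; rewrite setUv.
- by move=> x _; rewrite lee_fin.
- exact/disj_setPCl.
congr (_ + _)%E.
rewrite setCitvr integral_itv_bndo_bndc; last exact/measurable_EFinP/measurable_funTS.
rewrite -{1}oppr0 ge0_integration_by_substitutionNy//.
exact: continuous_subspaceT.
Qed.

Lemma expR_cvg0 (d : R) : 0 < d -> expR (- (d * x)) @[x --> +oo%R] --> 0.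
Proof.
move=> d0; apply: (@cvg_comp _ _ _ (fun x => d * x) (fun y => expR (- y)) _ (+oo%R)).
  apply/cvgryPge => A; near=> x; rewrite -ler_pdivrMl//; near: x.
exact: cvgr_expR.
Unshelve. all: by end_near. Qed.

Lemma ge0_FTC_halfline (g G : R -> R) (l : R) :
  continuous g -> (forall x, 0 <= g x) ->
  (forall x : R, is_derive x (1 : R) G (g x)) -> G x @[x --> +oo%R] --> l ->
  (\int[mu]_(x in `[0%R, +oo[) (g x)%:E = (l - G 0)%:E)%E.
Proof.
move=> cg g0 dG Gl; rewrite (@ge0_continuous_FTC2y _ g G 0 l)//.
- exact: continuous_subspaceT.
- apply: cvg_at_right_filter; apply: differentiable_continuous.
  exact/derivable1_diffP.
- by move=> x _; rewrite derive1E derive_val.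
Qed.

(** The 1 added to the cosine makes the integrand nonnegative, as [ge0_FTC_halfline] requires; it is
    subtracted again once integrability is known. The phase c covers cosine and sine transforms at
    once. *)
Lemma integral_halfline_expR_cos (d z c : R) : 0 < d ->
  (\int[mu]_(x in `[0%R, +oo[) (expR (- (d * x)) * (1 + cos (z * x + c)))%:E
   = (d^-1 + (d * cos c - z * sin c) / (d ^+ 2 + z ^+ 2))%:E)%E.
Proof.
move=> d0.
have q0 := sqrD_neq0 z d0.
(* The real part of e^(i c) e^((i z - d) x) / (i z - d), minus e^(-d x) / d. *)
pose G x : R := expR (- (d * x)) *
  ((z * sin (z * x + c) - d * cos (z * x + c)) / (d ^+ 2 + z ^+ 2) - d^-1).
apply: etrans; [apply: (@ge0_FTC_halfline _ G 0)|]; last first.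
- rewrite /G !mulr0 oppr0 expR0 !add0r; congr EFin.
  by field; rewrite q0 gt_eqF.
- apply: (@squeeze_cvgr _ _ _ _
     (fun x => - (expR (- (d * x)) * ((`|z| + d) / (d ^+ 2 + z ^+ 2) + d^-1)))
     (fun x => expR (- (d * x)) * ((`|z| + d) / (d ^+ 2 + z ^+ 2) + d^-1))).
  + near=> x; rewrite -ler_norml /G normrM ger0_norm ?expR_ge0//.
    rewrite ler_wpM2l ?expR_ge0// (le_trans (ler_normB _ _))//.
    rewrite (gtr0_norm (_ : 0 < d^-1)) ?invr_gt0// lerD2r normrM.
    rewrite (ger0_norm (_ : 0 <= (d ^+ 2 + z ^+ 2)^-1)); last first.
      by rewrite invr_ge0 addr_ge0// sqr_ge0.
    rewrite ler_wpM2r ?invr_ge0 ?addr_ge0 ?sqr_ge0//.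
    rewrite (le_trans (ler_normB _ _))// lerD// normrM.
      by rewrite -[leRHS]mulr1 ler_wpM2l// sin_max.
    by rewrite gtr0_norm// -[leRHS]mulr1 ler_wpM2l// ?cos_max ?ltW.
  + rewrite -[X in _ --> X]oppr0; apply: cvgN.
    by rewrite -[X in _ --> X](mul0r ((`|z| + d) / (d ^+ 2 + z ^+ 2) + d^-1)); apply: cvgMl (expR_cvg0 d0).
  + by rewrite -[X in _ --> X](mul0r ((`|z| + d) / (d ^+ 2 + z ^+ 2) + d^-1)); apply: cvgMl (expR_cvg0 d0).
- move=> x; rewrite /G; apply: is_derive_eq.
  rewrite /GRing.scale/= ; field.
  by rewrite q0 gt_eqF.
- by move=> x; rewrite mulr_ge0 ?expR_ge0// -lerBlDl sub0r cos_geN1.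
- move=> x; apply: cvgM.
    apply: (@continuous_comp _ _ _ (fun x : R => - (d * x)) expR); last exact: continuous_expR.
    by apply: cvgN; apply: cvgMr; exact: cvg_id.
  apply: cvgD; first exact: cvg_cst.
  apply: (@continuous_comp _ _ _ (fun x : R => z * x + c) cos); last exact: continuous_cos.
  by apply: cvgD; [apply: cvgMr; exact: cvg_id | exact: cvg_cst].
Unshelve. all: by end_near. Qed.

(** The Poisson kernel of the half-plane at height d times 2 pi, hence of mass 2 pi: in this
    normalisation it is exactly the Fourier transform of e^(-d |x|). *)
Definition poisson (d z : R) : R := 2 * d / (d ^+ 2 + z ^+ 2).

Lemma continuous_expR_norm_cos (d z c : R) :
  continuous (fun x : R => expR (- (d * `|x|)) * (1 + cos (z * x + c))).
Proof.
move=> x; apply: cvgM.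
  apply: (@continuous_comp _ _ _ (fun x : R => - (d * `|x|)) expR); last exact: continuous_expR.
  by apply: cvgN; apply: cvgMr; exact: norm_continuous.
apply: cvgD; first exact: cvg_cst.
apply: (@continuous_comp _ _ _ (fun x : R => z * x + c) cos); last exact: continuous_cos.
apply: cvgD; last exact: cvg_cst.
by apply: cvgMr; exact: cvg_id.
Qed.

Lemma integral_expR_norm_1Dcos (d z c : R) : 0 < d ->
  (\int[mu]_x (expR (- (d * `|x|)) * (1 + cos (z * x + c)))%:E
   = (2 / d + poisson d z * cos c)%:E)%E.
Proof.
move=> d0; rewrite ge0_integralT_split; last 2 first.
- exact: continuous_expR_norm_cos.
- by move=> x; rewrite mulr_ge0 ?expR_ge0// -lerBlDl sub0r cos_geN1.
under eq_integral => x; first rewrite inE/= in_itv/= andbT => x0.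
  rewrite ger0_norm//; over.
rewrite [X in (X + _)%E](integral_halfline_expR_cos _ _ d0)//.
under eq_integral => x; first rewrite inE/= in_itv/= andbT => x0.
  rewrite normrN ger0_norm// mulrN -mulNr; over.
rewrite (integral_halfline_expR_cos _ _ d0)// -EFinD sqrrN; congr EFin.
rewrite /poisson; field.
by rewrite sqrD_neq0//= gt_eqF.
Qed.

Lemma integrable_expR_norm (d : R) : 0 < d ->
  mu.-integrable setT (fun x => (expR (- (d * `|x|)))%:E).
Proof.
(* For z = c = 0 the previous formula evaluates the integral of 2 e^(-d |x|), which is thereby
   finite. *)
move=> d0; have := integral_expR_norm_1Dcos 0 0 d0.
under eq_integral do rewrite mul0r addr0 cos0.
move=> I; have I2 : mu.-integrable setT (fun x => (expR (- (d * `|x|)) * (1 + 1))%:E).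
  apply/integrableP; split.
    apply/measurable_EFinP; apply: continuous_measurable_fun => x.
    have := @continuous_expR_norm_cos d 0 0 x.
    rewrite /continuous_at; under eq_fun do rewrite mul0r add0r cos0.
    by rewrite !mul0r add0r cos0.
  under eq_integral do rewrite gee0_abs ?lee_fin ?mulr_ge0 ?expR_ge0//.
  by rewrite I ltry.
have := @integrableZl _ _ _ mu setT measurableT 2^-1 _ I2.
apply: eq_integrable => // x _; rewrite -EFinM; congr EFin; by field.
Qed.

Lemma integrable_expR_norm_cos (d z c : R) : 0 < d ->
  mu.-integrable setT (fun x => (expR (- (d * `|x|)) * cos (z * x + c))%:E).
Proof.
move=> d0; apply: le_integrable (integrable_expR_norm d0) => //.
  apply/measurable_EFinP; apply: measurable_funM.
    by apply/measurable_EFinP; exact: measurable_int (integrable_expR_norm d0).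
  apply: continuous_measurable_fun => x.
  apply: (@continuous_comp _ _ _ (fun x : R => z * x + c) cos); last exact: continuous_cos.
  apply: cvgD; last exact: cvg_cst.
  by apply: cvgMr; exact: cvg_id.
by move=> x _; rewrite lee_fin normrM -[leRHS]mulr1 ler_wpM2l// cos_max.
Qed.

Lemma integral_expR_norm_cos (d z c : R) : 0 < d ->
  (\int[mu]_x (expR (- (d * `|x|)) * cos (z * x + c))%:E
   = (poisson d z * cos c)%:E)%E.
Proof.
move=> d0.
have I0 := integrable_expR_norm d0; have I1 := integrable_expR_norm_cos z c d0.
have := integral_expR_norm_1Dcos z c d0.
have := integral_expR_norm_1Dcos 0 0 d0.
under eq_integral do rewrite mul0r addr0 cos0 mulrDr mulr1 EFinD.
rewrite integralD//.
under [in X in _ -> X -> _]eq_integral do rewrite mulrDr mulr1 EFinD.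
rewrite integralD//.
case: (integral _ _ _) (integrable_fin_num measurableT I0) => // I _.
case: (integral _ _ _) (integrable_fin_num measurableT I1) => // J _.
move=> [] h1 [] h2; congr EFin.
have : I = 2 / d.
  have : I + I = 2 * (2 / d).
    rewrite h1 /poisson cos0; field; by rewrite gt_eqF.
  by move=> ?; lra.
lra.
Qed.

Lemma poisson_ge0 (d z : R) : 0 < d -> 0 <= poisson d z.
Proof. by move=> d0; rewrite divr_ge0 ?mulr_ge0 ?addr_ge0 ?sqr_ge0// ltW. Qed.

Lemma continuous_poisson (d z : R) : 0 < d -> continuous (fun y => poisson d (z - y)).
Proof.
move=> d0 x; rewrite /poisson; apply: cvgMr; apply: cvgV.
  by rewrite gt_eqF// ltr_wpDr ?sqr_ge0// exprn_gt0.
apply: cvgD; first exact: cvg_cst.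
rewrite expr2; under eq_fun do rewrite expr2.
by apply: cvgM; apply: cvgB; (exact: cvg_cst || exact: cvg_id).
Qed.

Lemma integral_poisson (d z : R) : 0 < d ->
  (\int[mu]_y (poisson d (z - y))%:E = (2 * pi)%:E)%E.
Proof.
move=> d0.
have dne : d != 0 by rewrite gt_eqF.
(* The sign e treats both halves of the line at once: reflection turns the negative half into the
   kernel at z + x with x >= 0. *)
have D (w e x : R) : (e = 1 \/ e = -1) ->
  is_derive x (1 : R) (fun y : R => 2 * atan (e * (e * y - w) / d)) (poisson d (w - e * x)).
  move=> he; have e2 : e ^+ 2 = 1 by case: he => ->; rewrite ?sqrrN expr1n.
  apply: is_derive_eq; rewrite /GRing.scale/= /poisson.
  have -> : 1 + (e * (e * x - w) / d) ^+ 2 = (d ^+ 2 + (w - e * x) ^+ 2) / d ^+ 2.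
    rewrite !exprMn e2 exprVn -[w - _]opprB sqrrN; field; exact: dne.
  rewrite invf_div mulr0 add0r subr0 mulr1 -expr2 e2 mulr1; field.
  by rewrite dne sqrD_neq0.
have L (w e : R) : (e = 1 \/ e = -1) -> (2 * atan (e * (e * x - w) / d)) @[x --> +oo%R] --> 2 * (pi / 2).
  move=> he; apply: cvgMr.
  apply: (@cvg_comp _ _ _ (fun x => e * (e * x - w) / d) atan _ (+oo%R)); last exact: cvgy_atan.
  apply/cvgryPge => A; near=> x.
  have -> : e * (e * x - w) / d = (x - e * w) / d.
    by case: he => ->; congr (_ / _); ring.
  rewrite ler_pdivlMr// lerBrDr; near: x; exact: nbhs_pinfty_ge (num_real _).
rewrite ge0_integralT_split; last 2 first.
- exact: continuous_poisson.
- by move=> x; exact: poisson_ge0.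
have H (w e : R) : (e = 1 \/ e = -1) ->
    (\int[mu]_(x in `[0%R, +oo[) (poisson d (w - e * x))%:E = (pi - 2 * atan (- (e * w) / d))%:E)%E.
  move=> he; apply: etrans; [apply: (@ge0_FTC_halfline _ _ (2 * (pi / 2)) _ _ (fun x => D w e x he) (L w e he))|].
  - move=> x; have -> : (fun y => poisson d (w - e * y)) = (fun y => poisson d (w - y)) \o ( *%R e) by [].
    apply: continuous_comp; first by apply: cvgMr; exact: cvg_id.
    exact: continuous_poisson.
  - by move=> x; exact: poisson_ge0.
  - by rewrite mulrC divfK ?pnatr_eq0// mulr0 sub0r mulrN.
have -> : (\int[mu]_(x in `[0%R, +oo[) (poisson d (z - x))%:E = (pi - 2 * atan (- (1 * z) / d))%:E)%E.
  rewrite -(H z 1 (or_introl erefl)).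
  by apply: eq_integral => x _; rewrite mul1r.
have -> : (\int[mu]_(x in `[0%R, +oo[) (poisson d (z - - x))%:E = (pi - 2 * atan (- (-1 * z) / d))%:E)%E.
  rewrite -(H z (-1) (or_intror erefl)).
  by apply: eq_integral => x _; rewrite mulN1r.
rewrite -EFinD; congr EFin; rewrite mul1r mulN1r opprK mulNr atanN; ring.
Unshelve. all: by end_near. Qed.

Lemma integrable_poisson (d z : R) : 0 < d ->
  mu.-integrable setT (fun y => (poisson d (z - y))%:E).
Proof.
move=> d0; apply/integrableP; split.
  by apply/measurable_EFinP; apply: continuous_measurable_fun; exact: continuous_poisson.
under eq_integral do rewrite gee0_abs ?lee_fin ?poisson_ge0//.
by rewrite integral_poisson// ltry.
Qed.

End real_line.

Section plane_integrals.
Context {R : realType}.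
Local Notation mu := (@lebesgue_measure R).
Local Notation mu2 := ((@lebesgue_measure R) \x (@lebesgue_measure R))%E.

Lemma sigma_finite_lebesgue2 : sigma_finite setT mu2.
Proof.
exists (fun n : nat => `[- n%:R, n%:R]%classic `*` `[- n%:R, n%:R]%classic).
  apply/seteqP; split => // -[x y] _ /=.
  exists (Num.truncn (Num.max `|x| `|y|)).+1 => //=.
  rewrite /= !in_itv/= -!ler_norml.
  have h := ltW (truncnS_gt (Num.max `|x| `|y|)).
  by split; apply: le_trans h; rewrite le_max lexx ?orbT.
move=> k; split; first by apply: measurableX; exact: measurable_itv.
have H : (mu `[(- k%:R)%R, (k%:R)%R]%classic < +oo)%E.
  by rewrite lebesgue_measure_itv/=; case: ifP => _; rewrite ?ltry// -EFinD ltry.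
rewrite product_measure1E//; apply: lte_mul_pinfty => //.
by rewrite ge0_fin_numE.
Qed.

(* The product measure carries no sigma-finite instance that inference finds
   for the iterated product. *)
Definition plane_measure : {sigma_finite_measure set (measurableTypeR R * measurableTypeR R)%type -> \bar R} :=
  HB.pack mu2
   (@Measure_isSigmaFinite.Build _ _ R mu2 sigma_finite_lebesgue2).
Lemma integrable_tensor d1 d2 (T1 : measurableType d1) (T2 : measurableType d2)
    (m1 : {sigma_finite_measure set T1 -> \bar R})
    (m2 : {sigma_finite_measure set T2 -> \bar R}) (u : T1 -> R) (v : T2 -> R) :
  m1.-integrable setT (EFin \o u) -> m2.-integrable setT (EFin \o v) ->
  (m1 \x m2)%E.-integrable setT (fun x => (u x.1 * v x.2)%:E).
Proof.
move=> iu iv.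
have mu_ : measurable_fun setT u by apply/measurable_EFinP; exact: measurable_int iu.
have mv : measurable_fun setT v by apply/measurable_EFinP; exact: measurable_int iv.
apply/integrable12ltyP.
  by apply/measurable_EFinP; apply: measurable_funM; apply: measurableT_comp.
have [_ /[dup] iu' /ltW iu''] := integrableP _ _ _ iu.
have [_ iv'] := integrableP _ _ _ iv.
under eq_integral => x _.
  under eq_integral do rewrite /= normrM EFinM.
  rewrite ge0_integralZl//; last by apply/measurable_EFinP; meas.
  over.
rewrite ge0_integralZr//; last 2 first.
- by apply/measurable_EFinP; meas.
- by apply: integral_ge0.
by rewrite lte_mul_pinfty// ?integral_ge0// ge0_fin_numE ?integral_ge0.
Qed.

(** A tensor product instead of e^(-d |xi|) with the Euclidean norm: its transform is a product of
    two one-dimensional kernels. *)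
Definition expdecay (d : R) (xi : R * R) : R := expR (- (d * `|xi.1|)) * expR (- (d * `|xi.2|)).

Lemma expdecay_gt0 (d : R) xi : 0 < expdecay d xi.
Proof. by rewrite mulr_gt0// expR_gt0. Qed.

Lemma expdecay_le1 (d : R) xi : 0 < d -> expdecay d xi <= 1.
Proof.
move=> d0; rewrite /expdecay -expRD -expR0 ler_expR.
by rewrite -opprD oppr_le0 addr_ge0// mulr_ge0// ltW.
Qed.

Lemma measurable_expdecay d : measurable_fun setT (expdecay d).
Proof. rewrite /expdecay; meas. Qed.

Lemma integrable_expdecay (d : R) : 0 < d -> mu2.-integrable setT (EFin \o expdecay d).
Proof.
move=> d0; pose e (x : R) := expR (- (d * `|x|)).
exact: (@integrable_tensor _ _ _ _ mu mu e e (integrable_expR_norm d0) (integrable_expR_norm d0)).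
Qed.

Lemma integrableM_bounded d (T : measurableType d) (m : {measure set T -> \bar R})
    (g h : T -> R) (M : R) :
  m.-integrable setT (EFin \o g) -> measurable_fun setT h -> (forall x, `|h x| <= M) ->
  m.-integrable setT (fun x => (g x * h x)%:E).
Proof.
move=> ig mh hM.
have mg : measurable_fun setT g by apply/measurable_EFinP; exact: measurable_int ig.
have := integrableZl measurableT M ig.
apply: le_integrable => //; first by apply/measurable_EFinP; exact: measurable_funM.
move=> x _; rewrite /= lee_fin mulrC !normrM ler_wpM2r//.
by rewrite (le_trans (hM x))// ler_norm.
Qed.

(** The free phase is what makes the iteration work: in the inner integral over the second
    coordinate, [z.1 * x + c] is merely another phase. *)
Lemma integral_expdecay_cos (d c : R) (z : R * R) : 0 < d ->
  (\int[mu2]_xi (expdecay d xi * cos (dotp z xi + c))%:E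
   = (poisson d z.1 * poisson d z.2 * cos c)%:E)%E.
Proof.
move=> d0.
have I : mu2.-integrable setT (fun xi => (expdecay d xi * cos (dotp z xi + c))%:E).
  apply: (@integrableM_bounded _ _ _ _ _ 1 (integrable_expdecay d0)).
    by rewrite /dotp; meas.
  by move=> x; exact: cos_max.
rewrite -(integral12_prod_meas1 I) /fubini_F.
transitivity (\int[mu]_x ((poisson d z.2)%:E * (expR (- (d * `|x|)) * cos (z.1 * x + c))%:E)%E)%E.
  apply: eq_integral => x _.
  transitivity (\int[mu]_y ((expR (- (d * `|x|)))%:E *
      (expR (- (d * `|y|)) * cos (z.2 * y + (z.1 * x + c)))%:E)%E)%E.
    apply: eq_integral => y _; rewrite /expdecay /dotp/= -EFinM; congr EFin.
    rewrite -mulrA; congr (_ * (_ * cos _)); ring.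
  rewrite integralZl//; last exact: integrable_expR_norm_cos.
  by rewrite integral_expR_norm_cos// -!EFinM; congr EFin; ring.
rewrite integralZl//; last exact: integrable_expR_norm_cos.
by rewrite integral_expR_norm_cos// -!EFinM; congr EFin; ring.
Qed.

Definition poisson2 (d : R) (z : R * R) : R := poisson d z.1 * poisson d z.2.

(** [poisson2 d (x - y)] is itself a Fourier integral over xi, and the two integrals are exchanged
    by Fubini; the double integrand is dominated by |g(y)| [expdecay d xi]. *)
Lemma poisson2_conv_fourier (d : R) (x : R * R) (g : R * R -> R) : 0 < d ->
  mu2.-integrable setT (EFin \o g) ->
  (\int[mu2]_y (g y * poisson2 d (x - y))%:E =
   \int[mu2]_xi (expdecay d xi * \int[mu2]_y (g y * cos (dotp (x - y) xi)))%:E)%E.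
Proof.
move=> d0 ig.
have mg : measurable_fun setT g by apply/measurable_EFinP; exact: measurable_int ig.
have I : (plane_measure \x plane_measure)%E.-integrable setT
    (fun z => (g z.1 * expdecay d z.2 * cos (dotp (x - z.1) z.2))%:E).
  have tI := @integrable_tensor _ _ _ _ plane_measure plane_measure g (expdecay d) ig (integrable_expdecay d0).
  have mh : measurable_fun setT (fun z : (R * R) * (R * R) => cos (dotp (x - z.1) z.2)).
    by rewrite /dotp/=; meas.
  exact: (integrableM_bounded tI mh (fun z => cos_max _)).
transitivity (\int[plane_measure]_y fubini_F plane_measure
    (fun z => (g z.1 * expdecay d z.2 * cos (dotp (x - z.1) z.2))%:E) y)%E.
  apply: eq_integral => y _; rewrite /fubini_F.
  transitivity (\int[mu2]_xi ((g y)%:E * (expdecay d xi * cos (dotp (x - y) xi + 0))%:E)%E)%E.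
    rewrite integralZl//.
      by rewrite integral_expdecay_cos// cos0 mulr1 -EFinM.
    apply: (@integrableM_bounded _ _ _ _ _ 1 (integrable_expdecay d0)).
      by rewrite /dotp; meas.
    by move=> xi; exact: cos_max.
  by apply: eq_integral => xi _; rewrite /= addr0 -EFinM mulrA.
rewrite integral12_prod_meas1// -integral21_prod_meas1//.
apply: eq_integral => xi _; rewrite /fubini_G.
have J : mu2.-integrable setT (fun y => (g y * cos (dotp (x - y) xi))%:E).
  apply: (@integrableM_bounded _ _ _ _ _ 1 ig).
    by rewrite /dotp/=; meas.
  by move=> z; exact: cos_max.
rewrite EFinM /Rintegral fineK ?integrable_fin_num//.
rewrite -integralZl//; apply: eq_integral => y _; rewrite /= -EFinM; congr EFin; ring.
Qed.

End plane_integrals.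

(** * Fourier inversion *)

Section fourier_inversion.
Context {R : realType}.
Local Notation mu := (@lebesgue_measure R).
Local Notation mu2 := ((@lebesgue_measure R) \x (@lebesgue_measure R))%E.

Lemma integrable_dominated d (T : measurableType d) (m : {measure set T -> \bar R})
    (g h : T -> R) : measurable_fun setT g -> m.-integrable setT (EFin \o h) ->
  (forall x, `|g x| <= h x) -> m.-integrable setT (EFin \o g).
Proof.
move=> mg ih gh; apply: le_integrable ih => //; first exact/measurable_EFinP.
by move=> x _; rewrite /= lee_fin (le_trans (gh x))// ler_norm.
Qed.

Lemma integrable_measurable d (T : measurableType d) (m : {measure set T -> \bar R})
    (g : T -> R) : m.-integrable setT (EFin \o g) -> measurable_fun setT g.
Proof. by move=> ig; apply/measurable_EFinP; exact: measurable_int ig. Qed.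

Lemma integrable_fourier_expdecay (g : R * R -> R) (d c : R) : 0 < d ->
  mu2.-integrable setT (EFin \o g) ->
  mu2.-integrable setT
    (fun xi => (expdecay d xi * \int[mu2]_y (g y * cos (dotp y xi + c)))%:E).
Proof.
move=> d0 ig.
have mg := integrable_measurable ig.
have tI := @integrable_tensor R _ _ _ _ plane_measure plane_measure (expdecay d) g (integrable_expdecay d0) ig.
have mh : measurable_fun setT (fun z : (R * R) * (R * R) => cos (dotp z.2 z.1 + c)).
  by rewrite /dotp/=; meas.
have I := integrableM_bounded tI mh (fun z => cos_max _).
have := integrable_fubini_F I; apply: eq_integrable => // xi _; rewrite /fubini_F.
have J : mu2.-integrable setT (fun y => (g y * cos (dotp y xi + c))%:E).
  apply: (@integrableM_bounded _ _ _ _ _ _ 1 ig).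
    by rewrite /dotp/=; meas.
  by move=> z; exact: cos_max.
rewrite EFinM /Rintegral fineK ?integrable_fin_num//.
rewrite -integralZl//; apply: eq_integral => y _; rewrite /= -EFinM; congr EFin; ring.
Qed.

(** Fubini gives measurability of the product with the weight [expdecay 1], which is positive and
    can be divided out. *)
Lemma measurable_fourier (g : R * R -> R) (c : R) :
  mu2.-integrable setT (EFin \o g) ->
  measurable_fun setT (fun xi : R * R => \int[mu2]_y (g y * cos (dotp y xi + c))).
Proof.
move=> ig; have := integrable_measurable (integrable_fourier_expdecay c ltr01 ig).
set F := (fun xi : R * R => _) => mF.
rewrite (_ : F = (fun xi => (expdecay 1 xi)^-1 * (expdecay 1 xi * F xi))).
  apply: measurable_funM => //; apply: measurable_invf; exact: measurable_expdecay.
by apply/funext => xi; rewrite mulrA mulVf ?mul1r// gt_eqF//; exact: expdecay_gt0.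
Qed.

Lemma lebesgue2_disc (r : R) : (mu2 [set x : R * R | (enorm x < r)%R] < +oo)%E.
Proof.
have H : (mu `[(- r)%R, r]%classic < +oo)%E.
  by rewrite lebesgue_measure_itv/=; case: ifP => _; rewrite ?ltry// -EFinD ltry.
apply: (@le_lt_trans _ _ (mu2 (`[(- r)%R, r]%classic `*` `[(- r)%R, r]%classic))).
  apply: le_measure; rewrite ?inE.
  - exact: measurable_disc.
  - by apply: measurableX; exact: measurable_itv.
  - move=> x /= xr; rewrite !in_itv/= -!ler_norml.
    by split; apply: le_trans (ltW xr); [exact: norm_fst_enorm|exact: norm_snd_enorm].
rewrite product_measure1E//; apply: lte_mul_pinfty => //.
by rewrite ge0_fin_numE.
Qed.

Lemma Lfun2_measurable (f : R * R -> R) : f \in Lfun mu2 2%:E -> measurable_fun setT f.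
Proof. by move=> /sub_Lfun_mfun; rewrite inE. Qed.

Lemma Lfun2_integrable_disc (f : R * R -> R) (r : R) : f \in Lfun mu2 2%:E ->
  mu2.-integrable setT (EFin \o (f \_ [set x | enorm x < r])).
Proof.
move=> f2; have mD := measurable_disc r; have mf := Lfun2_measurable f2.
rewrite -restrict_EFin -integrable_mkcond//.
have I1 : mu2.-integrable [set x : R * R | enorm x < r] (EFin \o cst 1).
  apply: measurable_bounded_integrable => //; first exact: lebesgue2_disc.
  exact: bounded_cst.
have I2 : mu2.-integrable [set x : R * R | enorm x < r] (EFin \o (fun x => f x ^+ 2)).
  by apply: integrableS (Lfun2_integrable_sqr f2).
have := integrableD (measurable_disc r) I1 I2; apply: le_integrable => //.
  by apply/measurable_EFinP; exact: measurable_funTS.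
move=> x _; rewrite /= lee_fin [leRHS]ger0_norm ?addr_ge0 ?sqr_ge0//.
rewrite -(real_normK (num_real (f x))); have := sqr_ge0 (`|f x| - 1); have := normr_ge0 (f x); rewrite !expr2; nra.
Qed.

(** The phase pi / 2 turns the cosine into minus the sine, so every statement with a free phase
    serves both the real and the imaginary part. *)
Lemma trunc_fourierE (f : R * R -> R) (r : R) xi :
  trunc_fourier_re f r xi = \int[mu2]_y ((f \_ [set x | enorm x < r]) y * cos (dotp y xi + 0)) /\
  trunc_fourier_im f r xi = \int[mu2]_y ((f \_ [set x | enorm x < r]) y * cos (dotp y xi + pi / 2)).
Proof.
split; rewrite /trunc_fourier_re /trunc_fourier_im Rintegral_mkcond;
  apply: eq_Rintegral => y _; rewrite !patchE; case: ifPn => _; rewrite ?mul0r// ?addr0//.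
by rewrite cosD cos_pihalf sin_pihalf; ring.
Qed.

Lemma integral_cos_shift (g : R * R -> R) (x xi : R * R) :
  mu2.-integrable setT (EFin \o g) ->
  \int[mu2]_y (g y * cos (dotp (x - y) xi)) =
  cos (dotp x xi) * \int[mu2]_y (g y * cos (dotp y xi + 0))
  - sin (dotp x xi) * \int[mu2]_y (g y * cos (dotp y xi + pi / 2)).
Proof.
move=> ig.
have I c : mu2.-integrable setT (EFin \o (fun y => g y * cos (dotp y xi + c))).
  apply: (@integrableM_bounded _ _ _ _ _ _ 1 ig).
    by rewrite /dotp/=; meas.
  by move=> z; exact: cos_max.
rewrite -!RintegralZl// -RintegralB//; last 2 first.
- by have := integrableZl measurableT (cos (dotp x xi)) (I 0).
- by have := integrableZl measurableT (sin (dotp x xi)) (I (pi / 2)).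
apply: eq_Rintegral => y _; rewrite dotpBl addr0 cosB cosD cos_pihalf sin_pihalf; ring.
Qed.

Lemma poisson_le (d z : R) : 0 < d -> poisson d z <= 2 / d.
Proof.
move=> d0; rewrite /poisson ler_pdivrMr ?ltr_wpDr ?sqr_ge0 ?exprn_gt0//.
rewrite mulrAC ler_pdivlMr//; have := sqr_ge0 z; nra.
Qed.

Lemma poisson2_ge0 (d : R) z : 0 < d -> 0 <= poisson2 d z.
Proof. by move=> d0; rewrite mulr_ge0// poisson_ge0. Qed.

Lemma integrable_poisson2 (d d' : R) (x : R * R) : 0 < d -> 0 < d' ->
  mu2.-integrable setT (EFin \o (fun y => poisson d (x.1 - y.1) * poisson d' (x.2 - y.2))).
Proof.
move=> d0 d'0.
exact: (@integrable_tensor _ _ _ _ _ mu mu _ _ (integrable_poisson x.1 d0) (integrable_poisson x.2 d'0)).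
Qed.

Lemma integral_poisson2 (d d' : R) (x : R * R) : 0 < d -> 0 < d' ->
  \int[mu2]_y (poisson d (x.1 - y.1) * poisson d' (x.2 - y.2)) = (2 * pi) ^+ 2.
Proof.
move=> d0 d'0; rewrite /Rintegral -(integral12_prod_meas1 (integrable_poisson2 x d0 d'0)) /fubini_F/=.
under eq_integral => y _.
  under eq_integral do rewrite EFinM.
  rewrite integralZl//; last exact: integrable_poisson.
  rewrite integral_poisson// -EFinM mulrC EFinM.
  over.
rewrite integralZl//; last exact: integrable_poisson.
by rewrite integral_poisson// -EFinM.
Qed.

Lemma integrable_Lfun2_poisson2 (f : R * R -> R) (d : R) (x : R * R) : 0 < d ->
  f \in Lfun mu2 2%:E ->
  mu2.-integrable setT (EFin \o (fun y => f y * poisson2 d (x - y))).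
Proof.
move=> d0 f2.
have mf := Lfun2_measurable f2.
have mp : measurable_fun setT (fun y : R * R => poisson2 d (x - y)).
  by rewrite /poisson2 /poisson/=; meas.
have I1 := Lfun2_integrable_sqr f2.
have I2 := integrableZl measurableT ((2 / d) ^+ 2) (integrable_poisson2 x d0 d0).
have := integrableD measurableT I1 I2; apply: le_integrable => //.
  by apply/measurable_EFinP; apply: measurable_funM.
move=> y _; rewrite /= lee_fin.
have K0 : 0 <= poisson2 d (x - y) by exact: poisson2_ge0.
rewrite [leRHS]ger0_norm; last first.
  by rewrite addr_ge0 ?sqr_ge0// mulr_ge0 ?sqr_ge0.
rewrite normrM (ger0_norm K0) -(real_normK (num_real (f y))).
have -> : poisson d (x.1 - y.1) * poisson d (x.2 - y.2) = poisson2 d (x - y) by [].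
have KB : poisson2 d (x - y) <= (2 / d) ^+ 2.
  by rewrite expr2 ler_pM ?poisson_ge0 ?poisson_le.
have := sqr_ge0 (`|f y| - poisson2 d (x - y)).
have := ler_wpM2r K0 KB; have := sqr_ge0 `|f y|; nra.
Qed.

Lemma Rintegral_dominated_cvg d (T : measurableType d) (m : {measure set T -> \bar R})
    (F : nat -> T -> R) (G h : T -> R) :
  (forall n, measurable_fun setT (F n)) -> measurable_fun setT G ->
  m.-integrable setT (EFin \o h) -> (forall n x, `|F n x| <= h x) ->
  (forall x, F n x @[n --> \oo] --> G x) ->
  \int[m]_x F n x @[n --> \oo] --> \int[m]_x G x.
Proof.
move=> mF mG ih Fh FG.
have IG : m.-integrable setT (EFin \o G).
  apply: (integrable_dominated mG ih) => x.
  by apply: (ler_cvg_to (cvg_norm (FG x)) (cvg_cst (h x))); near=> n; exact: Fh.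
have := @dominated_cvg _ _ _ m setT measurableT (fun n => EFin \o F n) (EFin \o G) (EFin \o h)
  (fun n => (measurable_EFinP _ _).2 (mF n)).
move=> /(_ _ _ ih) H.
rewrite /Rintegral; apply: fine_cvg; rewrite fineK ?integrable_fin_num//.
by apply: H => // [x _|n x _]; [apply: cvg_EFin; [exact: nearW|exact: FG] | rewrite lee_fin].
Unshelve. all: by end_near. Qed.

Lemma poisson2_trunc (f : R * R -> R) (d r : R) (x : R * R) : 0 < d ->
  f \in Lfun mu2 2%:E ->
  \int[mu2]_y ((f \_ [set y | enorm y < r]) y * poisson2 d (x - y)) =
  \int[mu2]_xi (expdecay d xi * (cos (dotp x xi) * trunc_fourier_re f r xi
                            - sin (dotp x xi) * trunc_fourier_im f r xi)).
Proof.
move=> d0 f2; have ig := Lfun2_integrable_disc r f2.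
rewrite /Rintegral poisson2_conv_fourier//; congr fine.
apply: eq_integral => xi _; congr EFin; congr (_ * _).
by rewrite integral_cos_shift//; have [-> ->] := trunc_fourierE f r xi.
Qed.

Lemma cvg_poisson2_trunc (f : R * R -> R) (d : R) (x : R * R) : 0 < d ->
  f \in Lfun mu2 2%:E ->
  \int[mu2]_y ((f \_ [set y | enorm y < n%:R]) y * poisson2 d (x - y)) @[n --> \oo] -->
  \int[mu2]_y (f y * poisson2 d (x - y)).
Proof.
move=> d0 f2; have I := integrable_norm (integrable_Lfun2_poisson2 x d0 f2).
have mf := Lfun2_measurable f2.
have mp : measurable_fun setT (fun y : R * R => poisson2 d (x - y)).
  by rewrite /poisson2 /poisson/=; meas.
apply: (Rintegral_dominated_cvg _ _ I).
- move=> n; apply: measurable_funM => //.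
  exact: integrable_measurable (Lfun2_integrable_disc n%:R f2).
- exact: measurable_funM.
- move=> n y /=; rewrite !normrM ler_wpM2r// patchE; case: ifP => // _.
  by rewrite normr0.
- move=> y; apply: cvgMl; apply: cvg_near_cst; near=> n; rewrite patchE mem_set//=.
  near: n; exact: nbhs_infty_gtr.
Unshelve. all: by end_near. Qed.

Lemma integrable_Lfun2_expdecay (a : R * R -> R) (h : R * R -> R) (d : R) : 0 < d ->
  a \in Lfun mu2 2%:E -> measurable_fun setT h -> (forall x, `|h x| <= 1) ->
  mu2.-integrable setT (EFin \o (fun xi => expdecay d xi * (h xi * a xi))).
Proof.
move=> d0 a2 mh h1.
have ma := Lfun2_measurable a2.
have := integrableD measurableT (Lfun2_integrable_sqr a2) (integrable_expdecay d0).
apply: le_integrable => //.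
  apply/measurable_EFinP; apply: measurable_funM; first exact: measurable_expdecay.
  exact: measurable_funM.
move=> y _; rewrite /= lee_fin.
have E0 := ltW (expdecay_gt0 d y); have E1 := expdecay_le1 y d0.
rewrite [leRHS]ger0_norm ?addr_ge0 ?sqr_ge0//.
rewrite normrM (ger0_norm E0) normrM -(real_normK (num_real (a y))) expr2.
apply: (@le_trans _ _ (expdecay d y * `|a y|)).
  by rewrite ler_wpM2l// -[leRHS]mul1r ler_wpM2r.
have := normr_ge0 (a y); have := sqr_ge0 (`|a y| - expdecay d y).
rewrite expr2; nra.
Qed.

(** The identity holds for the truncations of f by [poisson2_trunc]. As the radius grows, the left
    side converges by dominated convergence, the right side because the truncated transforms
    converge in L^2 and the weight is integrable. *)
Lemma fourier_poisson2 (f a b : R * R -> R) (d : R) (x : R * R) : 0 < d ->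
  f \in Lfun mu2 2%:E -> is_fourier f a b ->
  \int[mu2]_y (f y * poisson2 d (x - y)) =
  \int[mu2]_xi (expdecay d xi * (cos (dotp x xi) * a xi - sin (dotp x xi) * b xi)).
Proof.
move=> d0 f2 [a2 b2 fab].
have ma := Lfun2_measurable a2; have mb := Lfun2_measurable b2.
have mc : measurable_fun setT (fun xi : R * R => cos (dotp x xi)) by rewrite /dotp; meas.
have ms : measurable_fun setT (fun xi : R * R => sin (dotp x xi)) by rewrite /dotp; meas.
have Ia : mu2.-integrable setT (EFin \o (fun xi => expdecay d xi *
    (cos (dotp x xi) * a xi - sin (dotp x xi) * b xi))).
  have := integrableB measurableT
    (integrable_Lfun2_expdecay d0 a2 mc (fun _ => cos_max _))
    (integrable_Lfun2_expdecay d0 b2 ms (fun _ => sin_max _)).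
  by apply: eq_integrable => // xi _; rewrite /= -EFinB mulrBr.
have md := @measurable_expdecay R d.
pose Re n := trunc_fourier_re f n%:R; pose Im n := trunc_fourier_im f n%:R.
have IRe (n : nat) : mu2.-integrable setT (EFin \o (fun xi => expdecay d xi * Re n xi)).
  have := integrable_fourier_expdecay 0 d0 (Lfun2_integrable_disc n%:R f2).
  by apply: eq_integrable => // xi _; rewrite /= /Re (trunc_fourierE f n%:R xi).1.
have IIm (n : nat) : mu2.-integrable setT (EFin \o (fun xi => expdecay d xi * Im n xi)).
  have := integrable_fourier_expdecay (pi / 2) d0 (Lfun2_integrable_disc n%:R f2).
  by apply: eq_integrable => // xi _; rewrite /= /Im (trunc_fourierE f n%:R xi).2.
have mRe n : measurable_fun setT (Re n).
  have := measurable_fourier 0 (Lfun2_integrable_disc n%:R f2).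
  by apply: eq_measurable_fun => xi _; rewrite /Re (trunc_fourierE f n%:R xi).1.
have mIm n : measurable_fun setT (Im n).
  have := measurable_fourier (pi / 2) (Lfun2_integrable_disc n%:R f2).
  by apply: eq_measurable_fun => xi _; rewrite /Im (trunc_fourierE f n%:R xi).2.
have mq n : measurable_fun setT (fun xi => (Re n xi - a xi) ^+ 2 + (Im n xi - b xi) ^+ 2).
  by apply: measurable_funD; apply: measurable_funX; apply: measurable_funB.
have In (n : nat) : mu2.-integrable setT (EFin \o (fun xi => expdecay d xi *
    (cos (dotp x xi) * Re n xi - sin (dotp x xi) * Im n xi))).
  have := integrableB measurableT
    (@integrableM_bounded _ _ _ _ _ _ 1 (IRe n) mc (fun _ => cos_max _))
    (@integrableM_bounded _ _ _ _ _ _ 1 (IIm n) ms (fun _ => sin_max _)).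
  apply: eq_integrable => // xi _; rewrite /= -EFinB; congr EFin; ring.
pose D n := (\int[mu2]_xi ((Re n xi - a xi) ^+ 2 + (Im n xi - b xi) ^+ 2)%:E)%E.
have D0 : D n @[n --> \oo] --> 0%E.
  apply: (cvg_comp (fun n : nat => n%:R) _ _ fab); exact: cvgr_idn.
pose IE := \int[mu2]_xi expdecay d xi.
(* Young's inequality stands in for Cauchy-Schwarz: for every e > 0 the error is split into e times
   the mass of the weight and 1/e times the squared L^2 distance [D n]. *)
have bound (n : nat) (e : R) : 0 < e ->
  (`|\int[mu2]_y ((f \_ [set y | (enorm y < n%:R)%R]) y * poisson2 d (x - y))%R -
    \int[mu2]_xi (expdecay d xi * (cos (dotp x xi) * a xi - sin (dotp x xi) * b xi))%R|%:E
    <= (e * IE)%:E + (e^-1)%:E * D n)%E.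
  move=> e0; rewrite poisson2_trunc// -RintegralB//; last exact: In.
  have Id := integrableB measurableT (In n) Ia.
  have Id' : mu2.-integrable setT (EFin \o (fun xi => expdecay d xi *
    (cos (dotp x xi) * Re n xi - sin (dotp x xi) * Im n xi) - expdecay d xi *
    (cos (dotp x xi) * a xi - sin (dotp x xi) * b xi))) by exact: Id.
  apply: (@le_trans _ _ (\int[mu2]_xi `|(expdecay d xi *
    (cos (dotp x xi) * Re n xi - sin (dotp x xi) * Im n xi) - expdecay d xi *
    (cos (dotp x xi) * a xi - sin (dotp x xi) * b xi))%:E|)%E).
    rewrite /Rintegral -abse_EFin fineK ?integrable_fin_num//.
    exact: le_abse_integral (measurable_int _ Id').
  apply: (@le_trans _ _ (\int[mu2]_xi ((e * expdecay d xi)%:E +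
    (e^-1)%:E * ((Re n xi - a xi) ^+ 2 + (Im n xi - b xi) ^+ 2)%:E)%E)%E).
    apply: ge0_le_integral => //.
    - apply: measurableT_comp => //; exact: measurable_int Id'.
    - apply/measurable_EFinP; apply: measurable_funD.
        by apply: measurable_funM => //.
      exact: (measurable_funM (measurable_cst (e^-1)) (mq n)).
    - move=> xi _; rewrite -EFinM -EFinD lee_fin.
      have E0 := ltW (expdecay_gt0 d xi); have E1 := expdecay_le1 xi d0.
      rewrite -mulrBr normrM (ger0_norm E0).
      set E := expdecay d xi in E0 E1 *.
      set u := Re n xi - a xi; set v := Im n xi - b xi.
      have -> : cos (dotp x xi) * Re n xi - sin (dotp x xi) * Im n xi -
        (cos (dotp x xi) * a xi - sin (dotp x xi) * b xi) =
        cos (dotp x xi) * u - sin (dotp x xi) * v by rewrite /u /v; ring.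
      have h : `|cos (dotp x xi) * u - sin (dotp x xi) * v| <= `|u| + `|v|.
        rewrite (le_trans (ler_normB _ _))// !normrM lerD//.
          by rewrite -[leRHS]mul1r ler_wpM2r// cos_max.
        by rewrite -[leRHS]mul1r ler_wpM2r// sin_max.
      apply: (le_trans (ler_wpM2l E0 h)).
      rewrite -(real_normK (num_real u)) -(real_normK (num_real v)).
      move: (`|u|) (`|v|) (normr_ge0 u) (normr_ge0 v) => {h}U V U0 V0.
      have e_ne : e != 0 by rewrite gt_eqF.
      rewrite -subr_ge0.
      have -> : e * E + e^-1 * (U ^+ 2 + V ^+ 2) - E * (U + V) =
        e^-1 * ((e * E / 2 - U) ^+ 2 + (e * E / 2 - V) ^+ 2 + e ^+ 2 * E * (1 - E / 2)).
        by field.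
      apply: mulr_ge0; first by rewrite invr_ge0 ltW.
      rewrite addr_ge0 ?addr_ge0 ?sqr_ge0// !mulr_ge0 ?sqr_ge0//; lra.
  rewrite ge0_integralD//; last 4 first.
  - by move=> xi _; rewrite lee_fin mulr_ge0 ?ltW ?expdecay_gt0.
  - by apply/measurable_EFinP; apply: measurable_funM.
  - by move=> xi _; rewrite -EFinM lee_fin mulr_ge0 ?invr_ge0 ?addr_ge0 ?sqr_ge0// ltW.
  - by apply/measurable_EFinP; exact: (measurable_funM (measurable_cst (e^-1)) (mq n)).
  rewrite ge0_integralZl//; last 3 first.
  - by apply/measurable_EFinP; exact: (mq n).
  - by move=> xi _; rewrite lee_fin addr_ge0 ?sqr_ge0.
  - by rewrite lee_fin invr_ge0 ltW.
  rewrite leeD2r//.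
  under eq_integral do rewrite EFinM.
  rewrite integralZl//; last exact: integrable_expdecay.
  by rewrite EFinM /IE /Rintegral fineK// integrable_fin_num// integrable_expdecay.
rewrite -(cvg_lim (@norm_hausdorff _ _) (@cvg_poisson2_trunc f d x d0 f2)).
apply: (cvg_lim (@norm_hausdorff _ _)).
apply/cvgrPdist_le => k k0.
have IE0 : 0 <= IE by apply: Rintegral_ge0 => xi _; exact: ltW (expdecay_gt0 _ _).
(* With this e the first term is at most k / 2, and [D n <= e * k / 2] makes the second one at most
   k / 2. The 1 keeps the denominator positive when only [0 <= IE] is known. *)
pose e : R := k / 2 / (IE + 1).
have e0 : 0 < e by rewrite !divr_gt0// ltr_wpDl.
have ek0 : 0 < e * k / 2 by rewrite divr_gt0// mulr_gt0.
have /fine_cvgP[finD /cvgrPdist_le/(_ _ ek0) nearD] := D0.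
near=> n.
rewrite distrC -lee_fin (le_trans (bound n e e0))//.
have Dn : (D n <= (e * k / 2)%:E)%E.
  have fD : D n \is a fin_num by near: n.
  rewrite -(fineK fD) lee_fin.
  have : `|0 - fine (D n)| <= e * k / 2 by near: n.
  by rewrite sub0r normrN => /(le_trans (ler_norm _)).
apply: (@le_trans _ _ ((e * IE)%:E + (e^-1)%:E * (e * k / 2)%:E)%E).
  by rewrite leeD2l// lee_wpmul2l// lee_fin invr_ge0 ltW.
rewrite -EFinM -EFinD lee_fin.
have -> : e^-1 * (e * k / 2) = k / 2 by field; rewrite gt_eqF.
have : e * IE <= k / 2.
  rewrite /e mulrAC ler_pdivrMr ?ltr_wpDl// ler_wpM2l ?lerDl//.
  by rewrite divr_ge0// ltW.
lra.
Unshelve. all: by end_near. Qed.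

(** Away from 0 one has 1 + z^2 <= (1 + eta^(-2)) z^2, so the kernel is of order d, both relative to
    the fixed integrable kernel [poisson 1] and in the supremum norm. *)
Lemma poisson_far (d eta z : R) : 0 < d -> 0 < eta -> eta <= `|z| ->
  poisson d z <= d * (1 + eta ^- 2) * poisson 1 z /\ poisson d z <= 2 * d / eta ^+ 2.
Proof.
move=> d0 e0 ez.
have e2 : 0 < eta ^+ 2 by rewrite exprn_gt0.
have ez2 : eta ^+ 2 <= z ^+ 2.
  by rewrite -(real_normK (num_real z)) lerXn2r// nnegrE// ltW.
have q1 : 0 < d ^+ 2 + z ^+ 2 by rewrite ltr_wpDr ?sqr_ge0// exprn_gt0.
have q2 : 0 < 1 ^+ 2 + z ^+ 2 by rewrite ltr_wpDr ?sqr_ge0// exprn_gt0.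
have d2 : 0 < d ^+ 2 by rewrite exprn_gt0.
split; rewrite /poisson; last first.
  rewrite ler_pM2l ?mulr_gt0// lef_pV2 ?posrE//; lra.
rewrite ler_pdivrMr//.
rewrite (_ : d * (1 + eta ^- 2) * (2 * 1 / (1 ^+ 2 + z ^+ 2)) * (d ^+ 2 + z ^+ 2) =
  2 * d * (((1 + eta ^- 2) * (d ^+ 2 + z ^+ 2)) / (1 ^+ 2 + z ^+ 2))); last by ring.
rewrite -[leLHS]mulr1 ler_pM2l ?mulr_gt0// ler_pdivlMr// mul1r expr1n.
have h : 1 <= eta ^- 2 * z ^+ 2 by rewrite mulrC ler_pdivlMr// mul1r.
have h2 : 0 <= eta ^- 2 * d ^+ 2 by rewrite mulr_ge0 ?invr_ge0// ltW.
rewrite mulrDl mul1r mulrDr; lra.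
Qed.

(** Only one coordinate is known to be large. The first bound leaves [poisson d] in the other one,
    whose mass does not depend on d, so its integral is of order d. In the second bound the factor 2
    / d from the other coordinate uses up the gain d, and a bound uniform in d remains. *)
Lemma poisson2_far (d eta : R) (z : R * R) : 0 < d -> 0 < eta ->
  (eta <= `|z.1| \/ eta <= `|z.2|) ->
  poisson2 d z <= d * (1 + eta ^- 2) * (poisson 1 z.1 * poisson d z.2 + poisson d z.1 * poisson 1 z.2)
  /\ poisson2 d z <= 4 / eta ^+ 2.
Proof.
move=> d0 e0 h.
have p1 := poisson_ge0 z.1 d0; have p2 := poisson_ge0 z.2 d0.
have r1 := @poisson_ge0 R 1 z.1 ltr01; have r2 := @poisson_ge0 R 1 z.2 ltr01.
have c0 : 0 <= d * (1 + eta ^- 2).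
  by rewrite mulr_ge0 ?addr_ge0 ?invr_ge0 ?sqr_ge0// ltW.
have b1 := poisson_le z.1 d0; have b2 := poisson_le z.2 d0.
have E : 4 / eta ^+ 2 = 2 * d / eta ^+ 2 * (2 / d) :> R by field; rewrite !gt_eqF.
rewrite /poisson2; case: h => h; have [f1 f2] := poisson_far d0 e0 h; split.
- rewrite mulrDr mulrA; apply: (@le_trans _ _ (d * (1 + eta ^- 2) * poisson 1 z.1 * poisson d z.2)).
    by rewrite ler_wpM2r.
  by rewrite lerDl mulr_ge0// mulr_ge0.
- by rewrite E ler_pM.
- rewrite mulrDr; apply: (@le_trans _ _ (d * (1 + eta ^- 2) * (poisson d z.1 * poisson 1 z.2))).
    by rewrite [leRHS]mulrCA ler_wpM2l.
  by rewrite lerDr mulr_ge0// mulr_ge0.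
- by rewrite mulrC E ler_pM.
Qed.

(** Near x the continuity of f suffices. Far from x, f is only square integrable: |f| P <= k f^2 +
    P^2 / k for the kernel P, where P^2 is at most a constant times P by the uniform bound on P, and
    P has far mass of order d. The constant M may depend on e but not on d. *)
Lemma poisson2_approx (f : R * R -> R) (x : R * R) (e : R) :
  f \in Lfun mu2 2%:E -> {for x, continuous f} -> 0 < e ->
  exists M : R, forall d, 0 < d ->
    `|\int[mu2]_y (f y * poisson2 d (x - y)) - (2 * pi) ^+ 2 * f x| <= e + d * M.
Proof.
move=> f2 cf e0.
have mf := Lfun2_measurable f2.
have pi2 : 0 < (2 * pi) ^+ 2 :> R by rewrite exprn_gt0// mulr_gt0// pi_gt0.
pose e1 : R := e / 2 / (2 * pi) ^+ 2.
have e10 : 0 < e1 by rewrite !divr_gt0.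
pose F2 := \int[mu2]_y (f y ^+ 2).
have F20 : 0 <= F2 by apply: Rintegral_ge0 => y _; exact: sqr_ge0.
pose k : R := e / 2 / (F2 + 1).
have k0 : 0 < k by rewrite !divr_gt0// ltr_wpDl.
have /cvgrPdist_le/(_ _ e10) := cf.
move=> /nbhs_ballP[eta /= eta0 near_x].
pose B : R := 4 / eta ^+ 2.
have B0 : 0 <= B by rewrite divr_ge0 ?sqr_ge0.
(* B / k is the price of Young's inequality for |f(y)| P, and |f(x)| the coefficient of the
   subtracted term; both multiply the far bound on P. *)
pose c := (B / k + `|f x|) * (1 + eta ^- 2).
have c0 : 0 <= c.
  rewrite mulr_ge0// addr_ge0 ?invr_ge0 ?sqr_ge0//.
  by rewrite divr_ge0// ltW.
exists (c * (2 * (2 * pi) ^+ 2)) => d d0.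
pose Q (y : R * R) := poisson 1 (x.1 - y.1) * poisson d (x.2 - y.2) +
   poisson d (x.1 - y.1) * poisson 1 (x.2 - y.2).
have I1 := integrable_poisson2 x ltr01 d0; have I2 := integrable_poisson2 x d0 ltr01.
have IQ : mu2.-integrable setT (EFin \o Q) by have := integrableD measurableT I1 I2.
have IK : mu2.-integrable setT (EFin \o (fun y => poisson2 d (x - y))).
  exact: (integrable_poisson2 x d0 d0).
have EK : \int[mu2]_y poisson2 d (x - y) = (2 * pi) ^+ 2.
  exact: (integral_poisson2 x d0 d0).
have EQ : \int[mu2]_y Q y = 2 * (2 * pi) ^+ 2.
  by rewrite /Q RintegralD// !integral_poisson2//; ring.
have If2 := Lfun2_integrable_sqr f2.
have IfK := integrable_Lfun2_poisson2 x d0 f2.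
have IfxK : mu2.-integrable setT (EFin \o (fun y => f x * poisson2 d (x - y))).
  by have := integrableZl measurableT (f x) IK.
have Iek : mu2.-integrable setT (EFin \o (fun y => e1 * poisson2 d (x - y))).
  by have := integrableZl measurableT e1 IK.
have Ikf : mu2.-integrable setT (EFin \o (fun y => k * f y ^+ 2)).
  by have := integrableZl measurableT k If2.
have IcQ : mu2.-integrable setT (EFin \o (fun y => c * d * Q y)).
  by have := integrableZl measurableT (c * d) IQ.
have Isum1 : mu2.-integrable setT (EFin \o (fun y => e1 * poisson2 d (x - y) + k * f y ^+ 2)).
  by have := integrableD measurableT Iek Ikf.
have Isum : mu2.-integrable setT (EFin \o (fun y => e1 * poisson2 d (x - y) + k * f y ^+ 2 + c * d * Q y)).
  by have := integrableD measurableT Isum1 IcQ.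
have Idiff : mu2.-integrable setT (EFin \o (fun y => f y * poisson2 d (x - y) - f x * poisson2 d (x - y))).
  by have := integrableB measurableT IfK IfxK.
have EfxK : \int[mu2]_y (f x * poisson2 d (x - y)) = (2 * pi) ^+ 2 * f x.
  by rewrite RintegralZl// EK mulrC.
rewrite -EfxK -RintegralB//.
apply: (le_trans (le_normr_Rintegral _ _)) => //.
apply: (@le_trans _ _ (\int[mu2]_y (e1 * poisson2 d (x - y) + k * f y ^+ 2 + c * d * Q y))).
  apply: le_Rintegral => //; first exact: integrable_norm Idiff.
  move=> y _.
  set K := poisson2 d (x - y).
  have K0 : 0 <= K by exact: poisson2_ge0.
  have Q0 : 0 <= Q y by rewrite addr_ge0// mulr_ge0// poisson_ge0.
  have kf0 : 0 <= k * f y ^+ 2 by rewrite mulr_ge0 ?sqr_ge0// ltW.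
  have cQ0 : 0 <= c * d * Q y by apply: mulr_ge0 => //; apply: mulr_ge0 => //; exact: ltW.
  have eK0 : 0 <= e1 * K by rewrite mulr_ge0// ltW.
  rewrite -mulrBl normrM (ger0_norm K0).
  have [hy|hy] := pselect (ball x eta y).
    have := near_x _ hy; rewrite /= distrC => h.
    have := ler_wpM2r K0 h; lra.
  (* Balls of the product are squares, so a point outside has one coordinate at distance at least
     eta, which is the form [poisson2_far] takes. *)
  have far : eta <= `|(x - y).1| \/ eta <= `|(x - y).2|.
    have [h1|h1] := leP eta `|(x - y).1|; first by left.
    have [h2|h2] := leP eta `|(x - y).2|; first by right.
    by exfalso; apply: hy; split.
  have [far1 far2] := poisson2_far d0 eta0 far.
  rewrite -/K -/(Q y) in far1; rewrite -/K -/B in far2.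
  have h1 : `|f y - f x| * K <= `|f y| * K + `|f x| * K.
    by rewrite -mulrDl ler_wpM2r// ler_normB.
  have h2 : `|f y| * K <= k * f y ^+ 2 + B / k * K.
    rewrite -(real_normK (num_real (f y))).
    pose t : R := `|f y|; rewrite -/t.
    have kK : K ^+ 2 / k <= B / k * K.
      by rewrite expr2 mulrAC ler_wpM2r// ler_wpM2r// invr_ge0 ltW.
    rewrite (le_trans _ (lerD (lexx _) kK))//.
    rewrite -subr_ge0.
    have -> : k * t ^+ 2 + K ^+ 2 / k - t * K = k^-1 * ((k * t - K / 2) ^+ 2 + 3 / 4 * K ^+ 2).
      by field; rewrite gt_eqF.
    apply: mulr_ge0; first by rewrite invr_ge0 ltW.
    apply: addr_ge0; first exact: sqr_ge0.
    by apply: mulr_ge0; [rewrite divr_ge0|exact: sqr_ge0].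
  have h3 : (B / k + `|f x|) * K <= c * d * Q y.
    rewrite /c; have : 0 <= B / k + `|f x| by rewrite addr_ge0// divr_ge0// ltW.
    move=> /ler_wpM2l/(_ _ _ far1) /le_trans; apply; rewrite le_eqVlt; apply/orP; left.
    by apply/eqP; rewrite /Q; ring.
  rewrite mulrDl in h3; lra.
rewrite RintegralD// RintegralD// !RintegralZl// EK EQ.
have -> : e1 * (2 * pi) ^+ 2 = e / 2 by rewrite /e1 divfK// gt_eqF.
have : k * F2 <= e / 2.
  rewrite /k mulrAC ler_pdivrMr ?ltr_wpDl// ler_wpM2l ?lerDl//.
  by rewrite divr_ge0// ltW.
rewrite -/F2; lra.
Qed.

Lemma expdecay_cvg1 (xi : R * R) : expdecay (n.+1%:R^-1) xi @[n --> \oo] --> (1 : R).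
Proof.
have H (t : R) : expR (- (n.+1%:R^-1 * t)) @[n --> \oo] --> (1 : R).
  suff : expR (- (n.+1%:R^-1 * t)) @[n --> \oo] --> expR (- (0 * t)).
    by rewrite mul0r oppr0 expR0.
  apply: (cvg_comp _ expR); last exact: continuous_expR.
  apply: cvgN; apply: cvgMl; exact: cvg_harmonic.
suff : expdecay (n.+1%:R^-1) xi @[n --> \oo] --> (1 * 1 : R) by rewrite mulr1.
by apply: cvgM; exact: H.
Qed.

(** The integrals of [fourier_poisson2] at heights 1 / (n + 1) have two limits that must agree: the
    approximate identity yields (2 pi)^2 f(x), and dominated convergence with |a| + |b| removes the
    weight. *)
Lemma fourier_inversion (f a b : R * R -> R) (x : R * R) :
  continuous f -> f \in Lfun mu2 2%:E -> is_fourier f a b ->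
  mu2.-integrable setT (EFin \o a) -> mu2.-integrable setT (EFin \o b) ->
  (2 * pi) ^+ 2 * f x = \int[mu2]_xi (cos (dotp x xi) * a xi - sin (dotp x xi) * b xi).
Proof.
move=> cf f2 fab ia ib.
have ma := integrable_measurable ia; have mb := integrable_measurable ib.
have mc : measurable_fun setT (fun xi : R * R => cos (dotp x xi)) by rewrite /dotp; meas.
have ms : measurable_fun setT (fun xi : R * R => sin (dotp x xi)) by rewrite /dotp; meas.
pose h xi := cos (dotp x xi) * a xi - sin (dotp x xi) * b xi.
have mh : measurable_fun setT h by apply: measurable_funB; apply: measurable_funM.
have Iab : mu2.-integrable setT (EFin \o (fun xi => `|a xi| + `|b xi|)).
  by have := integrableD measurableT (integrable_norm ia) (integrable_norm ib).
have hab xi : `|h xi| <= `|a xi| + `|b xi|.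
  rewrite (le_trans (ler_normB _ _))// !normrM lerD//.
    by rewrite -[leRHS]mul1r ler_wpM2r// cos_max.
  by rewrite -[leRHS]mul1r ler_wpM2r// sin_max.
have C1 : \int[mu2]_xi (expdecay (n.+1%:R^-1) xi * h xi) @[n --> \oo] --> \int[mu2]_xi h xi.
  apply: (Rintegral_dominated_cvg _ _ Iab) => //.
  - by move=> n; apply: measurable_funM => //; exact: measurable_expdecay.
  - move=> n xi; rewrite normrM (ger0_norm (ltW (expdecay_gt0 _ _))).
    apply: le_trans (hab xi); rewrite -[leRHS]mul1r ler_wpM2r//.
    by apply: expdecay_le1; rewrite invr_gt0.
  - move=> xi; suff : expdecay (n.+1%:R^-1) xi * h xi @[n --> \oo] --> 1 * h xi.
      by rewrite mul1r.
    apply: cvgMl; exact: expdecay_cvg1.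
have C2 : \int[mu2]_xi (expdecay (n.+1%:R^-1) xi * h xi) @[n --> \oo] --> (2 * pi) ^+ 2 * f x.
  apply/cvgrPdist_le => e e0.
  have e20 : 0 < e / 2 by rewrite divr_gt0.
  have [M HM] := poisson2_approx f2 (cf x) e20.
  have HM0 : n.+1%:R^-1 * `|M| @[n --> \oo] --> (0 : R).
    by rewrite -(mul0r `|M|); apply: cvgMl; exact: cvg_harmonic.
  have /cvgrPdist_le/(_ _ e20) nearM := HM0.
  near=> n.
  have d0 : 0 < n.+1%:R^-1 :> R by rewrite invr_gt0.
  rewrite distrC -(fourier_poisson2 x d0 f2 fab) (le_trans (HM _ d0))//.
  have : `|0 - n.+1%:R^-1 * `|M| | <= e / 2 by near: n.
  rewrite sub0r normrN normrM normr_id => h1.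
  have : n.+1%:R^-1 * M <= n.+1%:R^-1 * `|M| by rewrite ler_wpM2l ?ler_norm// ltW.
  move=> h3; rewrite (gtr0_norm d0) in h1.
  by rewrite -lerBrDl (le_trans h3)// (le_trans h1)// lerBrDl -splitr.
rewrite -(cvg_lim (@norm_hausdorff _ _) C2); exact: (cvg_lim (@norm_hausdorff _ _) C1).
Unshelve. all: by end_near. Qed.

End fourier_inversion.

(** * Sobolev embedding *)

Section sobolev_embedding.
Context {R : realType}.
Local Notation mu2 := ((@lebesgue_measure R) \x (@lebesgue_measure R))%E.

Lemma mean_value (phi dphi : R -> R) (a b : R) :
  (forall x : R, is_derive x (1 : R) phi (dphi x)) ->
  exists2 c, `|c - a| <= `|b - a| & phi b - phi a = dphi c * (b - a).
Proof.
move=> dp.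
have cp : continuous phi.
  by move=> x; apply: differentiable_continuous; apply/derivable1_diffP; have [] := dp x.
have [ab|ba] := leP a b.
  have [c] := @MVT_segment R phi dphi a b ab (fun x _ => dp x) (continuous_subspaceT cp).
  rewrite in_itv/= => /andP[ac cb] E; exists c => //.
  by rewrite !ger0_norm ?subr_ge0// lerD2r.
have [c] := @MVT_segment R phi dphi b a (ltW ba) (fun x _ => dp x) (continuous_subspaceT cp).
rewrite in_itv/= => /andP[ac cb] E; exists c.
  by rewrite !ler0_norm ?subr_le0 ?lerN2 ?lerD2r// ltW.
by rewrite -opprB E -mulrN opprB.
Qed.

Lemma lipschitz_cos (u v : R) : `|cos u - cos v| <= `|u - v|.
Proof.
have [c _ ->] := @mean_value cos (fun x => - sin x) v u (fun x => is_derive_cos x).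
by rewrite normrM normrN -[leRHS]mul1r ler_wpM2r// sin_max.
Qed.

Lemma lipschitz_sin (u v : R) : `|sin u - sin v| <= `|u - v|.
Proof.
have [c _ ->] := @mean_value sin cos v u (fun x => is_derive_sin x).
by rewrite normrM -[leRHS]mul1r ler_wpM2r// cos_max.
Qed.

Lemma taylor1_bound (phi dphi : R -> R) (u t : R) :
  (forall x : R, is_derive x (1 : R) phi (dphi x)) ->
  (forall x y, `|dphi x - dphi y| <= `|x - y|) ->
  `|phi (u + t) - phi u - dphi u * t| <= t ^+ 2.
Proof.
move=> dp lip; have [c] := mean_value u (u + t) dp.
rewrite (_ : u + t - u = t); last by ring.
move=> hc ->; rewrite -mulrBl normrM.
rewrite -(real_normK (num_real t)) expr2 ler_wpM2r//.
by rewrite (le_trans (lip _ _)).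
Qed.

Lemma taylor_cos (u t : R) : `|cos (u + t) - cos u + sin u * t| <= t ^+ 2.
Proof.
have := @taylor1_bound cos (fun x => - sin x) u t (fun x => is_derive_cos x).
rewrite mulNr opprK; apply => x y.
by rewrite -opprD normrN; exact: lipschitz_sin.
Qed.

Lemma taylor_sin (u t : R) : `|sin (u + t) - sin u - cos u * t| <= t ^+ 2.
Proof. by apply: (@taylor1_bound sin cos) lipschitz_cos => x; exact: is_derive_sin. Qed.

(** The norm is the root of an infimum, so a strict bound produces an actual transform of small
    energy; the estimates below are therefore stated under [sobolev_norm s f < e]. *)
Lemma sobolev_norm_lt (s e : R) (f : R * R -> R) : 0 < e ->
  (sobolev_norm s f < e%:E)%E ->
  exists2 ab, is_fourier f ab.1 ab.2 & (sobolev_energy s ab.1 ab.2 < (e ^+ 2)%:E)%E.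
Proof.
move=> e0; rewrite /sobolev_norm => h.
have : (ereal_inf [set sobolev_energy s ab.1 ab.2 | ab in [set ab | is_fourier f ab.1 ab.2]] < (e ^+ 2)%:E)%E.
  case: ereal_inf h => [r| |] //=; last by rewrite ltNye.
  rewrite !lte_fin => h; have [r0|r0] := leP 0 r.
    by rewrite -(sqr_sqrtr r0) ltrXn2r ?nnegrE ?sqrtr_ge0// ltW.
  by rewrite (lt_trans r0)// exprn_gt0.
by move=> /ereal_inf_lt[_ [ab hab <-] lt_e]; exists ab.
Qed.

(* pi ^+ 2 is the integral of 1 / ((1 + xi.1 ^+ 2) * (1 + xi.2 ^+ 2)), which
   dominates (1 + |xi|^2)^(-2). *)
Definition embedding_cst : R := 1 + pi ^+ 2.

Lemma embedding_cst_gt0 : 0 < embedding_cst.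
Proof. by rewrite /embedding_cst ltr_wpDr ?sqr_ge0. Qed.

(** With w = 1 + |xi|^2, the inequality w t <= w^4 t^2 / (2 e) + (e / 2) w^(-2) separates the
    energy, since w^4 <= w^s, from w^(-2), which is integrable over the plane. As the energy is
    below e^2, both parts are of order e, so the bound is linear in the norm. *)
Lemma sobolev_weighted_L1 (s e : R) (f : R * R -> R) : 4 <= s -> 0 < e ->
  (sobolev_norm s f < e%:E)%E ->
  exists a b, [/\ is_fourier f a b,
    mu2.-integrable setT (EFin \o (fun xi => (1 + dotp xi xi) * (`|a xi| + `|b xi|))) &
    \int[mu2]_xi ((1 + dotp xi xi) * (`|a xi| + `|b xi|)) <= embedding_cst * e].
Proof.
move=> s4 e0 /(sobolev_norm_lt e0)[[a b] /= fab lt_e].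
exists a, b; have [a2 b2 _] := fab.
have ma := Lfun2_measurable a2; have mb := Lfun2_measurable b2.
pose En xi := (1 + dotp xi xi) `^ s * (a xi ^+ 2 + b xi ^+ 2).
have En0 xi : 0 <= En xi by rewrite mulr_ge0 ?powR_ge0 ?addr_ge0 ?sqr_ge0.
have IEn : mu2.-integrable setT (EFin \o En).
  apply/integrableP; split; first by apply/measurable_EFinP; rewrite /En /dotp; meas.
  under eq_integral do rewrite gee0_abs ?lee_fin ?En0//.
  by apply: lt_trans (ltry (e ^+ 2)).
have IEn_le : \int[mu2]_xi En xi <= e ^+ 2.
  rewrite /Rintegral -lee_fin fineK; first exact: ltW.
  exact: integrable_fin_num.
(* Q / 4 is 1 / ((1 + xi.1^2) (1 + xi.2^2)), which dominates w^(-2) and whose integral is known from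
   the Poisson kernel. *)
pose Q (xi : R * R) : R := poisson 1 (0 - xi.1) * poisson 1 (0 - xi.2).
have IQ : mu2.-integrable setT (EFin \o Q) := integrable_poisson2 (0, 0) ltr01 ltr01.
have EQ : \int[mu2]_xi Q xi = (2 * pi) ^+ 2 := integral_poisson2 (0, 0) ltr01 ltr01.
have I1 : mu2.-integrable setT (EFin \o (fun xi => (2 * e)^-1 * En xi)).
  by have := integrableZl measurableT (2 * e)^-1 IEn.
have I2 : mu2.-integrable setT (EFin \o (fun xi => e / 4 * Q xi)).
  by have := integrableZl measurableT (e / 4) IQ.
have I12 : mu2.-integrable setT (EFin \o (fun xi => (2 * e)^-1 * En xi + e / 4 * Q xi)).
  by have := integrableD measurableT I1 I2.
have bound xi : (1 + dotp xi xi) * (`|a xi| + `|b xi|) <= (2 * e)^-1 * En xi + e / 4 * Q xi.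
  set w := 1 + dotp xi xi.
  have w1 : 1 <= w by rewrite lerDl dotpp_ge0.
  have w0 : 0 < w by rewrite (lt_le_trans _ w1).
  have ws : w ^+ 4 <= w `^ s by rewrite -(powR_mulrn 4 (ltW w0)) ler_powR.
  have hQ : w ^- 2 <= Q xi / 4.
    have -> : Q xi / 4 = ((1 + xi.1 ^+ 2) * (1 + xi.2 ^+ 2))^-1.
      rewrite /Q /poisson !sub0r !sqrrN expr1n; field.
      by rewrite !gt_eqF// ltr_wpDr ?sqr_ge0.
    rewrite lef_pV2 ?posrE ?exprn_gt0// ?mulr_gt0 ?ltr_wpDr ?sqr_ge0//.
    rewrite /w /dotp; have := sqr_ge0 xi.1; have := sqr_ge0 xi.2; rewrite !expr2; nra.
  have amgm (t : R) : 0 <= t -> w * t <= (2 * e)^-1 * (w ^+ 4 * t ^+ 2) + e / 2 * w ^- 2.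
    move=> t0; rewrite -subr_ge0.
    have -> : (2 * e)^-1 * (w ^+ 4 * t ^+ 2) + e / 2 * w ^- 2 - w * t =
      (2 * e)^-1 * (w ^+ 2 * t - e / w) ^+ 2 by field; rewrite !gt_eqF.
    by apply: mulr_ge0; [rewrite invr_ge0 mulr_ge0// ltW|exact: sqr_ge0].
  have h1 := amgm _ (normr_ge0 (a xi)); have h2 := amgm _ (normr_ge0 (b xi)).
  rewrite !real_normK ?num_real// in h1 h2.
  rewrite mulrDr (le_trans (lerD h1 h2))//.
  rewrite addrACA -mulrDr -mulrDr -mulrDl -splitr lerD//.
    apply: ler_wpM2l; first by rewrite invr_ge0 mulr_ge0// ltW.
    by apply: ler_wpM2r => //; rewrite addr_ge0 ?sqr_ge0.
  rewrite mulrAC -mulrA; apply: ler_wpM2l => //; exact: ltW.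
have w0 xi : 0 <= (1 + dotp xi xi) * (`|a xi| + `|b xi|).
  by apply: mulr_ge0; apply: addr_ge0 => //; exact: dotpp_ge0.
have IW : mu2.-integrable setT (EFin \o (fun xi => (1 + dotp xi xi) * (`|a xi| + `|b xi|))).
  apply: integrable_dominated I12 _.
    by rewrite /dotp; meas.
  by move=> xi; rewrite ger0_norm.
split => //.
apply: (@le_trans _ _ (\int[mu2]_xi ((2 * e)^-1 * En xi + e / 4 * Q xi))).
  exact: le_Rintegral.
rewrite RintegralD// !RintegralZl// EQ /embedding_cst.
have : (2 * e)^-1 * \int[mu2]_xi En xi <= e / 2.
  apply: (@le_trans _ _ ((2 * e)^-1 * e ^+ 2)).
    by rewrite ler_wpM2l// invr_ge0 mulr_ge0// ltW.
  by rewrite le_eqVlt; apply/orP; left; apply/eqP; field; rewrite gt_eqF.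
have -> : e / 4 * (2 * pi) ^+ 2 = e * pi ^+ 2 by field.
move=> h; rewrite [leRHS]mulrDl mul1r (mulrC (pi ^+ 2)) lerD2r (le_trans h)//.
by rewrite ler_pdivrMr// ler_pMr// ler1n.
Qed.

(** In the inversion formula, the value, the first increment and the Taylor remainder of cosine and
    sine cost the factors 1, |h| |xi| and |h|^2 |xi|^2. The weight 1 + |xi|^2 absorbs all three
    powers of |xi|. The vector p is the formal derivative of the formula; [grad_C11] identifies it
    with the gradient. *)
Lemma sobolev_C11 (s e : R) (f : R * R -> R) :
  4 <= s -> 0 < e -> sobolev s f -> (sobolev_norm s f < e%:E)%E ->
  [/\ forall x, `|f x| <= embedding_cst * e,
      forall x h, `|f (x + h) - f x| <= embedding_cst * e * enorm h &
      exists p : R * R -> R * R, forall x h,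
        `|f (x + h) - f x - dotp (p x) h| <= embedding_cst * e * enorm h ^+ 2].
Proof.
move=> s4 e0 [cf f2 _] lt_e.
have [a [b [fab IW leW]]] := sobolev_weighted_L1 s4 e0 lt_e.
set W := fun xi => _ in IW; have [a2 b2 _] := fab.
have ma := Lfun2_measurable a2; have mb := Lfun2_measurable b2.
have W0 xi : 0 <= W xi by apply: mulr_ge0; apply: addr_ge0 => //; exact: dotpp_ge0.
have N1 xi : enorm xi <= 1 + dotp xi xi.
  by rewrite -sqr_enorm; have := sqr_ge0 (enorm xi - 1); have := enorm_ge0 xi; rewrite !expr2; nra.
have N2 xi : enorm xi ^+ 2 <= 1 + dotp xi xi by rewrite -sqr_enorm lerDr.
have N0 xi : 1 <= 1 + dotp xi xi by rewrite lerDl dotpp_ge0.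
have ab0 xi : 0 <= `|a xi| + `|b xi| by rewrite addr_ge0.
have aW xi : `|a xi| + `|b xi| <= W xi by rewrite -[leLHS]mul1r ler_wpM2r.
have Idom (g : R * R -> R) : measurable_fun setT g ->
    (forall xi, `|g xi| <= W xi) -> mu2.-integrable setT (EFin \o g).
  by move=> mg gW; exact: integrable_dominated IW gW.
have Ia : mu2.-integrable setT (EFin \o a).
  by apply: Idom => // xi; rewrite (le_trans _ (aW xi))// lerDl.
have Ib : mu2.-integrable setT (EFin \o b).
  by apply: Idom => // xi; rewrite (le_trans _ (aW xi))// lerDr.
have pi2 : 1 <= (2 * pi) ^+ 2 :> R.
  rewrite exprn_ege1//; have := pi_ge2 R; lra.
have pi20 : 0 < (2 * pi) ^+ 2 :> R by rewrite (lt_le_trans _ pi2).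
have inv x := fourier_inversion x cf f2 fab Ia Ib.
pose k : R := ((2 * pi) ^+ 2)^-1.
have k0 : 0 <= k by rewrite invr_ge0 ltW.
have k1 : k <= 1 by rewrite invf_le1.
have fE x : f x = k * \int[mu2]_xi (cos (dotp x xi) * a xi - sin (dotp x xi) * b xi).
  by rewrite -inv mulrA mulVf ?mul1r// gt_eqF.
have comb (u v A B c : R) : `|u| <= c -> `|v| <= c -> `|u * A + v * B| <= c * (`|A| + `|B|).
  move=> uc vc; rewrite (le_trans (ler_normD _ _))// !normrM mulrDr.
  by rewrite lerD// ler_wpM2r.
(* The common pattern of the three bounds; the factor k = (2 pi)^(-2) is at most 1 and is given
   away. *)
have scale (g : R * R -> R) (c : R) : 0 <= c -> measurable_fun setT g ->
    (forall xi, `|g xi| <= c * W xi) -> `|k * \int[mu2]_xi g xi| <= embedding_cst * e * c.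
  move=> c0 mg gW; rewrite normrM (ger0_norm k0).
  have IcW : mu2.-integrable setT (EFin \o (fun xi => c * W xi)).
    by have := integrableZl measurableT c IW.
  have Ig : mu2.-integrable setT (EFin \o g) by exact: integrable_dominated IcW gW.
  rewrite -[leRHS]mul1r ler_pM//.
  apply: (le_trans (le_normr_Rintegral _ _)) => //.
  apply: (@le_trans _ _ (\int[mu2]_xi (c * W xi))).
    by apply: le_Rintegral => //; exact: integrable_norm Ig.
  by rewrite RintegralZl// mulrC ler_wpM2r.
have mdot (x : R * R) : measurable_fun setT (fun xi : R * R => dotp x xi) by rewrite /dotp; meas.
have I0 (x : R * R) : mu2.-integrable setT
    (EFin \o (fun xi => cos (dotp x xi) * a xi - sin (dotp x xi) * b xi)).
  apply: Idom => [|xi]; first by meas.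
  rewrite -mulNr (le_trans (comb _ _ _ _ 1 _ _)) ?cos_max ?normrN ?sin_max//.
  by rewrite mul1r.
have I1 (x : R * R) : mu2.-integrable setT
    (EFin \o (fun xi => (- sin (dotp x xi) * a xi - cos (dotp x xi) * b xi) * xi.1)).
  apply: Idom => [|xi]; first by meas.
  rewrite normrM mulrC -mulNr; apply: ler_pM => //.
    by rewrite (le_trans (norm_fst_enorm _))// N1.
  by rewrite (le_trans (comb _ _ _ _ 1 _ _)) ?mul1r ?normrN ?cos_max ?sin_max.
have I2 (x : R * R) : mu2.-integrable setT
    (EFin \o (fun xi => (- sin (dotp x xi) * a xi - cos (dotp x xi) * b xi) * xi.2)).
  apply: Idom => [|xi]; first by meas.
  rewrite normrM mulrC -mulNr; apply: ler_pM => //.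
    by rewrite (le_trans (norm_snd_enorm _))// N1.
  by rewrite (le_trans (comb _ _ _ _ 1 _ _)) ?mul1r ?normrN ?cos_max ?sin_max.
split.
- move=> x; rewrite fE -[leRHS]mulr1; apply: scale => //; first by meas.
  move=> xi; rewrite mul1r (le_trans _ (aW xi))// -mulNr (le_trans (comb _ _ _ _ 1 _ _)) ?mul1r//.
    exact: cos_max.
  by rewrite normrN sin_max.
- move=> x h; rewrite !fE -mulrBr -RintegralB//; apply: scale; [exact: enorm_ge0|by meas|].
  move=> xi.
  rewrite (_ : _ - _ = (cos (dotp (x + h) xi) - cos (dotp x xi)) * a xi +
    (- (sin (dotp (x + h) xi) - sin (dotp x xi))) * b xi); last by ring.
  have d : `|dotp (x + h) xi - dotp x xi| <= enorm h * enorm xi.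
    by rewrite dotpDl addrC addKr norm_dotp.
  rewrite (le_trans (comb _ _ _ _ (enorm h * enorm xi) _ _))//.
  + exact: le_trans (lipschitz_cos _ _) d.
  + by rewrite normrN; exact: le_trans (lipschitz_sin _ _) d.
  + by rewrite -mulrA ler_wpM2l ?enorm_ge0// /W ler_wpM2r// N1.
- exists (fun x => (k * \int[mu2]_xi ((- sin (dotp x xi) * a xi - cos (dotp x xi) * b xi) * xi.1),
     k * \int[mu2]_xi ((- sin (dotp x xi) * a xi - cos (dotp x xi) * b xi) * xi.2))) => x h.
  rewrite !fE.
  rewrite (_ : dotp _ h = k * \int[mu2]_xi (h.1 * ((- sin (dotp x xi) * a xi - cos (dotp x xi) * b xi) * xi.1) + h.2 * ((- sin (dotp x xi) * a xi - cos (dotp x xi) * b xi) * xi.2))); last first.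
    rewrite {1}/dotp/= RintegralD//.
    - by rewrite !RintegralZl//; ring.
    - by have := integrableZl measurableT h.1 (I1 x).
    - by have := integrableZl measurableT h.2 (I2 x).
  have IB : mu2.-integrable setT (EFin \o (fun xi =>
      cos (dotp (x + h) xi) * a xi - sin (dotp (x + h) xi) * b xi -
      (cos (dotp x xi) * a xi - sin (dotp x xi) * b xi))).
    by have := integrableB measurableT (I0 (x + h)) (I0 x).
  have ID : mu2.-integrable setT (EFin \o (fun xi =>
      h.1 * ((- sin (dotp x xi) * a xi - cos (dotp x xi) * b xi) * xi.1) +
      h.2 * ((- sin (dotp x xi) * a xi - cos (dotp x xi) * b xi) * xi.2))).
    by have := integrableD measurableT (integrableZl measurableT h.1 (I1 x)) (integrableZl measurableT h.2 (I2 x)).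
  rewrite -mulrBr -RintegralB// -mulrBr -RintegralB//.
  apply: scale; [exact: sqr_ge0|by meas|].
  move=> xi.
  rewrite (_ : _ - _ = (cos (dotp x xi + dotp h xi) - cos (dotp x xi) + sin (dotp x xi) * dotp h xi) * a xi +
    (- (sin (dotp x xi + dotp h xi) - sin (dotp x xi) - cos (dotp x xi) * dotp h xi)) * b xi); last first.
    by rewrite -dotpDl (_ : dotp h xi = h.1 * xi.1 + h.2 * xi.2)//; ring.
  have d : dotp h xi ^+ 2 <= enorm h ^+ 2 * enorm xi ^+ 2.
    rewrite -exprMn -(real_normK (num_real (dotp h xi))) lerXn2r ?nnegrE ?mulr_ge0 ?enorm_ge0//.
    exact: norm_dotp.
  rewrite (le_trans (comb _ _ _ _ (enorm h ^+ 2 * enorm xi ^+ 2) _ _))//.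
  + exact: le_trans (taylor_cos _ _) d.
  + by rewrite normrN; exact: le_trans (taylor_sin _ _) d.
  + by rewrite -mulrA ler_wpM2l ?sqr_ge0// /W ler_wpM2r// N2.
Qed.

End sobolev_embedding.

(** * Dilations of the Lebesgue measure of the plane *)

Section dilation.
Context {R : realType}.
Local Notation mu := (@lebesgue_measure R).
Local Notation mu2 := ((@lebesgue_measure R) \x (@lebesgue_measure R))%E.

(** The image measure multiplied by l agrees with Lebesgue measure on half-open intervals, and
    uniqueness does the rest. In the plane the same is done with rectangles. *)
Lemma lebesgue_measure_dilation (l : R) (A : set (measurableTypeR R)) : 0 < l ->
  measurable A -> (mu A = l%:E * mu ((fun x : R => (l * x)%R) @^-1` A))%E.
Proof.
move=> l0.
have ml : measurable_fun setT (fun x : measurableTypeR R => l * x : measurableTypeR R).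
  exact: mulrl_measurable.
pose pm := measure_function_pushforward__canonical__measure_function_Measure mu ml.
pose m' := mscale (NngNum (ltW l0)) pm.
move=> mA; apply: (@lebesgue_measure_unique R m') => //.
move=> X [[a b] /= _ <-].
change (mu `]a, b]%classic = (l%:E * mu ((fun x : R => (l * x)%R) @^-1` `]a, b]%classic))%E).
have -> : (fun x : R => l * x) @^-1` `]a, b]%classic = `](a / l), (b / l)]%classic.
  by apply/seteqP; split => x /=; rewrite !in_itv/= ltr_pdivrMr// ler_pdivlMr// mulrC.
have -> : mu `](a / l), (b / l)]%classic = (if a < b then (b / l - a / l)%:E else 0%E).
  by rewrite lebesgue_measure_itv/= lte_fin ltr_pM2r ?invr_gt0// EFinB.
have -> : mu `]a, b]%classic = (if a < b then (b - a)%:E else 0%E).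
  by rewrite lebesgue_measure_itv/= lte_fin EFinB.
case: ifP => _; last by rewrite mule0.
by rewrite -EFinM; congr EFin; field; rewrite gt_eqF.
Qed.

Lemma measurable_dilation (l : R) :
  measurable_fun setT (fun y : (measurableTypeR R * measurableTypeR R)%type =>
    (l * y.1, l * y.2) : (measurableTypeR R * measurableTypeR R)%type).
Proof. by meas. Qed.

Lemma lebesgue2_dilation (l : R) (A : set (measurableTypeR R * measurableTypeR R)%type) : 0 < l ->
  measurable A -> (mu2 A = (l ^+ 2)%:E * mu2 ((fun y : R * R => (l * y.1, l * y.2)%R) @^-1` A))%E.
Proof.
move=> l0.
pose pm := measure_function_pushforward__canonical__measure_function_Measure mu2 (measurable_dilation l).
pose m' := mscale (NngNum (sqr_ge0 l)) pm.
move=> mA; apply: (@product_measure_unique _ _ _ _ R mu mu m' _ A mA).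
move=> X Y mX mY.
change ((l ^+ 2)%:E * mu2 ((fun y : R * R => (l * y.1, l * y.2)%R) @^-1` (X `*` Y)) = mu X * mu Y)%E.
have mpre Z : measurable (Z : set (measurableTypeR R)) -> measurable ((fun x : R => l * x) @^-1` Z).
  move=> mZ; rewrite -[X in measurable X]setTI; exact: mulrl_measurable.
have -> : (fun y : R * R => (l * y.1, l * y.2)) @^-1` (X `*` Y) =
  ((fun x : R => l * x) @^-1` X) `*` ((fun x : R => l * x) @^-1` Y) by [].
rewrite product_measure1E; [|exact: mpre|exact: mpre].
rewrite [in RHS](lebesgue_measure_dilation l0 mX) [in RHS](lebesgue_measure_dilation l0 mY).
by rewrite expr2 EFinM muleACA.
Qed.

Lemma ge0_integral_dilation (l : R) (A : set (measurableTypeR R * measurableTypeR R)%type)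
    (g : R * R -> \bar R) : 0 < l -> measurable A -> measurable_fun setT g ->
  (forall x, 0 <= g x)%E ->
  (\int[mu2]_(z in A) g z =
   (l ^+ 2)%:E * \int[mu2]_(y in (fun y : R * R => (l * y.1, l * y.2)%R) @^-1` A) g (l * y.1, l * y.2)%R)%E.
Proof.
move=> l0 mA mg g0.
pose pm := measure_function_pushforward__canonical__measure_function_Measure mu2 (measurable_dilation l).
pose m' := mscale (NngNum (sqr_ge0 l)) pm.
have mgA : measurable_fun A g by exact: measurable_funTS.
have E1 : (\int[mu2]_(z in A) g z = \int[m']_(z in A) g z)%E.
  by apply: eq_measure_integral => B mB _; exact: (lebesgue2_dilation l0 mB).
have E2 : (\int[m']_(z in A) g z = (l ^+ 2)%:E * \int[pm]_(z in A) g z)%E.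
  exact: (@ge0_integral_mscale _ _ R pm A mA (NngNum (sqr_ge0 l)) g mgA (fun x _ => g0 x)).
have E3 : (\int[pm]_(z in A) g z =
    \int[mu2]_(y in (fun y : R * R => (l * y.1, l * y.2)%R) @^-1` A) g (l * y.1, l * y.2)%R)%E.
  exact: (@ge0_integral_pushforward _ _ _ _ R _ (measurable_dilation l) mu2 A g mA mgA (fun x _ => g0 x)).
by apply: (etrans E1); apply: (etrans E2); apply: (congr1 (fun t => (l ^+ 2)%:E * t)%E); exact: E3.
Qed.

Lemma Rintegral_dilation (l : R) (A : set (measurableTypeR R * measurableTypeR R)%type)
    (g : R * R -> R) : 0 < l -> measurable A -> measurable_fun setT g ->
  let B := (fun y : R * R => (l * y.1, l * y.2)) @^-1` A in
  mu2.-integrable B (fun y => (g (l * y.1, l * y.2))%:E) ->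
  \int[mu2]_(z in A) g z = l ^+ 2 * \int[mu2]_(y in B) g (l * y.1, l * y.2).
Proof.
move=> l0 mA mg B ig.
have mB : measurable (B : set (measurableTypeR R * measurableTypeR R)%type).
  by rewrite -[X in measurable X]setTI; exact: measurable_dilation.
have mg' : measurable_fun setT (EFin \o g) by exact/measurable_EFinP.
pose gl (y : R * R) : \bar R := (g (l * y.1, l * y.2))%:E.
have h1 : (\int[mu2]_(z in A) (EFin \o g)^\+ z = (l ^+ 2)%:E * \int[mu2]_(y in B) gl^\+ y)%E.
  apply: etrans (@ge0_integral_dilation l A _ l0 mA (measurable_funepos mg') (funepos_ge0 _)) _.
  apply: (congr1 (fun t => (l ^+ 2)%:E * t)%E); apply: eq_integral => y _.
  by rewrite !funeposE.
have h2 : (\int[mu2]_(z in A) (EFin \o g)^\- z = (l ^+ 2)%:E * \int[mu2]_(y in B) gl^\- y)%E.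
  apply: etrans (@ge0_integral_dilation l A _ l0 mA (measurable_funeneg mg') (funeneg_ge0 _)) _.
  apply: (congr1 (fun t => (l ^+ 2)%:E * t)%E); apply: eq_integral => y _.
  by rewrite !funenegE.
have igl : mu2.-integrable B gl by [].
have p1 := integrable_pos_fin_num mB igl; have p2 := integrable_neg_fin_num mB igl.
have E1 : (\int[mu2]_(z in A) (EFin \o g) z = \int[mu2]_(z in A) (EFin \o g)^\+ z
  - \int[mu2]_(z in A) (EFin \o g)^\- z)%E by rewrite integralE.
have E2 : (\int[mu2]_(z in B) gl z = \int[mu2]_(z in B) gl^\+ z
  - \int[mu2]_(z in B) gl^\- z)%E by rewrite integralE.
rewrite /Rintegral.
transitivity (fine (\int[mu2]_(z in A) (EFin \o g) z)) => //.
transitivity (l ^+ 2 * fine (\int[mu2]_(z in B) gl z)) => //.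
rewrite E1 E2 h1 h2 -(fineK p1) -(fineK p2) -!EFinM -!EFinB /=; ring.
Qed.

End dilation.

(** * Functions with a uniform quadratic Taylor remainder *)

Section C11_functions.
Context {R : realType}.
Implicit Types (f : R * R -> R) (x y z h : R * R).

Lemma powR32 (N : R) : 0 < N -> N `^ (3 / 2) = N * Num.sqrt N.
Proof.
move=> N0; rewrite (_ : 3 / 2 = 1 + 2^-1); last by field.
by rewrite powRD ?powRr1 ?powR12_sqrt ?ltW// gt_eqF// implybT.
Qed.

Lemma is_derive_quadratic (g : R -> R) (t d C : R) :
  (forall s, `|g (t + s) - g t - d * s| <= C * s ^+ 2) -> is_derive t (1 : R) g d.
Proof.
move=> H.
have lim : s^-1 *: ((g \o shift t) (s *: (1 : R)) - g t) @[s --> 0^'] --> d.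
  apply/cvgrPdist_le => e e0.
  have C1 : 0 < `|C| + 1 by rewrite ltr_wpDl.
  near=> s.
  have s0 : s != 0 by near: s; exact: nbhs_dnbhs_neq.
  have sle : `|s| <= e / (`|C| + 1).
    by near: s; apply: dnbhs0_le; rewrite divr_gt0.
  change (`|d - s^-1 * (g (s * 1 + t) - g t)| <= e).
  rewrite mulr1 [s + t]addrC distrC.
  have -> : s^-1 * (g (t + s) - g t) - d = s^-1 * (g (t + s) - g t - d * s) by field.
  rewrite normrM normrV ?unitfE// mulrC ler_pdivrMr ?normr_gt0//.
  apply: (le_trans (H s)); rewrite -(real_normK (num_real s)) expr2 mulrA ler_wpM2r//.
  apply: (@le_trans _ _ ((`|C| + 1) * `|s|)).
    by rewrite ler_wpM2r// (le_trans (ler_norm _))// lerDl.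
  by rewrite mulrC -ler_pdivlMr.
have dv : derivable g t (1 : R) by apply/cvg_ex; exists d.
by split => //; apply: (cvg_lim (@norm_hausdorff _ _)).
Unshelve. all: by end_near. Qed.

Lemma derive_quadratic f x v (d C : R) :
  (forall s : R, `|f (x + s *: v) - f x - d * s| <= C * s ^+ 2) -> 'D_v f x = d.
Proof.
move=> H.
have : is_derive (0 : R) (1 : R) (fun s => f (x + s *: v)) d.
  by apply: (@is_derive_quadratic _ 0 d C) => s; rewrite add0r scale0r addr0.
move=> [dv E].
rewrite -E /derive.
have -> : (fun t : R => t^-1 *: ((f \o shift x) (t *: v) - f x)) =
  (fun t : R => t^-1 *: (((fun s : R => f (x + s *: v)) \o shift 0) (t *: (1 : R)) - f (x + 0 *: v))) => //.
apply/funext => t.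
change (t^-1 *: (f (t *: v + x) - f x) = t^-1 *: (f (x + (t * 1 + 0) *: v) - f (x + 0 *: v))).
by rewrite mulr1 addr0 scale0r addr0 [t *: v + x]addrC.
Qed.

Lemma grad_C11 f (K : R) (p : R * R -> R * R) :
  (forall x h, `|f (x + h) - f x - dotp (p x) h| <= K * enorm h ^+ 2) -> forall x, grad f x = p x.
Proof.
move=> H x; rewrite /grad (surjective_pairing (p x)); congr pair.
- apply: (@derive_quadratic _ _ _ _ K) => s.
  have := H x (s *: (1, 0)); rewrite dotpZr enormZ.
  have -> : dotp (p x) (1, 0) = (p x).1 by rewrite /dotp/= mulr1 mulr0 addr0.
  have -> : enorm (1, 0) = 1 :> R by rewrite /enorm /dotp/= mulr1 mulr0 addr0 sqrtr1.
  by rewrite mulr1 real_normK ?num_real// mulrC.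
- apply: (@derive_quadratic _ _ _ _ K) => s.
  have := H x (s *: (0, 1)); rewrite dotpZr enormZ.
  have -> : dotp (p x) (0, 1) = (p x).2 by rewrite /dotp/= mulr1 mulr0 add0r.
  have -> : enorm (0, 1) = 1 :> R by rewrite /enorm /dotp/= mulr1 mulr0 add0r sqrtr1.
  by rewrite mulr1 real_normK ?num_real// mulrC.
Qed.

(** A Lipschitz gradient, encoded by its Taylor remainder: this is the form that the Fourier bound
    delivers, and restricted to a line it yields derivatives at once. *)
Definition C11 (K : R) f : Prop :=
  forall x h, `|f (x + h) - f x - dotp (grad f x) h| <= K * enorm h ^+ 2.

Definition lipschitz_with (L : R) f : Prop :=
  forall x h, `|f (x + h) - f x| <= L * enorm h.

Lemma enorm_grad_le (K L : R) f x : C11 K f -> lipschitz_with L f -> enorm (grad f x) <= L.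
Proof.
move=> fK fL; set p := grad f x.
have [->|p0] := eqVneq (enorm p) 0.
  have := le_trans (normr_ge0 _) (fL x (1, 0)).
  have -> : enorm (1, 0) = 1 :> R by rewrite /enorm /dotp/= mulr1 mulr0 addr0 sqrtr1.
  by rewrite mulr1.
have {}p0 : 0 < enorm p by rewrite lt_def p0 enorm_ge0.
(* The increment in the direction of the gradient p is t |p|^2 up to order t^2, and at most L t |p|;
   t tends to 0 below. The absolute value of K is taken because its sign is not assumed. *)
have H (t : R) : 0 < t -> enorm p <= L + t * (`|K| * enorm p).
  move=> t0; rewrite -(ler_pM2l (mulr_gt0 t0 p0)).
  have h1 := fK x (t *: p); have h2 := fL x (t *: p).
  rewrite dotpZr -/p -sqr_enorm enormZ (gtr0_norm t0) in h1 h2.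
  have h3 : t * enorm p ^+ 2 <= L * (t * enorm p) + K * (t * enorm p) ^+ 2.
    have := ler_norm (f (x + t *: p) - f x).
    have := ler_norm (- (f (x + t *: p) - f x - t * enorm p ^+ 2)); rewrite normrN.
    move: (f (x + t *: p) - f x) h1 h2 => D h1 h2; lra.
  have h4 : K * (t * enorm p) ^+ 2 <= `|K| * (t * enorm p) ^+ 2.
    by rewrite ler_wpM2r ?sqr_ge0// ler_norm.
  rewrite (_ : t * enorm p * enorm p = t * enorm p ^+ 2); last by ring.
  apply: (le_trans h3); apply: (le_trans (lerD (lexx _) h4)).
  by rewrite le_eqVlt; apply/orP; left; apply/eqP; ring.
apply/ler_addgt0Pl => e e0.
have c0 : 0 < `|K| * enorm p + 1 by rewrite ltr_wpDl// mulr_ge0// enorm_ge0.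
have := H (e / (`|K| * enorm p + 1)) (divr_gt0 e0 c0) => /le_trans; apply.
rewrite addrC lerD2r mulrAC ler_pdivrMr// ler_wpM2l ?lerDl//; exact: ltW.
Qed.

Lemma measurable_shift f (c : R * R) : measurable_fun setT f ->
  measurable_fun setT (fun x : R * R => f (x + c)).
Proof.
move=> mf; apply: (measurableT_comp mf).
have -> : (fun x : R * R => x + c) = (fun x => (x.1 + c.1, x.2 + c.2)) by [].
by meas.
Qed.

(** Each directional derivative is the pointwise limit of the difference quotients with step 1 / (n
    + 1), which are measurable. *)
Lemma measurable_grad f (K : R) : C11 K f -> measurable_fun setT f ->
  measurable_fun setT (fun x => (grad f x).1) /\ measurable_fun setT (fun x => (grad f x).2).
Proof.
move=> fK mf.
have H (v : R * R) : measurable_fun setT (fun x => dotp (grad f x) v).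
  apply: (@measurable_fun_cvg _ _ _ _
    (fun n x => n.+1%:R * (f (x + n.+1%:R^-1 *: v) - f x))).
    move=> n; apply: measurable_funM; first exact: measurable_cst.
    by apply: measurable_funB => //; exact: measurable_shift.
  move=> x _; apply/cvgrPdist_le => e e0.
  have lim0 : n.+1%:R^-1 * (`|K| * enorm v ^+ 2) @[n --> \oo] --> (0 : R).
    rewrite -(mul0r (`|K| * enorm v ^+ 2)); apply: cvgMl; exact: cvg_harmonic.
  have /cvgrPdist_le/(_ _ e0) near0 := lim0.
  near=> n; have n0 : 0 < n.+1%:R :> R by [].
  rewrite distrC.
  have q0 : 0 <= n.+1%:R^-1 :> R by rewrite invr_ge0.
  have := fK x (n.+1%:R^-1 *: v); rewrite dotpZr enormZ (ger0_norm q0) => h.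
  have -> : n.+1%:R * (f (x + n.+1%:R^-1 *: v) - f x) - dotp (grad f x) v =
    n.+1%:R * (f (x + n.+1%:R^-1 *: v) - f x - n.+1%:R^-1 * dotp (grad f x) v).
    by rewrite [RHS]mulrBr mulrA mulfV ?mul1r// gt_eqF.
  rewrite normrM gtr0_norm// mulrC -ler_pdivlMr//.
  apply: (le_trans h).
  have : `|0 - n.+1%:R^-1 * (`|K| * enorm v ^+ 2)| <= e by near: n.
  rewrite sub0r normrN => /(le_trans (ler_norm _)) h2.
  rewrite mulrC -(ler_pM2l n0) [leRHS]mulrC divfK ?gt_eqF// (le_trans _ h2)//.
  have -> : n.+1%:R * ((n.+1%:R^-1 * enorm v) ^+ 2 * K) = n.+1%:R^-1 * (K * enorm v ^+ 2).
    by move: (n.+1%:R : R) n0 => m m0; field; rewrite gt_eqF.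
  by rewrite ler_wpM2l ?invr_ge0// ler_wpM2r ?sqr_ge0// ler_norm.
split.
- have := H (1, 0); apply: eq_measurable_fun => x _.
  by rewrite /dotp/= mulr1 mulr0 addr0.
- have := H (0, 1); apply: eq_measurable_fun => x _.
  by rewrite /dotp/= mulr1 mulr0 add0r.
Unshelve. all: by end_near. Qed.

End C11_functions.

(** * The Muskat kernel *)

Section muskat_kernel.
Context {R : realType}.
Implicit Types (f : R * R -> R) (x y z h : R * R).

Lemma is_derive_invsqrt (N : R -> R) (t dN : R) : 0 < N t ->
  is_derive t (1 : R) N dN ->
  is_derive t (1 : R) (fun s => (Num.sqrt (N s))^-1) (- (dN / 2) * (Num.sqrt (N t))^-1 ^+ 3).
Proof.
move=> N0 iN.
have S0 : Num.sqrt (N t) != 0 by rewrite gt_eqF// sqrtr_gt0.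
have iS := is_derive1_sqrt N0.
have iC : is_derive t (1 : R) (fun s => Num.sqrt (N s)) ((2 * Num.sqrt (N t))^-1 * dN).
  by apply: is_derive_eq.
have iV := @is_deriveV R (fun s => Num.sqrt (N s)) t _ 1 S0 iC.
apply: is_derive_eq; rewrite /GRing.scale/=; field; exact: S0.
Qed.

(* The derivative of this profile in u has the sign of
   -(r^2 + u^2 + 3 u (q - u)) = -(r^2 - 2 u^2 + 3 u q) <= -(1 - 5 L^2) r^2; this
   is the only place where the size of the slope matters. *)
Lemma muskat_profile_decr (L r q u u' : R) : 0 < r -> 5 * L ^+ 2 <= 1 ->
  `|q| <= L * r -> `|u| <= L * r -> `|u'| <= L * r -> u <= u' ->
  (q - u') * (Num.sqrt (r ^+ 2 + u' ^+ 2))^-1 ^+ 3 <= (q - u) * (Num.sqrt (r ^+ 2 + u ^+ 2))^-1 ^+ 3.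
Proof.
move=> r0 L5 qL uL u'L uu'.
have r20 : 0 < r ^+ 2 by rewrite exprn_gt0.
have N0 (v : R) : 0 < r ^+ 2 + v ^+ 2 by rewrite ltr_wpDr ?sqr_ge0.
pose rho (v : R) : R := (Num.sqrt (r ^+ 2 + v ^+ 2))^-1.
have rho2 v : rho v ^+ 2 * (r ^+ 2 + v ^+ 2) = 1.
  by rewrite /rho exprVn sqr_sqrtr ?ltW// mulVf// gt_eqF.
pose dg (v : R) : R := - (rho v ^+ 5 * (r ^+ 2 + v ^+ 2 + 3 * v * (q - v))).
have dgE (v : R) : is_derive v (1 : R) (fun v => (q - v) * rho v ^+ 3) (dg v).
  have iN : is_derive v (1 : R) (fun v : R => r ^+ 2 + v ^+ 2) (2 * v).
    by apply: is_derive_eq; rewrite /GRing.scale/=; ring.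
  have iR : is_derive v (1 : R) rho (- (2 * v / 2) * rho v ^+ 3) :=
    @is_derive_invsqrt (fun v : R => r ^+ 2 + v ^+ 2) v (2 * v) (N0 v) iN.
  apply: is_derive_eq; rewrite /GRing.scale/= -/(rho v) /dg.
  have e : rho v ^+ 3 = rho v ^+ 5 * (r ^+ 2 + v ^+ 2).
    by rewrite -[LHS]mulr1 -(rho2 v); ring.
  transitivity (- (rho v ^+ 5 * (r ^+ 2 + v ^+ 2)) - rho v ^+ 5 * (3 * v * (q - v))).
    by rewrite -e; field.
  ring.
have cg : {within `[u, u'], continuous (fun v => (q - v) * rho v ^+ 3)}.
  apply: derivable_within_continuous => v _; by have [] := dgE v.
have [c] := MVT_segment uu' (fun v _ => dgE v) cg.
rewrite in_itv/= => /andP[uc cu'] E.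
rewrite -subr_le0 E mulr_le0_ge0 ?subr_ge0//.
rewrite oppr_le0; apply: mulr_ge0; first by rewrite exprn_ge0// invr_ge0 sqrtr_ge0.
have cL : `|c| <= L * r.
  move: uL u'L; rewrite !ler_norml => /andP[h1 h2] /andP[h3 h4]; apply/andP; split; lra.
have Lr0 : 0 <= L * r := le_trans (normr_ge0 _) cL.
have c2 : c ^+ 2 <= (L * r) ^+ 2.
  by rewrite -(real_normK (num_real c)) lerXn2r ?nnegrE.
have cq : - (c * q) <= (L * r) ^+ 2.
  rewrite (le_trans (ler_norm _))// normrN normrM expr2 ler_pM//.
have : (L * r) ^+ 2 * 5 <= r ^+ 2.
  by rewrite exprMn mulrAC (mulrC _ 5) -[leRHS]mul1r ler_wpM2r// ltW.
rewrite mulrBr; nra.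
Qed.

Definition incr f x z : R := f x - f (x - z).
Definition invdist f x z : R := (Num.sqrt (enorm z ^+ 2 + incr f x z ^+ 2))^-1.
(** The sine of the inclination of the chord of the graph over x - z and x. *)
Definition slope f x z : R := incr f x z * invdist f x z.
(* The part of the integrand that involves grad f (x - z) is the radial
   derivative of the slope (see is_derive_slope), hence the name below. *)
Definition main_part f x z : R := (dotp (grad f x) z - incr f x z) * invdist f x z ^+ 3.
Definition radial_part f x z : R :=
  (dotp (grad f (x - z)) z - incr f x z) * invdist f x z ^+ 3.

Lemma muskat_integrandE f x z : 0 < enorm z ->
  muskat_integrand f x z = main_part f x z - radial_part f x z.
Proof.
move=> z0; have N0 : 0 < enorm z ^+ 2 + incr f x z ^+ 2.
  by rewrite ltr_wpDr ?sqr_ge0// exprn_gt0.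
rewrite /muskat_integrand /main_part /radial_part powR32// -mulrBl dotpBl.
rewrite (_ : (_ * Num.sqrt _)^-1 = invdist f x z ^+ 3); first by congr (_ * _); ring.
rewrite /invdist exprVn; congr (_^-1).
by rewrite -/(incr f x z) -{1}(sqr_sqrtr (ltW N0)); ring.
Qed.

Lemma invdist_ge0 f x z : 0 <= invdist f x z.
Proof. by rewrite invr_ge0 sqrtr_ge0. Qed.

Lemma invdist_le f x z : 0 < enorm z -> invdist f x z <= (enorm z)^-1.
Proof.
move=> z0.
have S0 : 0 < Num.sqrt (enorm z ^+ 2 + incr f x z ^+ 2).
  by rewrite sqrtr_gt0 ltr_wpDr ?sqr_ge0// exprn_gt0.
rewrite lef_pV2 ?posrE//.
by rewrite -{1}(ger0_norm (ltW z0)) -sqrtr_sqr ler_wsqrtr// lerDl sqr_ge0.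
Qed.

Lemma norm_incr_lipschitz (L : R) f x z : lipschitz_with L f -> `|incr f x z| <= L * enorm z.
Proof. by move=> fL; rewrite /incr distrC -(enormN z); exact: fL. Qed.

Lemma norm_incr_C11 (K : R) f x z : C11 K f ->
  `|incr f x z - dotp (grad f x) z| <= K * enorm z ^+ 2.
Proof.
move=> fK; have := fK x (- z); rewrite enormN.
have -> : dotp (grad f x) (- z) = - dotp (grad f x) z by rewrite /dotp/=; ring.
by rewrite opprK -normrN /incr => h; rewrite (_ : _ - _ - _ = - (f (x - z) - f x + dotp (grad f x) z))//; ring.
Qed.

Lemma is_derive_incr (K : R) f x y (l : R) : C11 K f ->
  is_derive l (1 : R) (fun s => incr f x (s *: y)) (dotp (grad f (x - l *: y)) y).
Proof.
move=> fK; apply: (@is_derive_quadratic _ _ _ _ (K * enorm y ^+ 2)) => s.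
have := fK (x - l *: y) (- s *: y).
rewrite dotpZr enormZ normrN exprMn real_normK ?num_real//.
have -> : x - l *: y + - s *: y = x - (l + s) *: y by rewrite scaleNr -addrA -opprD -scalerDl.
rewrite -normrN /incr => h.
rewrite (_ : _ - _ - _ = - (f (x - (l + s) *: y) - f (x - l *: y) - - s * dotp (grad f (x - l *: y)) y)); last by ring.
by rewrite (le_trans h)// le_eqVlt; apply/orP; left; apply/eqP; ring.
Qed.

(** With u the increment along s y, the terms u^2 u' cancel in the derivative of u / (s^2 |y|^2 +
    u^2)^(1/2). What remains is s |y|^2 (s u' - u) over the cube of the distance, and s u' is grad
    f(x - s y) . (s y). *)
Lemma is_derive_slope (K : R) f x y (l : R) : C11 K f -> 0 < l -> 0 < enorm y ->
  is_derive l (1 : R) (fun s => slope f x (s *: y))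
    (l * enorm y ^+ 2 * radial_part f x (l *: y)).
Proof.
move=> fK l0 y0.
have iU := is_derive_incr x y l fK.
pose N (s : R) := s ^+ 2 * enorm y ^+ 2 + incr f x (s *: y) ^+ 2.
have NE (s : R) : enorm (s *: y) ^+ 2 + incr f x (s *: y) ^+ 2 = N s.
  by rewrite /N enormZ exprMn real_normK ?num_real.
have Nl : 0 < N l by rewrite ltr_wpDr ?sqr_ge0// mulr_gt0// exprn_gt0.
have iN : is_derive l (1 : R) N (2 * l * enorm y ^+ 2 + 2 * incr f x (l *: y) * dotp (grad f (x - l *: y)) y).
  by apply: is_derive_eq; rewrite /GRing.scale/=; ring.
have iR := @is_derive_invsqrt N l _ Nl iN.
have -> : (fun s => slope f x (s *: y)) = (fun s => incr f x (s *: y) * (Num.sqrt (N s))^-1).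
  by apply/funext => s; rewrite /slope /invdist NE.
apply: is_derive_eq.
rewrite /GRing.scale/= /radial_part /invdist NE dotpZr.
set U := incr f x (l *: y); set U' := dotp _ _; set rho := (Num.sqrt (N l))^-1.
have rho2 : rho = rho ^+ 3 * N l.
  rewrite /rho; have S0 : Num.sqrt (N l) != 0 by rewrite gt_eqF// sqrtr_gt0.
  by rewrite -{3}(sqr_sqrtr (ltW Nl)); field.
have -> : rho * U' = rho ^+ 3 * N l * U' by rewrite -rho2.
by rewrite /N -/U; field.
Qed.

Lemma norm_slope_le (B : R) f x z : (forall x, `|f x| <= B) -> 0 < enorm z ->
  `|slope f x z| <= 2 * B / enorm z.
Proof.
move=> fB z0; rewrite /slope normrM ler_pM//; last by rewrite ger0_norm ?invdist_ge0 ?invdist_le.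
by rewrite (le_trans (ler_normB _ _))// mulr_natl mulr2n lerD.
Qed.

Lemma norm_main_part (K L : R) f x z : C11 K f -> lipschitz_with L f -> 0 < enorm z ->
  `|main_part f x z| <= 2 * L / enorm z ^+ 2.
Proof.
move=> fK fL z0; rewrite /main_part normrM.
have -> : 2 * L / enorm z ^+ 2 = (L * enorm z + L * enorm z) * (enorm z)^-1 ^+ 3.
  by field; rewrite gt_eqF.
rewrite ler_pM//.
  rewrite (le_trans (ler_normB _ _))// lerD//; last exact: norm_incr_lipschitz.
  by rewrite (le_trans (norm_dotp _ _))// ler_wpM2r ?enorm_ge0// (enorm_grad_le _ fK fL).
by rewrite ger0_norm ?exprn_ge0 ?invdist_ge0// lerXn2r ?nnegrE ?invdist_ge0 ?invr_ge0 ?enorm_ge0 ?invdist_le.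
Qed.

Lemma norm_radial_part (K L : R) f x z : C11 K f -> lipschitz_with L f -> 0 < enorm z ->
  `|radial_part f x z| <= 2 * L / enorm z ^+ 2.
Proof.
move=> fK fL z0; rewrite /radial_part normrM.
have -> : 2 * L / enorm z ^+ 2 = (L * enorm z + L * enorm z) * (enorm z)^-1 ^+ 3.
  by field; rewrite gt_eqF.
rewrite ler_pM//.
  rewrite (le_trans (ler_normB _ _))// lerD//; last exact: norm_incr_lipschitz.
  by rewrite (le_trans (norm_dotp _ _))// ler_wpM2r ?enorm_ge0// (enorm_grad_le _ fK fL).
by rewrite ger0_norm ?exprn_ge0 ?invdist_ge0// lerXn2r ?nnegrE ?invdist_ge0 ?invr_ge0 ?enorm_ge0 ?invdist_le.
Qed.

(** Equal gradients make the two increments agree up to 2 K |z|^2, and u / (|z|^2 + u^2)^(1/2) has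
    derivative at most 1 / |z| in u. *)
Lemma slope_sub_le (K : R) f x x' z : C11 K f -> grad f x = grad f x' -> 0 < enorm z ->
  `|slope f x' z - slope f x z| <= 2 * K * enorm z.
Proof.
move=> fK gxx' z0.
have r20 : 0 < enorm z ^+ 2 by rewrite exprn_gt0.
have N0 (v : R) : 0 < enorm z ^+ 2 + v ^+ 2 by rewrite ltr_wpDr ?sqr_ge0.
pose rho (v : R) : R := (Num.sqrt (enorm z ^+ 2 + v ^+ 2))^-1.
have rho2 v : rho v ^+ 2 * (enorm z ^+ 2 + v ^+ 2) = 1.
  by rewrite /rho exprVn sqr_sqrtr ?ltW// mulVf// gt_eqF.
have dE (v : R) : is_derive v (1 : R) (fun v => v * rho v) (enorm z ^+ 2 * rho v ^+ 3).
  have iN : is_derive v (1 : R) (fun v : R => enorm z ^+ 2 + v ^+ 2) (2 * v).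
    by apply: is_derive_eq; rewrite /GRing.scale/=; ring.
  have iR : is_derive v (1 : R) rho (- (2 * v / 2) * rho v ^+ 3) :=
    @is_derive_invsqrt (fun v : R => enorm z ^+ 2 + v ^+ 2) v (2 * v) (N0 v) iN.
  apply: is_derive_eq; rewrite /GRing.scale/= -/(rho v).
  have -> : rho v * 1 = rho v ^+ 3 * (enorm z ^+ 2 + v ^+ 2).
    by rewrite mulr1 -[LHS]mulr1 -(rho2 v); ring.
  by field.
have [c _ E] := mean_value (incr f x z) (incr f x' z) dE.
have -> : slope f x' z - slope f x z = enorm z ^+ 2 * rho c ^+ 3 * (incr f x' z - incr f x z) by [].
have rho_le : rho c <= (enorm z)^-1.
  have S0 : 0 < Num.sqrt (enorm z ^+ 2 + c ^+ 2) by rewrite sqrtr_gt0.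
  rewrite lef_pV2 ?posrE//.
  by rewrite -{1}(ger0_norm (ltW z0)) -sqrtr_sqr ler_wsqrtr// lerDl sqr_ge0.
have rho0 : 0 <= rho c by rewrite invr_ge0 sqrtr_ge0.
have h1 : `|incr f x' z - incr f x z| <= 2 * K * enorm z ^+ 2.
  have a1 := norm_incr_C11 x z fK; have a2 := norm_incr_C11 x' z fK.
  rewrite gxx' in a1.
  rewrite (_ : _ - _ = (incr f x' z - dotp (grad f x') z) - (incr f x z - dotp (grad f x') z)); last by ring.
  rewrite (le_trans (ler_normB _ _))// (le_trans (lerD a2 a1))//.
  by rewrite -mulrA mulr_natl mulr2n.
rewrite normrM ger0_norm ?mulr_ge0 ?exprn_ge0 ?enorm_ge0//.
apply: (@le_trans _ _ ((enorm z ^+ 2 * (enorm z)^-1 ^+ 3) * (2 * K * enorm z ^+ 2))).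
  rewrite ler_pM// ?mulr_ge0 ?exprn_ge0 ?enorm_ge0//.
  by rewrite ler_wpM2l ?exprn_ge0 ?enorm_ge0// lerXn2r ?nnegrE ?invr_ge0 ?enorm_ge0.
by rewrite le_eqVlt; apply/orP; left; apply/eqP; field; rewrite gt_eqF.
Qed.

Lemma main_part_le (K L : R) f x x' z : C11 K f -> lipschitz_with L f -> 5 * L ^+ 2 <= 1 ->
  grad f x = grad f x' -> 0 < enorm z -> incr f x z <= incr f x' z ->
  main_part f x' z <= main_part f x z.
Proof.
move=> fK fL L5 gxx' z0 le_incr; rewrite /main_part /invdist gxx'.
apply: (muskat_profile_decr z0 L5) => //; try exact: norm_incr_lipschitz.
by rewrite (le_trans (norm_dotp _ _))// ler_wpM2r ?enorm_ge0// (enorm_grad_le _ fK fL).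
Qed.

End muskat_kernel.

(** * Comparison of principal values *)

Section principal_value.
Context {R : realType}.
Local Notation mu2 := ((@lebesgue_measure R) \x (@lebesgue_measure R))%E.
Implicit Types (f : R * R -> R) (x y z h : R * R).

Lemma ler_sub_cancel (a b c d : R) : a <= b -> (a - c) - (b - d) <= - (c - d).
Proof. by move=> ab; lra. Qed.

Lemma double_lt_of_third (t u : R) : 0 < u -> t <= u / 3 -> 2 * t < u.
Proof. by move=> ? ?; lra. Qed.

Lemma sixth_add_sixth (k : R) : k / 6 + k / 6 = k / 3.
Proof. by field. Qed.

Lemma ler_three_thirds (k a a' p p' : R) :
  p - a <= k / 3 -> a' - p' <= k / 3 -> p' - p <= k / 3 -> a' <= k + a.
Proof. by move=> *; lra. Qed.

Definition annulus (e r : R) : set (measurableTypeR R * measurableTypeR R)%type :=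
  [set y | e < enorm y < r].

Lemma lebesgue2_disc_le (r : R) : 0 <= r ->
  (mu2 [set x : R * R | (enorm x < r)%R] <= (4 * r ^+ 2)%:E)%E.
Proof.
move=> r0.
have H : (@lebesgue_measure R `[(- r)%R, r]%classic <= (2 * r)%:E)%E.
  rewrite lebesgue_measure_itv/=; case: ifP => _; last by rewrite lee_fin mulr_ge0.
  by rewrite -EFinD lee_fin opprK mulr_natl mulr2n.
apply: (@le_trans _ _ (mu2 (`[(- r)%R, r]%classic `*` `[(- r)%R, r]%classic))).
  apply: le_measure; rewrite ?inE.
  - exact: measurable_disc.
  - by apply: measurableX; exact: measurable_itv.
  - move=> x /= xr; rewrite !in_itv/= -!ler_norml.
    by split; apply: le_trans (ltW xr); [exact: norm_fst_enorm|exact: norm_snd_enorm].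
rewrite product_measure1E//.
rewrite (_ : 4 * r ^+ 2 = (2 * r) * (2 * r)); last by ring.
by rewrite EFinM lee_pmul.
Qed.

Lemma annulus_finite e r : (mu2 (annulus e r) < +oo)%E.
Proof.
apply: le_lt_trans (lebesgue2_disc r); apply: le_measure; rewrite ?inE.
- exact: measurable_annulus.
- exact: measurable_disc.
- by move=> y /= /andP[].
Qed.

Lemma integrable_annulus (g : R * R -> R) (e r M : R) : measurable_fun setT g ->
  (forall y, annulus e r y -> `|g y| <= M) -> mu2.-integrable (annulus e r) (EFin \o g).
Proof.
move=> mg gM; apply: measurable_bounded_integrable.
- exact: measurable_annulus.
- exact: annulus_finite.
- exact: measurable_funTS.
- exists M; split; first exact: num_real.
  by move=> t Mt y /= Ay; rewrite (le_trans (gM y Ay))// ltW.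
Qed.

Section measurability_kernel.
Context (f : R * R -> R) (K : R).
Context (mf : measurable_fun setT f) (fK : C11 K f).

Lemma measurable_incr x : measurable_fun setT (incr f x).
Proof.
rewrite /incr; apply: measurable_funB => //.
apply: (measurableT_comp mf).
have -> : (fun z : R * R => x - z) = (fun z => (x.1 - z.1, x.2 - z.2)) by [].
by meas.
Qed.

Lemma measurable_invdist x : measurable_fun setT (invdist f x).
Proof.
rewrite /invdist; apply: measurable_invf; apply: measurable_sqrtf.
apply: measurable_funD; apply: measurable_funX; first exact: measurable_enorm.
exact: measurable_incr.
Qed.

Lemma measurable_slope x : measurable_fun setT (slope f x).
Proof. by apply: measurable_funM; [exact: measurable_incr|exact: measurable_invdist]. Qed.

Lemma measurable_main_part x : measurable_fun setT (main_part f x).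
Proof.
apply: measurable_funM; last by apply: measurable_funX; exact: measurable_invdist.
apply: measurable_funB; last exact: measurable_incr.
by rewrite /dotp; meas.
Qed.

Lemma measurable_radial_part x : measurable_fun setT (radial_part f x).
Proof.
apply: measurable_funM; last by apply: measurable_funX; exact: measurable_invdist.
apply: measurable_funB; last exact: measurable_incr.
have [m1 m2] := measurable_grad fK mf.
have ms : measurable_fun setT (fun z : R * R => x - z).
  have -> : (fun z : R * R => x - z) = (fun z => (x.1 - z.1, x.2 - z.2)) by [].
  by meas.
have n1 := measurableT_comp m1 ms; have n2 := measurableT_comp m2 ms.
exact: (measurable_funD (measurable_funM n1 (@measurable_fst _ _ _ _)) (measurable_funM n2 (@measurable_snd _ _ _ _))).
Qed.

End measurability_kernel.

Section comparison.
Context (f : R * R -> R) (K B L : R) (x x' : R * R).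
Context (mf : measurable_fun setT f) (fK : C11 K f) (fB : forall x, `|f x| <= B).
Context (fL : lipschitz_with L f) (L5 : 5 * L ^+ 2 <= 1).
Context (gxx' : grad f x = grad f x').
Context (incr_le : forall z, incr f x z <= incr f x' z).

(** The measure |z|^(-2) dz is invariant under dilations of the plane, so scaling the variable
    changes only the domain of integration. The difference of slopes is O(|z|) at the origin because
    the gradients agree, and O(1 / |z|) at infinity because f is bounded. *)
Let slope_diff z := (slope f x' z - slope f x z) / enorm z ^+ 2.

Let measurable_slope_diff : measurable_fun setT slope_diff.
Proof.
apply: measurable_funM.
  by apply: measurable_funB; exact: measurable_slope.
apply: measurable_invf; apply: measurable_funX; exact: measurable_enorm.
Qed.

Let K0 : 0 <= K.
Proof.
have := le_trans (normr_ge0 _) (fK x (1, 0)).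
have -> : enorm (1, 0) = 1 :> R by rewrite /enorm /dotp/= mulr1 mulr0 addr0 sqrtr1.
by rewrite expr1n mulr1.
Qed.

Let B0 : 0 <= B. Proof. exact: le_trans (normr_ge0 _) (fB x). Qed.

Let L0 : 0 <= L.
Proof.
have := le_trans (normr_ge0 _) (fL x (1, 0)).
have -> : enorm (1, 0) = 1 :> R by rewrite /enorm /dotp/= mulr1 mulr0 addr0 sqrtr1.
by rewrite mulr1.
Qed.

Let slope_diff_near z : 0 < enorm z -> `|slope_diff z| <= 2 * K / enorm z.
Proof.
move=> z0; rewrite /slope_diff normrM normrV ?unitfE ?expf_neq0 ?gt_eqF//.
rewrite (ger0_norm (sqr_ge0 (enorm z))).
rewrite ler_pdivrMr ?exprn_gt0// (le_trans (slope_sub_le fK gxx' z0))//.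
by rewrite le_eqVlt; apply/orP; left; apply/eqP; field; rewrite gt_eqF.
Qed.

Let slope_diff_far z : 0 < enorm z -> `|slope_diff z| <= 4 * B / enorm z ^+ 3.
Proof.
move=> z0; rewrite /slope_diff normrM normrV ?unitfE ?expf_neq0 ?gt_eqF//.
rewrite (ger0_norm (sqr_ge0 (enorm z))).
rewrite ler_pdivrMr ?exprn_gt0//.
rewrite (le_trans (ler_normB _ _))// (le_trans (lerD (norm_slope_le x' fB z0) (norm_slope_le x fB z0)))//.
by rewrite le_eqVlt; apply/orP; left; apply/eqP; field; rewrite gt_eqF.
Qed.

(* l *: y on R * R, in a form that unfolds to coordinates. *)
Let sc (l : R) y : R * R := (l * y.1, l * y.2).

Let enorm_sc l y : enorm (sc l y) = `|l| * enorm y.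
Proof. exact: enormZ. Qed.

Let measurable_sc (l : R) (g : R * R -> R) : measurable_fun setT g ->
  measurable_fun setT (fun y => g (sc l y)).
Proof. by move=> mg; apply: (measurableT_comp mg); rewrite /sc; meas. Qed.

Let annulus_sc (l e r : R) : 0 < l ->
  (fun y : R * R => (l * y.1, l * y.2)) @^-1` (annulus (l * e) (l * r)) = annulus e r.
Proof.
move=> l0; apply/seteqP; split => y; rewrite /annulus /=;
  by rewrite -/(sc l y) enorm_sc (gtr0_norm l0) !ltr_pM2l.
Qed.

(* Dilation turns J e r l into the integral of slope_diff over
   l e < |z| < l r, so that J e r 2 - J e r 1 only sees the two ends of the
   annulus and is small; on the other hand the derivative of J in l is the
   integral of the radial parts over the same annulus. The mean value theorem
   thus yields arbitrarily small and large radii for which the radial parts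
   contribute almost nothing, and no divergence theorem is needed. *)
Let J (e r l : R) : R :=
  \int[mu2]_(y in annulus e r) ((slope f x' (sc l y) - slope f x (sc l y)) / enorm y ^+ 2).

Let J_dilation (e r l : R) : 0 < e -> 0 < l ->
  J e r l = \int[mu2]_(z in annulus (l * e) (l * r)) slope_diff z.
Proof.
move=> e0 l0.
rewrite (Rintegral_dilation l0 (measurable_annulus (l * e) (l * r)) measurable_slope_diff) annulus_sc//.
  rewrite /J -RintegralZl; last 2 first.
  - exact: measurable_annulus.
  - apply: (@integrable_annulus (fun y => slope_diff (sc l y)) e r (2 * K / (l * e))).
      exact: measurable_sc.
    move=> y /= /andP[ey _]; have y0 := lt_trans e0 ey.
    have ly0 : 0 < enorm (sc l y) by rewrite enorm_sc mulr_gt0// gtr0_norm.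
    rewrite (le_trans (slope_diff_near ly0))// enorm_sc (gtr0_norm l0).
    by rewrite ler_wpM2l ?mulr_ge0// lef_pV2 ?posrE ?mulr_gt0// ler_wpM2l// ltW.
  apply: eq_Rintegral => y; rewrite inE /= => /andP[ey _]; have y0 := lt_trans e0 ey.
  rewrite /slope_diff -/(sc l y) enorm_sc (gtr0_norm l0); field.
  by rewrite !gt_eqF.
apply: (@integrable_annulus (fun y => slope_diff (sc l y)) e r (2 * K / (l * e))).
  exact: measurable_sc.
move=> y /= /andP[ey _]; have y0 := lt_trans e0 ey.
have ly0 : 0 < enorm (sc l y) by rewrite enorm_sc mulr_gt0// gtr0_norm.
rewrite (le_trans (slope_diff_near ly0))// enorm_sc (gtr0_norm l0).
by rewrite ler_wpM2l ?mulr_ge0// lef_pV2 ?posrE ?mulr_gt0// ler_wpM2l// ltW.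
Qed.

(** The two annuli differ only in e < |z| <= 2 e and r <= |z| < 2 r. These lie in discs of radius 3
    e and 2 r, where 3 e leaves room for the circle |z| = 2 e. Bounding the disc of radius R by its
    square of area 4 R^2 gives (2 K / e) 36 e^2 and (4 B / r^3) 16 r^2. *)
Let J_increment (e r : R) : 0 < e -> 0 < r ->
  `|J e r 2 - J e r 1| <= 72 * K * e + 64 * B / r.
Proof.
move=> e0 r0.
rewrite !J_dilation// !mul1r.
pose A1 := annulus e r; pose A2 := annulus (2 * e) (2 * r).
have mA1 := measurable_annulus e r; have mA2 := measurable_annulus (2 * e) (2 * r).
have sd_near (e1 : R) (z : R * R) : 0 < e1 -> e1 < enorm z -> `|slope_diff z| <= 2 * K / e1.
  move=> e10 ez; have z0 := lt_trans e10 ez.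
  by rewrite (le_trans (slope_diff_near z0))// ler_wpM2l ?mulr_ge0// lef_pV2 ?posrE// ltW.
have I1 : mu2.-integrable A1 (EFin \o slope_diff).
  apply: (@integrable_annulus _ _ _ (2 * K / e)) => // z /andP[ez _].
  exact: sd_near.
have I2 : mu2.-integrable A2 (EFin \o slope_diff).
  apply: (@integrable_annulus _ _ _ (2 * K / (2 * e))) => // z /andP[ez _].
  by apply: sd_near => //; exact: mulr_gt0.
rewrite Rintegral_mkcond [in X in _ - X]Rintegral_mkcond.
have I1' : mu2.-integrable setT (EFin \o (slope_diff \_ A1)).
  by rewrite -restrict_EFin -integrable_mkcond.
have I2' : mu2.-integrable setT (EFin \o (slope_diff \_ A2)).
  by rewrite -restrict_EFin -integrable_mkcond.
rewrite -RintegralB//.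
pose D1 : set (measurableTypeR R * measurableTypeR R)%type := [set y | enorm y < 3 * e].
pose D2 : set (measurableTypeR R * measurableTypeR R)%type := [set y | enorm y < 2 * r].
have mD1 : measurable D1 := measurable_disc (3 * e).
have mD2 : measurable D2 := measurable_disc (2 * r).
pose M1 : R := 2 * K / e; pose M2 : R := 4 * B / r ^+ 3.
have M10 : 0 <= M1 by rewrite divr_ge0 ?mulr_ge0// ltW.
have M20 : 0 <= M2 by rewrite divr_ge0 ?mulr_ge0 ?exprn_ge0// ltW.
have e3 : 0 <= 3 * e by rewrite mulr_ge0// ltW.
have r2 : 0 <= 2 * r by rewrite mulr_ge0// ltW.
have fin1 : mu2 D1 \is a fin_num by rewrite ge0_fin_numE// lebesgue2_disc.
have fin2 : mu2 D2 \is a fin_num by rewrite ge0_fin_numE// lebesgue2_disc.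
have J1 : mu2.-integrable D1 (EFin \o cst M1).
  by apply: measurable_bounded_integrable => //; [exact: lebesgue2_disc|exact: bounded_cst].
have J2 : mu2.-integrable D2 (EFin \o cst M2).
  by apply: measurable_bounded_integrable => //; [exact: lebesgue2_disc|exact: bounded_cst].
have J1' : mu2.-integrable setT (EFin \o (cst M1 \_ D1)).
  by rewrite -restrict_EFin -integrable_mkcond.
have J2' : mu2.-integrable setT (EFin \o (cst M2 \_ D2)).
  by rewrite -restrict_EFin -integrable_mkcond.
have Id : mu2.-integrable setT (EFin \o (fun z => (slope_diff \_ A2) z - (slope_diff \_ A1) z)).
  by have := integrableB measurableT I2' I1'.
have Jd : mu2.-integrable setT (EFin \o (fun z => (cst M1 \_ D1) z + (cst M2 \_ D2) z)).
  by have := integrableD measurableT J1' J2'.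
apply: (le_trans (le_normr_Rintegral _ Id)) => //.
apply: (@le_trans _ _ (\int[mu2]_z ((cst M1 \_ D1) z + (cst M2 \_ D2) z))).
  apply: le_Rintegral => //; first exact: integrable_norm Id.
  move=> z _.
  have P1 : 0 <= (cst M1 \_ D1) z by rewrite patchE; case: ifP.
  have P2 : 0 <= (cst M2 \_ D2) z by rewrite patchE; case: ifP.
  rewrite !(patchE _ A1) !(patchE _ A2).
  have [/set_mem/= A2z|A2z] := boolP (z \in A2); have [/set_mem/= A1z|A1z] := boolP (z \in A1).
  - by rewrite subrr normr0 addr_ge0.
  - rewrite subr0.
    have rz : r <= enorm z.
      rewrite leNgt; apply/negP => zr; move/negP : A1z; apply; rewrite inE /A1 /annulus/=.
      case/andP: A2z => ez _; rewrite zr andbT (lt_trans _ ez)//.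
      by rewrite ltr_pMl// ltr1n.
    have D2z : z \in D2 by rewrite inE /D2/=; case/andP: A2z.
    have zp := lt_le_trans r0 rz.
    rewrite (patchE _ D2) D2z (le_trans (slope_diff_far zp))// ler_wpDl//.
    rewrite /M2 ler_wpM2l ?mulr_ge0// lef_pV2 ?posrE ?exprn_gt0//.
    by rewrite lerXn2r ?nnegrE ?enorm_ge0// ltW.
  - rewrite sub0r normrN.
    case/andP: A1z => ez zr.
    have D1z : z \in D1.
      rewrite inE /D1/= ltNge; apply/negP => z3; move/negP : A2z; apply; rewrite inE /A2 /annulus/=.
      apply/andP; split; first by rewrite (lt_le_trans _ z3)// ltr_pM2r// ltr_nat.
      by rewrite (lt_trans zr)// ltr_pMl// ltr1n.
    by rewrite (patchE _ D1) D1z (le_trans (sd_near _ _ e0 ez))// ler_wpDr.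
  - by rewrite subrr normr0 addr_ge0.
rewrite RintegralD// -!Rintegral_mkcond !Rintegral_cst// lerD//.
- apply: (@le_trans _ _ (M1 * (4 * (3 * e) ^+ 2))).
    rewrite ler_wpM2l// -lee_fin fineK//; exact: lebesgue2_disc_le.
  by rewrite le_eqVlt; apply/orP; left; apply/eqP; rewrite /M1; field; rewrite gt_eqF.
- apply: (@le_trans _ _ (M2 * (4 * (2 * r) ^+ 2))).
    rewrite ler_wpM2l// -lee_fin fineK//; exact: lebesgue2_disc_le.
  by rewrite le_eqVlt; apply/orP; left; apply/eqP; rewrite /M2; field; rewrite gt_eqF.
Qed.

Let integrable_radial (y : R * R) (e r : R) : 0 < e ->
  mu2.-integrable (annulus e r) (EFin \o radial_part f y).
Proof.
move=> e0; apply: (@integrable_annulus _ _ _ (2 * L / e ^+ 2)).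
  exact: measurable_radial_part fK _.
move=> z /= /andP[ez _]; have z0 := lt_trans e0 ez.
rewrite (le_trans (norm_radial_part _ fK fL z0))// ler_wpM2l ?mulr_ge0//.
by rewrite lef_pV2 ?posrE ?exprn_gt0// lerXn2r ?nnegrE ?enorm_ge0 ?ltW.
Qed.

Let integrable_main (y : R * R) (e r : R) : 0 < e ->
  mu2.-integrable (annulus e r) (EFin \o main_part f y).
Proof.
move=> e0; apply: (@integrable_annulus _ _ _ (2 * L / e ^+ 2)).
  exact: measurable_main_part.
move=> z /= /andP[ez _]; have z0 := lt_trans e0 ez.
rewrite (le_trans (norm_main_part _ fK fL z0))// ler_wpM2l ?mulr_ge0//.
by rewrite lef_pV2 ?posrE ?exprn_gt0// lerXn2r ?nnegrE ?enorm_ge0 ?ltW.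
Qed.

Let radial_diff z := radial_part f x' z - radial_part f x z.

Let measurable_radial_diff : measurable_fun setT radial_diff.
Proof. by apply: measurable_funB; exact: measurable_radial_part fK _. Qed.

Let radial_diff_bound z : 0 < enorm z -> `|radial_diff z| <= 4 * L / enorm z ^+ 2.
Proof.
move=> z0; rewrite /radial_diff (le_trans (ler_normB _ _))//.
rewrite (le_trans (lerD (norm_radial_part x' fK fL z0) (norm_radial_part x fK fL z0)))//.
by rewrite le_eqVlt; apply/orP; left; apply/eqP; ring.
Qed.

Let is_derive_J_integrand y (l : R) : 0 < l -> 0 < enorm y ->
  is_derive l (1 : R) (fun s => (slope f x' (sc s y) - slope f x (sc s y)) / enorm y ^+ 2)
    (l * radial_diff (sc l y)).
Proof.
move=> l0 y0.
have i1 := is_derive_slope x' fK l0 y0; have i2 := is_derive_slope x fK l0 y0.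
have i3 : is_derive l (1 : R) (fun s => ((enorm y ^+ 2)^-1 : R) * (slope f x' (s *: y) - slope f x (s *: y)))
   (l * radial_diff (sc l y)).
  apply: is_derive_eq; rewrite /GRing.scale/= /radial_diff -/(sc l y).
  by field; rewrite gt_eqF.
have -> : (fun s => (slope f x' (sc s y) - slope f x (sc s y)) / enorm y ^+ 2) =
  (fun s => ((enorm y ^+ 2)^-1 : R) * (slope f x' (s *: y) - slope f x (s *: y))) => //.
by apply/funext => s; rewrite mulrC.
Qed.

(** In the variable y the annulus is fixed and l sits in the integrand alone, which is what permits
    differentiation under the integral. The interval ]1/2, 3[ is an open neighbourhood of [1, 2]
    that stays away from 0. *)
Let J_derive (e r l : R) : 0 < e -> 2^-1 < l -> l < 3 ->
  is_derive l (1 : R) (J e r) (\int[mu2]_(y in annulus e r) (l * radial_diff (sc l y))).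
Proof.
move=> e0 l1 l3.
pose G (s : R) y := (slope f x' (sc s y) - slope f x (sc s y)) / enorm y ^+ 2.
pose I : set R := `]2^-1, 3[%classic.
have Ipos (s : R) : I s -> 2^-1 < s /\ 0 < s.
  rewrite /I/= in_itv/= => /andP[h _]; split => //; by rewrite (lt_trans _ h)// invr_gt0.
have Il : I l by rewrite /I/= in_itv/= l1.
have mG s : measurable_fun setT (G s).
  apply: measurable_funM.
    by apply: measurable_funB; apply: measurable_sc; exact: measurable_slope.
  apply: measurable_invf; apply: measurable_funX; exact: measurable_enorm.
have intG (s : R) : I s -> mu2.-integrable (annulus e r) (EFin \o G s).
  move=> /Ipos[_ s0]; apply: (@integrable_annulus _ _ _ (4 * B / (s * e ^+ 3))) => // y /andP[ey _].
  have y0 := lt_trans e0 ey.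
  have sy0 : 0 < enorm (sc s y) by rewrite enorm_sc mulr_gt0// gtr0_norm.
  have -> : G s y = s ^+ 2 * slope_diff (sc s y).
    rewrite /G /slope_diff enorm_sc (gtr0_norm s0); field; by rewrite !gt_eqF.
  rewrite normrM (ger0_norm (sqr_ge0 s)).
  rewrite (le_trans (ler_wpM2l (sqr_ge0 s) (slope_diff_far sy0)))// enorm_sc (gtr0_norm s0).
  have -> : s ^+ 2 * (4 * B / (s * enorm y) ^+ 3) = 4 * B / (s * enorm y ^+ 3).
    by field; rewrite !gt_eqF.
  rewrite ler_wpM2l ?mulr_ge0// lef_pV2 ?posrE ?mulr_gt0 ?exprn_gt0//.
  by rewrite ler_wpM2l ?(ltW s0)// lerXn2r ?nnegrE ?enorm_ge0 ?ltW.
have derG (s : R) y : I s -> annulus e r y -> is_derive s (1 : R) (G ^~ y) (s * radial_diff (sc s y)).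
  move=> /Ipos[_ s0] /andP[ey _]; apply: is_derive_J_integrand => //; exact: lt_trans e0 ey.
have dG (s : R) y : I s -> annulus e r y -> derivable (G ^~ y) s 1.
  by move=> Is Ay; have [] := derG s y Is Ay.
have d1E (s : R) y : I s -> annulus e r y -> partial1of2 G s y = s * radial_diff (sc s y).
  by move=> Is Ay; rewrite partial1of2E; have [_] := derG s y Is Ay.
(* From s * 4 L / (s |y|)^2 = 4 L / (s |y|^2) with s > 1/2 and |y| > e. *)
pose M : R := 8 * L / e ^+ 2.
have M0 : 0 <= M by rewrite divr_ge0 ?mulr_ge0 ?exprn_ge0// ltW.
have IM : mu2.-integrable (annulus e r) (EFin \o cst M).
  by apply: (@integrable_annulus _ _ _ M) => // y _; rewrite ger0_norm.
have Gub (s : R) y : I s -> annulus e r y -> `|partial1of2 G s y| <= cst M y.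
  move=> Is Ay; rewrite d1E//; have [s2 s0] := Ipos s Is.
  case/andP: Ay => ey _; have y0 := lt_trans e0 ey.
  have sy0 : 0 < enorm (sc s y) by rewrite enorm_sc mulr_gt0// gtr0_norm.
  rewrite normrM (gtr0_norm s0) (le_trans (ler_wpM2l (ltW s0) (radial_diff_bound sy0)))//.
  rewrite enorm_sc (gtr0_norm s0).
  have -> : s * (4 * L / (s * enorm y) ^+ 2) = 4 * L * (s^-1 * (enorm y ^+ 2)^-1).
    by field; rewrite !gt_eqF.
  rewrite /cst /M (_ : 8 * L / e ^+ 2 = 4 * L * (2 * (e ^+ 2)^-1)); last by ring.
  rewrite ler_wpM2l ?mulr_ge0// ler_pM ?invr_ge0 ?exprn_ge0 ?enorm_ge0 ?(ltW s0)//.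
    by rewrite -[leRHS]invrK lef_pV2 ?posrE ?invr_gt0// ltW.
  by rewrite lef_pV2 ?posrE ?exprn_gt0// lerXn2r ?nnegrE ?enorm_ge0 ?ltW.
have mA := measurable_annulus e r.
have D1 := derivable_under_integral mA Il intG dG (fun=> M0) IM Gub.
have D2 := differentiation_under_integral mA Il intG dG (fun=> M0) IM Gub.
split; first exact: D1.
rewrite derive1E in D2; rewrite D2.
by apply: eq_Rintegral => y; rewrite inE => Ay; exact: d1E.
Qed.

(** At the mean value point l the radial integrals differ by l ([J e r 2] - [J e r 1]): of the
    Jacobian l^2 one power belongs to the derivative of J, and the other one, at most 2, is the
    leading factor of the bound. The main parts only help, by [main_part_le]. *)
Let PV_increment (e r : R) : 0 < e -> 0 < r ->
  exists2 l, 1 <= l <= 2 &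
  \int[mu2]_(z in annulus (l * e) (l * r)) muskat_integrand f x' z -
  \int[mu2]_(z in annulus (l * e) (l * r)) muskat_integrand f x z <=
  2 * (72 * K * e + 64 * B / r).
Proof.
move=> e0 r0.
have h2 : 2^-1 < 1 :> R by rewrite invf_lt1// ltr1n.
have dJ (l : R) : l \in `]1, 2[ -> is_derive l (1 : R) (J e r)
    (\int[mu2]_(y in annulus e r) (l * radial_diff (sc l y))).
  rewrite in_itv/= => /andP[l1 l2]; apply: J_derive => //; first exact: lt_trans h2 l1.
  by rewrite (lt_trans l2)// ltr_nat.
have cJ : {within `[1, 2], continuous (J e r)}.
  apply: derivable_within_continuous => l; rewrite in_itv/= => /andP[l1 l2].
  have [] // := @J_derive e r l e0 (lt_le_trans h2 l1) _.
  by rewrite (le_lt_trans l2)// ltr_nat.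
have [l] := MVT (ltr_nat R 1 2) dJ cJ.
rewrite in_itv/= => /andP[l1 l2] E.
exists l; first by rewrite !ltW.
have l0 : 0 < l := lt_trans ltr01 l1.
have le0 : 0 < l * e by rewrite mulr_gt0.
have mA := measurable_annulus (l * e) (l * r).
have splitE y : \int[mu2]_(z in annulus (l * e) (l * r)) muskat_integrand f y z =
   \int[mu2]_(z in annulus (l * e) (l * r)) main_part f y z -
   \int[mu2]_(z in annulus (l * e) (l * r)) radial_part f y z.
  rewrite -RintegralB//; [|exact: integrable_main|exact: integrable_radial].
  apply: eq_Rintegral => z; rewrite inE => /andP[ez _].
  by rewrite muskat_integrandE// (lt_trans le0).
have main_le : \int[mu2]_(z in annulus (l * e) (l * r)) main_part f x' z <=
    \int[mu2]_(z in annulus (l * e) (l * r)) main_part f x z.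
  apply: le_Rintegral => //; [exact: integrable_main|exact: integrable_main|].
  move=> z /andP[ez _]; apply: (main_part_le fK fL L5) => //; exact: lt_trans le0 ez.
have radE : \int[mu2]_(z in annulus (l * e) (l * r)) radial_part f x' z -
    \int[mu2]_(z in annulus (l * e) (l * r)) radial_part f x z = l * (J e r 2 - J e r 1).
  have Isc : mu2.-integrable (annulus e r) (EFin \o (fun y => radial_diff (sc l y))).
    apply: (@integrable_annulus _ _ _ (4 * L / (l * e) ^+ 2)).
      exact: measurable_sc.
    move=> y /= /andP[ey _]; have y0 := lt_trans e0 ey.
    have sy0 : 0 < enorm (sc l y) by rewrite enorm_sc mulr_gt0// gtr0_norm.
    rewrite (le_trans (radial_diff_bound sy0))// enorm_sc (gtr0_norm l0).
    rewrite ler_wpM2l ?mulr_ge0// lef_pV2 ?posrE ?exprn_gt0 ?mulr_gt0//.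
    rewrite lerXn2r ?nnegrE ?(ltW le0)//; first by rewrite mulr_ge0 ?enorm_ge0// ltW.
    by rewrite ler_wpM2l ?ltW.
  rewrite -RintegralB//; [|exact: integrable_radial|exact: integrable_radial].
  rewrite (Rintegral_dilation l0 mA measurable_radial_diff) annulus_sc//.
  rewrite E RintegralZl//; last exact: measurable_annulus.
  by rewrite /sc; ring.
rewrite (splitE x') (splitE x); apply: (le_trans (ler_sub_cancel _ _ main_le)); rewrite radE.
rewrite (le_trans (ler_norm _))// normrN normrM (gtr0_norm l0).
by apply: ler_pM => //; [exact: ltW|exact: ltW|exact: J_increment].
Qed.

(** The tolerance k is shared in three: one third for each principal value against its truncated
    integral, one for the increment on the good annulus. As l is not under control, e and r must be
    such that l e and l r are admissible for every l in [1, 2]. *)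
Lemma PV_le (a a' : R) : is_PV (muskat_integrand f x) a -> is_PV (muskat_integrand f x') a' ->
  a' <= a.
Proof.
move=> pv pv'; apply/ler_addgt0Pl => k k0.
have k3 : 0 < k / 3 by rewrite divr_gt0.
have /cvgrPdist_le/(_ _ k3) [[P1 Q1] /= [HP1 HQ1] H1] := pv.
have /cvgrPdist_le/(_ _ k3) [[P2 Q2] /= [HP2 HQ2] H2] := pv'.
have [d /= d0 Hd] : \forall e \near (0 : R)^'+, P1 e /\ P2 e.
  by near=> e; split; near: e.
have [A [Areal HA]] : \forall r \near +oo%R, Q1 r /\ Q2 r by near=> r; split; near: r.
have K1 : 0 < 144 * K + 1 by rewrite ltr_wpDl// mulr_ge0.
(* The bound d / 3 gives 2 e < d; the other one makes 144 K e at most k / 6, as r below does for 128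
   B / r. The added 1 in the denominator covers K = 0. *)
pose e : R := Num.min (d / 3) (k / 6 / (144 * K + 1)).
have e0 : 0 < e by rewrite lt_min; apply/andP; split; rewrite !divr_gt0.
have ed : e <= d / 3 by rewrite ge_min lexx.
have eK : 144 * K * e <= k / 6.
  apply: (@le_trans _ _ ((144 * K + 1) * e)); first by rewrite ler_wpM2r ?(ltW e0)// lerDl.
  by rewrite mulrC -ler_pdivlMr// ge_min lexx orbT.
pose r : R := Num.max (A + 1) (128 * B * 6 / k + 1).
have r0 : 0 < r.
  rewrite lt_max; apply/orP; right; rewrite ltr_wpDl// divr_ge0 ?(ltW k0)//.
  by rewrite !mulr_ge0.
have rA : A + 1 <= r by rewrite le_max lexx.
have rB : 128 * B / r <= k / 6.
  rewrite ler_pdivrMr//.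
  have h : 128 * B * 6 / k <= r by rewrite le_max (ler_wpDr _ (lexx _)) ?orbT.
  rewrite ler_pdivrMr// in h.
  by rewrite mulrAC ler_pdivlMr// (mulrC k).
have [l /andP[l1 l2] Hl] := PV_increment e0 r0.
have l0 : 0 < l := lt_le_trans ltr01 l1.
have le_d : l * e < d.
  have h1 : l * e <= 2 * e by rewrite ler_wpM2r// ltW.
  exact: le_lt_trans h1 (double_lt_of_third d0 ed).
have le0 : 0 < l * e by rewrite mulr_gt0.
have [p1 p2] : P1 (l * e) /\ P2 (l * e).
  by apply: Hd => //=; rewrite sub0r normrN gtr0_norm.
have [q1 q2] : Q1 (l * r) /\ Q2 (l * r).
  apply: HA; apply: (@lt_le_trans _ _ (A + 1)); first by rewrite ltrDl.
  by rewrite (le_trans rA)// ler_peMl// ltW.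
have B1 := H1 (l * e, l * r) (conj p1 q1).
have B2 := H2 (l * e, l * r) (conj p2 q2).
rewrite /= distrC in B1; rewrite /= in B2.
have B1' := le_trans (ler_norm _) B1; have B2' := le_trans (ler_norm _) B2.
have Hl' : 2 * (72 * K * e + 64 * B / r) <= k / 3.
  rewrite (_ : 2 * _ = 144 * K * e + 128 * B / r); last by field; rewrite gt_eqF.
  by rewrite (le_trans (lerD eK rB))// sixth_add_sixth.
exact: (ler_three_thirds B1' B2' (le_trans Hl Hl')).
Unshelve. all: by end_near. Qed.


End comparison.
End principal_value.

(** * Evolution in time *)

Section time_evolution.
Context {R : realType}.
Local Notation mu2 := ((@lebesgue_measure R) \x (@lebesgue_measure R))%E.
Implicit Types (f : R * R -> R) (x y z h : R * R).

Lemma Lfun2_sub f g : f \in Lfun mu2 2%:E -> g \in Lfun mu2 2%:E -> f \- g \in Lfun mu2 2%:E.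
Proof.
move=> f2 g2.
have p1 : (1 <= (2%:E : \bar R))%E by rewrite lee_fin ler1n.
have := (Lfun_submod_closed mu2 p1).2 (-1) g f g2 f2.
suff -> : -1 *: g + f = f \- g by [].
by apply/funext => x; change (-1 * g x + f x = f x - g x); rewrite mulN1r addrC.
Qed.

Lemma sobolev_sub (s : R) f g : sobolev s f -> sobolev s g -> (sobolev_norm s (f \- g)%R < +oo)%E ->
  sobolev s (f \- g).
Proof.
move=> [cf f2 _] [cg g2 _] fg; split => //; last exact: Lfun2_sub.
by move=> x; apply: cvgB; [exact: cf|exact: cg].
Qed.

Lemma sobolev_regular (s : R) f : 4 <= s -> sobolev s f ->
  exists K : R, [/\ 0 < K, forall x, `|f x| <= K, lipschitz_with K f & C11 K f].
Proof.
move=> s4 sf; have [_ _ nf] := sf.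
have [e e0 lt_e] : exists2 e : R, 0 < e & (sobolev_norm s f < e%:E)%E.
  move: nf; case: (sobolev_norm s f) => [r| |] // _.
    exists (`|r| + 1); first by rewrite ltr_wpDl.
    by rewrite lte_fin (le_lt_trans (ler_norm r))// ltrDl.
  by exists 1 => //; rewrite ltNye.
have [bf lf [p pf]] := sobolev_C11 s4 e0 sf lt_e.
exists (embedding_cst * e); split => //.
  by rewrite mulr_gt0// embedding_cst_gt0.
by move=> x h; rewrite (grad_C11 pf); exact: pf.
Qed.

Definition uniform_at (T : R) (F : R -> R * R -> R) (t0 : R) : Prop :=
  forall e : R, 0 < e -> exists2 d : R, 0 < d & forall t, 0 <= t <= T -> `|t - t0| < d ->
    (forall x, `|F t x - F t0 x| <= e) /\ lipschitz_with e (F t \- F t0).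

Lemma continuous_sobolev_uniform (s T : R) (F : R -> R * R -> R) : 4 <= s ->
  continuous_sobolev s T F -> forall t0, 0 <= t0 <= T -> uniform_at T F t0.
Proof.
move=> s4 cF t0 t0T e e0; have [sF0 /fine_cvgP[fin0 /cvgrPdist_le lim0]] := cF t0 t0T.
have C0 := @embedding_cst_gt0 R.
pose k : R := e / embedding_cst / 2.
have k0 : 0 < k by rewrite !divr_gt0.
have : \forall t \near within [set t | 0 <= t <= T] (nbhs t0),
    (sobolev_norm s (F t \- F t0)%R < (e / embedding_cst)%:E)%E.
  near=> t.
  have ft : sobolev_norm s (F t \- F t0)%R \is a fin_num by near: t.
  rewrite -(fineK ft) lte_fin.
  have : `|0 - fine (sobolev_norm s (F t \- F t0)%R)| <= k by near: t; exact: lim0.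
  rewrite sub0r normrN => /(le_trans (ler_norm _)) /le_lt_trans; apply.
  by rewrite ltr_pdivrMr// ltr_pMr ?divr_gt0// ltr1n.
move=> [d /= d0 Hd]; exists d => // t tT td.
have lt_t : (sobolev_norm s (F t \- F t0)%R < (e / embedding_cst)%:E)%E.
  by apply: Hd => //=; rewrite distrC.
have [sFt _] := cF t tT.
have sD := sobolev_sub sFt sF0 (lt_trans lt_t (ltry _)).
have ec : 0 < e / embedding_cst by rewrite divr_gt0.
have [b1 b2 _] := sobolev_C11 s4 ec sD lt_t.
have E : embedding_cst * (e / embedding_cst) = e by rewrite mulrC divfK// gt_eqF.
by rewrite E in b1 b2; split.
Unshelve. all: by end_near. Qed.

Lemma lebesgue2_square (x : R * R) (a : R) : 0 < a ->
  mu2 (`[x.1, (x.1 + a)%R]%classic `*` `[x.2, (x.2 + a)%R]%classic) = (a ^+ 2)%:E.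
Proof.
move=> a0.
have H (t : R) : @lebesgue_measure R `[t, (t + a)%R]%classic = a%:E.
  by rewrite lebesgue_measure_itv/= lte_fin ltrDl a0 -EFinB addrAC subrr add0r.
rewrite product_measure1E//; transitivity (a%:E * a%:E)%E; first by congr (_ * _)%E; exact: H.
by rewrite -EFinM expr2.
Qed.

Lemma ler_half_of_triangle (e p q w : R) : e < p -> p <= w + q -> w <= e / 2 -> e / 2 <= q.
Proof. by move=> *; lra. Qed.

(** If |f(x)| > e, then |f| >= e / 2 on a whole square of side e / (4 K) at x, which carries a fixed
    amount c of the integral of f^2; far out the tail of this integral is at most c / 2. *)
Lemma lipschitz_Lfun2_decay f (K : R) : 0 < K -> f \in Lfun mu2 2%:E -> lipschitz_with K f ->
  forall e : R, 0 < e -> exists r : R, forall x, r < enorm x -> `|f x| <= e.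
Proof.
move=> K0 f2 fK e e0.
have mf := Lfun2_measurable f2; have If2 := Lfun2_integrable_sqr f2.
pose F (n : nat) := (fun y => f y ^+ 2) \_ [set y : R * R | n%:R <= enorm y].
have mD (n : nat) : measurable ([set y | n%:R <= enorm y] : set (measurableTypeR R * measurableTypeR R)%type).
  rewrite (_ : [set y | _] = ~` [set y : R * R | enorm y < n%:R]).
    by apply: measurableC; exact: measurable_disc.
  by apply/seteqP; split => y /=; rewrite leNgt => /negP.
have IF n : mu2.-integrable setT (EFin \o F n).
  by rewrite /F -restrict_EFin -integrable_mkcond//; exact: integrableS If2.
have mF n : measurable_fun setT (F n) := integrable_measurable (IF n).
have lim0 : \int[mu2]_y F n y @[n --> \oo] --> \int[mu2]_y (0 : R).
  apply: (Rintegral_dominated_cvg _ _ If2) => //.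
  - move=> n y; rewrite /F patchE; case: ifP => _; first by rewrite ger0_norm// sqr_ge0.
    by rewrite normr0 sqr_ge0.
  - move=> y; apply: cvg_near_cst; near=> n; rewrite /F patchE memNset//=.
    apply/negP; rewrite -ltNge; near: n; exact: nbhs_infty_gtr.
rewrite [X in _ --> X]/Rintegral integral0 /= in lim0.
pose a : R := e / (4 * K).
have a0 : 0 < a by rewrite divr_gt0// mulr_gt0.
pose c : R := (e / 2) ^+ 2 * a ^+ 2.
have c0 : 0 < c by rewrite mulr_gt0// exprn_gt0// divr_gt0.
have c20 : 0 < c / 2 by rewrite divr_gt0.
have /cvgrPdist_le/(_ _ c20) [n _ /(_ n (leqnn n)) Hn] := lim0.
(* The margin 2 a bounds the distance from x to the points of the square, so the square stays in the
   region |y| >= n. *)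
exists (n%:R + 2 * a) => x hx; rewrite leNgt; apply/negP => fx.
pose Q : set (measurableTypeR R * measurableTypeR R)%type :=
  `[x.1, (x.1 + a)%R]%classic `*` `[x.2, (x.2 + a)%R]%classic.
have mQ : measurable Q by apply: measurableX; exact: measurable_itv.
have QF y : Q y -> (e / 2) ^+ 2 <= F n y.
  move=> [/=]; rewrite !in_itv/= => /andP[h1 h2] /andP[h3 h4].
  have yx : enorm (x - y) <= 2 * a.
    rewrite (le_trans (enorm_le_norm1 _))// mulr_natl mulr2n lerD//=.
      by rewrite ler0_norm ?subr_le0// opprB lerBlDl.
    by rewrite ler0_norm ?subr_le0// opprB lerBlDl.
  have yn : n%:R <= enorm y.
    have := enormD (x - y) y; rewrite subrK => h5.
    have h6 := le_trans (ltW hx) (le_trans h5 (lerD yx (lexx _))).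
    by rewrite addrC lerD2l in h6.
  rewrite /F patchE mem_set//.
  have fy : e / 2 <= `|f y|.
    have := fK y (x - y); rewrite (_ : y + (x - y) = x); last by rewrite addrC subrK.
    move=> h5.
    have h6 : K * enorm (x - y) <= e / 2.
      apply: (le_trans (ler_wpM2l (ltW K0) yx)).
      by rewrite /a le_eqVlt; apply/orP; left; apply/eqP; field; rewrite gt_eqF.
    have h7 : `|f x| <= `|f x - f y| + `|f y| by rewrite -{1}(subrK (f y) (f x)) ler_normD.
    exact: ler_half_of_triangle fx h7 (le_trans h5 h6).
  rewrite -[leRHS](real_normK (num_real (f y))) lerXn2r ?nnegrE//.
  by rewrite divr_ge0// ltW.
have big : (c%:E <= \int[mu2]_y (F n y)%:E)%E.
  apply: (@le_trans _ _ (\int[mu2]_(y in Q) (F n y)%:E)%E).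
    rewrite (_ : c%:E = \int[mu2]_(y in Q) (cst ((e / 2) ^+ 2)%:E) y)%E; last first.
      rewrite integral_cst// EFinM; congr (_ * _)%E; exact/esym/lebesgue2_square.
    apply: ge0_le_integral => //.
      by move=> y _; rewrite lee_fin sqr_ge0.
    by apply: measurable_funTS; exact: measurable_int (IF n).
  apply: ge0_subset_integral => //; first exact: measurable_int (IF n).
  move=> y _; rewrite lee_fin /F patchE; case: ifP => // _; exact: sqr_ge0.
have : c <= \int[mu2]_y F n y.
  rewrite /Rintegral -lee_fin fineK; first exact: big.
  exact: (integrable_fin_num measurableT (IF n)).
rewrite /= sub0r normrN in Hn => h; have := le_trans h (le_trans (ler_norm _) Hn).
by rewrite leNgt ltr_pdivrMr// ltr_pMr// ltr1n.
Unshelve. all: by end_near. Qed.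

End time_evolution.

(** * The maximum principle for increments *)

Section maximum_principle.
Context {R : realType}.
Implicit Types (f : R * R -> R) (x y z h : R * R).

(** The positive value f(x0) is the threshold: beyond some radius f does not exceed it, so the
    maximum over a compact square containing x0 is global. *)
Lemma decay_max f : continuous f ->
  (forall e : R, 0 < e -> exists r : R, forall x, r < enorm x -> `|f x| <= e) ->
  forall x0, 0 < f x0 -> exists x, forall y, f y <= f x.
Proof.
move=> cf df x0 fx0; have [r Hr] := df _ fx0.
pose M : R := Num.max r (enorm x0).
pose K : set (R * R) := `[- M, M] `*` `[- M, M].
have KP y : enorm y <= M -> K y.
  move=> yM; rewrite /K /= !in_itv/= -!ler_norml.
  by split; apply: (le_trans _ yM); [exact: norm_fst_enorm|exact: norm_snd_enorm].
have x0K : K x0 by apply: KP; rewrite /M le_max lexx orbT.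
have cK : compact K by apply: compact_setX; exact: segment_compact.
have [|c _ Hc] := @compact_EVT_max _ _ f K _ cK (continuous_subspaceT cf).
  by exists x0.
exists c => y; have [/KP yK|yM] := leP (enorm y) M; first by apply: Hc; exact: mem_set.
apply: (le_trans (ler_norm _)); apply: (@le_trans _ _ (f x0)); last by apply: Hc; exact: mem_set.
by apply: Hr; apply: le_lt_trans yM; rewrite /M le_max lexx.
Qed.

Lemma taylor_sub_le_at_max (f1 f2 f3 f4 p q c d : R) :
  - c <= f1 - f2 - p -> f3 - f4 - q <= c -> f1 - f3 <= f2 - f4 -> c <= d -> p - q <= 2 * d.
Proof. by move=> *; lra. Qed.

(** Moving x by s P, with P the difference of the gradients, raises D_h f by s |P|^2 up to an error
    of order s^2 |P|^2, so a small s contradicts maximality unless P = 0. *)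
Lemma grad_eq_at_max f (K : R) x h : C11 K f ->
  (forall y, f (y + h) - f y <= f (x + h) - f x) -> grad f (x + h) = grad f x.
Proof.
move=> fK Hmax; set P := grad f (x + h) - grad f x.
suff P0 : enorm P = 0 by apply/eqP; rewrite -subr_eq0; apply/eqP; exact: enorm_eq0.
have K0 : 0 <= `|K| by [].
have H (s : R) : 0 < s -> s * enorm P ^+ 2 <= 2 * `|K| * (s * enorm P) ^+ 2.
  move=> s0; have h1 := fK (x + h) (s *: P); have h2 := fK x (s *: P).
  have h3 := Hmax (x + s *: P).
  rewrite enormZ (gtr0_norm s0) in h1 h2.
  have h4 : K * (s * enorm P) ^+ 2 <= `|K| * (s * enorm P) ^+ 2.
    by rewrite ler_wpM2r ?sqr_ge0// ler_norm.
  have h5 : s * enorm P ^+ 2 = dotp (grad f (x + h)) (s *: P) - dotp (grad f x) (s *: P).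
    by rewrite sqr_enorm -dotpBl dotpZr.
  rewrite h5; rewrite (addrAC x) in h3.
  move: h1 h2; rewrite !ler_norml => /andP[h1 _] /andP[_ h2].
  by rewrite -mulrA; exact: taylor_sub_le_at_max h1 h2 h3 h4.
have q0 : 0 < 2 * `|K| + 1 by rewrite ltr_wpDl// mulr_ge0.
(* For s = 1 / q with q = 2 |K| + 1 the inequality reads q |P|^2 <= (q - 1) |P|^2. *)
have := H _ (divr_gt0 ltr01 q0).
rewrite -(ler_pM2r (exprn_gt0 2 q0)) exprMn.
have -> : 1 / (2 * `|K| + 1) * enorm P ^+ 2 * (2 * `|K| + 1) ^+ 2 = (2 * `|K| + 1) * enorm P ^+ 2.
  by field; rewrite gt_eqF.
have -> : 2 * `|K| * ((1 / (2 * `|K| + 1)) ^+ 2 * enorm P ^+ 2) * (2 * `|K| + 1) ^+ 2 = 2 * `|K| * enorm P ^+ 2.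
  by field; rewrite gt_eqF.
rewrite mulrDl mul1r gerDl => /(conj (sqr_ge0 (enorm P)))/andP.
by rewrite -eq_le eq_sym sqrf_eq0 => /eqP.
Qed.

Lemma is_derive_ge0_of_left_max (g : R -> R) (t d : R) : 0 < t -> is_derive t (1 : R) g d ->
  (forall u, 0 <= u < t -> g u <= g t) -> 0 <= d.
Proof.
move=> t0 [dg gE] Hmax.
have lim : s^-1 *: ((g \o shift t) (s *: (1 : R)) - g t) @[s --> 0^'] --> d by rewrite -gE; exact: dg.
apply: (cvgr_to_ge (cvg_dnbhs_at_left lim)); near=> s.
have s0 : s < 0 by near: s; exact: nbhs_left_lt.
have st : - t <= s by near: s; apply: nbhs_left_ge; rewrite oppr_lt0.
change (0 <= s^-1 * (g (s * 1 + t) - g t)).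
rewrite mulr1 mulr_le0// ?invr_le0 ?(ltW s0)// subr_le0 Hmax// -lerBlDr sub0r st/=.
by rewrite gtrDr.
Unshelve. all: by end_near. Qed.

Lemma sup_dist_le (T : Type) (F G : T -> R) (i0 : T) (B e : R) :
  (forall i, `|F i| <= B) -> (forall i, `|G i| <= B) -> (forall i, `|F i - G i| <= e) ->
  `|sup (range F) - sup (range G)| <= e.
Proof.
have le_sup (F' G' : T -> R) : (forall i, `|G' i| <= B) ->
    (forall i, `|F' i - G' i| <= e) -> sup (range F') <= sup (range G') + e.
  move=> bG FG; apply: ge_sup; first by exists (F' i0); exists i0.
  move=> _ [i _ <-]; apply: (@le_trans _ _ (G' i + e)).
    by rewrite -lerBlDl (le_trans (ler_norm _)).
  rewrite lerD2r; apply: ub_le_sup; last by exists i.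
  by exists B => _ [j _ <-]; rewrite (le_trans (ler_norm _)).
move=> bF bG FG; rewrite ler_distl lerBlDr le_sup//= 1?le_sup// => i.
by rewrite distrC.
Qed.

Definition shift_diff f h x : R := f (x + h) - f x.

Lemma shift_diff_le f h (B : R) : (forall x, `|f x| <= B) -> forall x, `|shift_diff f h x| <= 2 * B.
Proof.
move=> fB x; rewrite mulr_natl mulr2n (le_trans (ler_normB _ _))//; apply: lerD; exact: fB.
Qed.

Lemma continuous_shift_diff f h : continuous f -> continuous (shift_diff f h).
Proof.
move=> cf x; apply: (@cvgB _ _ _ _ _ (fun y => f (y + h)) f); last exact: cf.
apply: (@continuous_comp _ _ _ (fun y => y + h) f); last exact: cf.
by apply: cvgD; [exact: cvg_id|exact: cvg_cst].
Qed.

Lemma shift_diff_decay f h : (forall e : R, 0 < e -> exists r : R, forall x, r < enorm x -> `|f x| <= e) ->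
  forall e : R, 0 < e -> exists r : R, forall x, r < enorm x -> `|shift_diff f h x| <= e.
Proof.
move=> df e e0; have [r Hr] := df (e / 2) (divr_gt0 e0 (ltr0Sn _ 1)).
exists (r + enorm h) => x xr; rewrite (le_trans (ler_normB _ _))// [leRHS]splitr.
have hx : r < enorm (x + h).
  rewrite -(ltrD2r (enorm h)) (lt_le_trans xr)//.
  by have := enormB (x + h) h; rewrite addrK.
by apply: lerD; apply: Hr => //; rewrite (le_lt_trans _ xr)// lerDl enorm_ge0.
Qed.

(** The tilt e t makes the conclusion strict: at the maximum the time derivative is at most -e by
    the equation, yet nonnegative by maximality over earlier times. Only earlier times are compared
    because the maximum may sit at t1; since t1 < T, the equation still holds there. *)
Lemma shift_diff_max_principle (rho1 rho2 s T L t1 A : R) f0 (f : R -> R * R -> R) h :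
  rho1 < rho2 -> 4 <= s -> muskat_solution rho1 rho2 s T f0 f -> t1 < T ->
  (forall t, 0 <= t <= t1 -> lipschitz_with L (f t)) -> 5 * L ^+ 2 <= 1 ->
  0 <= A -> (forall x, shift_diff (f 0) h x <= A) ->
  forall t x, 0 <= t <= t1 -> shift_diff (f t) h x <= A.
Proof.
move=> rho s4 [cf _ eqf] t1T fL L5 A0 Ainit t x0 /andP[t0 tt1].
have sub t' : 0 <= t' <= t1 -> 0 <= t' <= T.
  by move=> /andP[-> /le_trans]; apply; exact: ltW.
have reg t' : 0 <= t' <= t1 -> exists K : R,
    [/\ 0 < K, forall x, `|f t' x| <= K, lipschitz_with K (f t') & C11 K (f t')].
  by move=> /sub/cf[sf _]; exact: sobolev_regular s4 sf.
rewrite leNgt; apply/negP => Alt; set D0 := shift_diff (f t) h x0 in Alt.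
(* Small enough that e t1 < D0 - A, so the tilted quantity still exceeds A at time t; the 1 covers
   t1 = 0. *)
pose e : R := (D0 - A) / (2 * (t1 + 1)).
have t10 : 0 <= t1 := le_trans t0 tt1.
have e0 : 0 < e by rewrite divr_gt0 ?subr_gt0// mulr_gt0// ltr_wpDl.
have et : A < D0 - e * t.
  rewrite ltrBrDl -ltrBrDr (le_lt_trans (ler_wpM2l (ltW e0) tt1))//.
  rewrite /e mulrAC ltr_pdivrMr ?mulr_gt0 ?ltr_wpDl// ltr_pM2l ?subr_gt0//.
  by rewrite mulrDr mulr1 mulr_natl mulr2n -addrA ltrDl ltr_wpDl.
pose m t' : R := sup (range (shift_diff (f t') h)).
have le_m t' x : 0 <= t' <= t1 -> shift_diff (f t') h x <= m t'.
  move=> /reg[K [_ fK _ _]]; apply: ub_le_sup; last by exists x.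
  by exists (2 * K) => _ [y _ <-]; rewrite (le_trans (ler_norm _))// shift_diff_le.
(* A uniform change of f by k / 2 moves D_h f, and hence its supremum, by at most k. *)
have cm : {within `[0, t1], continuous (fun t' => m t' - e * t')}.
  apply/subspace_continuousP => t' /=; rewrite in_itv/= => t't.
  have ce : (e * u) @[u --> within `[0, t1] (nbhs t')] --> e * t'.
    by apply: cvg_within_filter; apply: cvgMr; exact: cvg_id.
  apply: cvgB ce; apply/cvgrPdist_le => k k0.
  have [d d0 Hd] := continuous_sobolev_uniform s4 cf (sub _ t't) (divr_gt0 k0 (ltr0Sn _ 1)).
  exists d => //= u ud; rewrite in_itv/= => ut.
  have ud' : `|u - t'| < d by rewrite distrC.
  have [Hu _] := Hd u (sub _ ut) ud'.
  have [K1 [_ fK1 _ _]] := reg _ t't; have [K2 [_ fK2 _ _]] := reg _ ut.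
  apply: (@sup_dist_le _ _ _ 0 (2 * Num.max K1 K2)) => [x|x|x].
  - by apply: shift_diff_le => y; rewrite le_max fK1.
  - by apply: shift_diff_le => y; rewrite le_max fK2 orbT.
  rewrite /shift_diff (_ : _ - _ = (f u x - f t' x) - (f u (x + h) - f t' (x + h))); last by ring.
  by rewrite (le_trans (ler_normB _ _))// [leRHS]splitr lerD.
have [tm] := EVT_max t10 cm; rewrite in_itv/= => tmt Hm.
have Am : A < m tm - e * tm.
  apply: (lt_le_trans et); apply: (@le_trans _ _ (m t - e * t)).
    by rewrite lerD2r le_m// t0.
  by apply: Hm; rewrite in_itv/= t0.
have tm0 : 0 < tm.
  move: tmt => /andP[tm0 _]; rewrite lt_def tm0 andbT; apply/eqP => tm00.
  move: Am; rewrite tm00 mulr0 subr0 ltNge => /negP; apply.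
  by apply: ge_sup; [exists (shift_diff (f 0) h 0), 0|move=> _ [y _ <-]; exact: Ainit].
(* Positivity, which comes from [0 <= A], makes the supremum a maximum, as D_h f vanishes at
   infinity. *)
have mtm : 0 < m tm.
  by rewrite (le_lt_trans A0)// (lt_le_trans Am)// gerBl mulr_ge0// ltW.
have [K [K0 fK fLK fC]] := reg _ tmt.
have [[cfm f2 _] _] := cf tm (sub _ tmt).
have [xm Hxm] : exists x, forall y, shift_diff (f tm) h y <= shift_diff (f tm) h x.
  have [_ [x _ <-] xm0] : exists2 y, range (shift_diff (f tm) h) y & 0 < y.
    apply: sup_gt => //; first by exists (shift_diff (f tm) h 0), 0.
  apply: decay_max xm0; first exact: continuous_shift_diff.
  apply: shift_diff_decay; exact: lipschitz_Lfun2_decay K0 f2 fLK.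
have mE : m tm = shift_diff (f tm) h xm.
  apply/eqP; rewrite eq_le le_m// andbT; apply: ge_sup; first by exists (shift_diff (f tm) h 0), 0.
  by move=> _ [y _ <-].
have tmT : 0 < tm < T.
  by rewrite tm0; move: tmt => /andP[_ /le_lt_trans]; apply.
have [a pva da] := eqf tm xm tmT; have [a' pva' da'] := eqf tm (xm + h) tmT.
have aa' : a' <= a.
  apply: (PV_le _ fC fK (fL _ tmt) L5 _ _ pva pva').
  - exact: Lfun2_measurable.
  - exact/esym/(grad_eq_at_max fC).
  - move=> z; have := Hxm (xm - z); rewrite /shift_diff /incr addrAC; move: (f tm _) => ?; lra.
set c := (rho2 - rho1) / (4 * pi) in da da'.
have c0 : 0 < c by rewrite divr_gt0 ?subr_gt0// mulr_gt0// pi_gt0.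
have dg : is_derive tm (1 : R) (fun u => shift_diff (f u) h xm - e * u) (c * a' - c * a - e).
  apply: is_derive_eq; rewrite /GRing.scale/=; ring.
have := is_derive_ge0_of_left_max tm0 dg.
suff H : forall u, 0 <= u < tm -> shift_diff (f u) h xm - e * u <= shift_diff (f tm) h xm - e * tm.
  move=> /(_ H); rewrite leNgt => /negP; apply.
  by rewrite -mulrBr subr_lt0 (le_lt_trans _ e0)// mulr_ge0_le0 ?subr_le0// ltW.
move=> u /andP[u0 utm].
have ut : 0 <= u <= t1 by rewrite u0 (le_trans (ltW utm))//; case/andP: tmt.
rewrite -mE; apply: (@le_trans _ _ (m u - e * u)); first by rewrite lerD2r le_m.
by apply: Hm; rewrite in_itv.
Qed.

End maximum_principle.

(** * Continuation of the Lipschitz bound *)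

Section gradient_bound.
Context {R : realType}.
Implicit Types (f : R * R -> R) (x y z h : R * R).

Lemma lipschitz_of_grad_le f (K L : R) : C11 K f -> (forall x, enorm (grad f x) <= L) ->
  lipschitz_with L f.
Proof.
move=> fK fL x h.
have D (t : R) : is_derive t (1 : R) (fun s => f (x + s *: h)) (dotp (grad f (x + t *: h)) h).
  apply: (@is_derive_quadratic _ _ _ _ (K * enorm h ^+ 2)) => s.
  have := fK (x + t *: h) (s *: h).
  rewrite [(t + s) *: h]scalerDl addrA dotpZr enormZ exprMn real_normK ?num_real//.
  by rewrite [dotp _ _ * s]mulrC -mulrA [enorm h ^+ 2 * _]mulrC.
have [c _] := mean_value 0 1 D; rewrite scale1r scale0r addr0 subr0 mulr1 => ->.
by rewrite (le_trans (norm_dotp _ _))// ler_wpM2r// enorm_ge0.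
Qed.

Lemma lipschitz_withD (L M : R) f (g : R * R -> R) :
  lipschitz_with L f -> lipschitz_with M (g \- f) -> lipschitz_with (L + M) g.
Proof.
move=> fL gM x h; have := lerD (fL x h) (gM x h); rewrite -mulrDl => /(le_trans _); apply.
rewrite (_ : g (x + h) - g x = (f (x + h) - f x) + ((g \- f) (x + h) - (g \- f) x)).
  exact: ler_normD.
by rewrite /=; ring.
Qed.

Lemma lipschitz_withN (L : R) f (g : R * R -> R) :
  lipschitz_with L (f \- g) -> lipschitz_with L (g \- f).
Proof. by move=> fg x h; rewrite distrC; have := fg x h; congr (`|_| <= _) => /=; ring. Qed.

Lemma lipschitz_withW (L M : R) f : L <= M -> lipschitz_with L f -> lipschitz_with M f.
Proof. by move=> LM fL x h; rewrite (le_trans (fL x h))// ler_wpM2r// enorm_ge0. Qed.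

Lemma lipschitz_with_lim (L : R) f : (forall e : R, 0 < e -> lipschitz_with (L + e) f) ->
  lipschitz_with L f.
Proof.
move=> H x h; apply/ler_addgt0Pl => e e0.
have h1 : 0 < enorm h + 1 by rewrite ltr_wpDl// enorm_ge0.
apply: (le_trans (H _ (divr_gt0 e0 h1) x h)).
rewrite mulrDl addrC lerD2r mulrAC ler_pdivrMr// ler_wpM2l ?lerDl//; exact: ltW.
Qed.

Section solution.
Context (rho1 rho2 s T : R) (f0 : R * R -> R) (f : R -> R * R -> R) (L : R).
Context (rho : rho1 < rho2) (s4 : 4 <= s) (sol : muskat_solution rho1 rho2 s T f0 f).
Context (L0 : 0 <= L) (L3 : L < 1 / 3) (initL : lipschitz_with L (f 0)).

(** The constant 1/3 enters only through the monotonicity of the kernel. The maximum principle with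
    bound L |h|, applied to h and to -h, then gives back the initial constant on the whole
    interval. *)
Lemma lipschitz_improvement (t1 : R) : t1 < T ->
  (forall t, 0 <= t <= t1 -> lipschitz_with (1 / 3) (f t)) ->
  forall t, 0 <= t <= t1 -> lipschitz_with L (f t).
Proof.
move=> t1T fL t tt1 x h.
have third : 5 * (1 / 3) ^+ 2 <= 1 :> R.
  by rewrite expr_div_n expr1n mulrA mulr1 ler_pdivrMr// mul1r -natrX ler_nat.
have H h' : forall x, shift_diff (f t) h' x <= L * enorm h'.
  move=> x'; apply: (shift_diff_max_principle rho s4 sol t1T fL third) => //.
    by rewrite mulr_ge0// enorm_ge0.
  by move=> y; rewrite (le_trans (ler_norm _))//; exact: initL.
have h1 := H h x; have := H (- h) (x + h); rewrite enormN /shift_diff addrK => h2.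
by rewrite ler_norml h1 andbT lerNl opprB.
Qed.

(** At the supremum a of the times up to which the bound L persists, continuity carries the weaker
    bound 1/3 a little beyond a, and [lipschitz_improvement] restores L there. *)
Lemma lipschitz_preserved_before (t : R) : 0 <= t < T -> lipschitz_with L (f t).
Proof.
move=> /andP[t0 tT]; apply: contrapT => ft.
pose S := [set u : R | 0 <= u < T /\ forall v, 0 <= v <= u -> lipschitz_with L (f v)].
have S0 : S 0.
  split; first by rewrite lexx (le_lt_trans t0).
  by move=> v v0; rewrite (_ : v = 0)//; apply/eqP; rewrite eq_le andbC.
have St : ubound S t.
  move=> u [_ Hu]; rewrite leNgt; apply/negP => tu; apply: ft; apply: Hu.
  by rewrite t0 ltW.
have supS : has_sup S by split; [exists 0|exists t].
set a := sup S.
have a0 : 0 <= a by apply: ub_le_sup => //; exists t.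
have at_ : a <= t by apply: ge_sup => //; exists 0.
have aT : 0 <= a <= T by rewrite a0 (le_trans at_)// ltW.
(* Half of the gap, because the path has two legs: from a time u of S to a, which is not known to be
   in S, and from a to the new time. *)
pose e : R := (1 / 3 - L) / 2.
have e0 : 0 < e by rewrite divr_gt0// subr_gt0.
have e3 : L + e + e = 1 / 3 by rewrite /e; field.
have [cf _ _] := sol.
have [d d0 Hd] := continuous_sobolev_uniform s4 cf aT e0.
have [u Su au] := sup_adherent d0 supS; rewrite -/a in au.
have [/andP[u0 uT] Hu] := Su.
have ua : u <= a by apply: ub_le_sup => //; exists t.
(* Strictly between a and both a + d and T; the midpoint of t and T works as a <= t < T. *)
pose t1 := Num.min (a + d / 2) ((t + T) / 2).
have t1T : t1 < T.
  by rewrite /t1 gt_min; apply/orP; right; rewrite midf_lt.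
have at1 : a < t1.
  rewrite /t1 lt_min ltrDl divr_gt0//= (le_lt_trans at_)//.
  by rewrite midf_lt.
have S1 : S t1.
  split; first by rewrite t1T (le_trans a0)// ltW.
  apply: lipschitz_improvement => // v /andP[v0 vt1].
  have [vu|uv] := leP v u.
    by apply: lipschitz_withW (Hu v _); [exact: ltW|rewrite v0].
  rewrite -e3; apply: (@lipschitz_withD _ _ (f a)); last first.
    apply: (Hd v _ _).2; first by rewrite v0 (le_trans vt1)// ltW.
    rewrite ltr_distl (lt_trans au)//= (le_lt_trans vt1)//.
    rewrite /t1 gt_min; apply/orP; left; rewrite ltrD2l ltr_pdivrMr// ltr_pMr// ltr1n//.
  apply: (@lipschitz_withD _ _ (f u)); first by apply: Hu; rewrite u0 lexx.
  apply: lipschitz_withN; apply: (Hd u _ _).2; first by rewrite u0 ltW.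
  by rewrite ltr_distl au/= (le_lt_trans ua)// ltrDl.
by have : t1 <= a by [apply: ub_le_sup => //; exists t]; rewrite leNgt at1.
Qed.

(** The equation is given only before T; the end time is reached by continuity in the Lipschitz
    seminorm. *)
Lemma lipschitz_preserved (t : R) : 0 <= t <= T -> lipschitz_with L (f t).
Proof.
move=> /andP[t0]; rewrite le_eqVlt => /orP[/eqP tE|tT]; last first.
  by apply: lipschitz_preserved_before; rewrite t0.
(* If T = 0 there is no earlier time to approach from, and the claim is the initial bound. *)
have [->//|t_neq0] := eqVneq t 0.
have {}t0 : 0 < t by rewrite lt_def t_neq0.
apply: lipschitz_with_lim => e e0; have [cf _ _] := sol.
have tT : 0 <= t <= T by rewrite ltW// tE lexx.
have [d d0 Hd] := continuous_sobolev_uniform s4 cf tT e0.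
pose u := Num.max 0 (t - d / 2).
have ut : u < t by rewrite /u gt_max t0 gtrBl divr_gt0.
have u0 : 0 <= u by rewrite /u le_max lexx.
apply: (@lipschitz_withD _ _ (f u)).
  by apply: lipschitz_preserved_before; rewrite u0 -tE.
apply: lipschitz_withN; apply: (Hd u _ _).2; first by rewrite u0 -tE ltW.
rewrite ltr_distl (lt_le_trans ut) ?lerDl ?(ltW d0)// andbT.
rewrite /u lt_max; apply/orP; right; rewrite ltrD2l ltrN2.
by rewrite ltr_pdivrMr// ltr_pMr// ltr1n.
Qed.

End solution.

End gradient_bound.

Theorem theorem4p1 (R : realType) (rho1 rho2 s : R) (f0 : R * R -> R)
    (hrho : rho1 < rho2) (hs : 4 <= s) (hf0 : sobolev s f0)
    (hgrad : (sup_grad f0 < (1 / 3)%:E)%E)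
    (T : R) (hT : 0 < T) (f : R -> R * R -> R)
    (hf : muskat_solution rho1 rho2 s T f0 f) :
  forall t : R, 0 < t <= T -> (sup_grad (f t) < (1 / 3)%:E)%E.
Proof.
move=> t /andP[t0 tT].
have [cf /funext f0E _] := hf.
have grad_le x : ((enorm (grad f0 x))%:E <= sup_grad f0)%E.
  by apply: ereal_sup_ubound; exists x.
have sup_fin : sup_grad f0 \is a fin_num.
  by rewrite fin_numE; move: (grad_le 0) hgrad; case: (sup_grad f0).
(* The supremum of the initial gradient itself is preserved, so the strict inequality survives
   taking the supremum at time t. *)
pose L : R := fine (sup_grad f0).
have LE : sup_grad f0 = L%:E by rewrite fineK.
rewrite LE in hgrad grad_le.
have L0 : 0 <= L by rewrite -lee_fin (le_trans _ (grad_le 0))// lee_fin enorm_ge0.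
have [K0 [_ _ _ f0C]] := sobolev_regular hs hf0.
have initL : lipschitz_with L (f 0) by rewrite f0E; apply: lipschitz_of_grad_le f0C _.
have t0T : 0 <= t <= T by rewrite ltW.
have [K [_ _ _ fC]] := sobolev_regular hs (cf t t0T).1.
apply: (le_lt_trans _ hgrad); apply: ge_ereal_sup => _ [x _ <-]; rewrite lee_fin.
rewrite lte_fin in hgrad; apply: (enorm_grad_le _ fC).
exact: lipschitz_preserved hrho hs hf L0 hgrad initL _ t0T.
Qed.
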